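(* The (edge) expansion of the associahedron graph $K_n$ on the triangulations of the convex $(n+2)$-gon is $\Omega\left(1/(\sqrt{n}\,\log n)\right)$ and $O(1/\sqrt{n})$, as $n\to\infty$.
   Context: Let $P_{n+2}$ be a convex polygon with $n+2$ vertices. The associahedron graph $K_n$ (also denoted $K_{3,n+2}$) has as vertices all triangulations of $P_{n+2}$ (maximal sets of pairwise non-crossing diagonals), with two triangulations adjacent if and only if they differ by a flip, i.e. one is obtained from the other by removing one diagonal and inserting the other diagonal of the quadrilateral formed by the two triangles containing it. The edge expansion (or expansion) of a finite graph $G=(V,E)$ is $h(G)=\min_{S\subseteq V,\,0<|S|\le |V|/2}|\partial S|/|S|$, where $\partial S$ is the set of edges with one endpoint in $S$ and the other in $V\setminus S$. *)

(* Defs.v *)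
From HB Require Import structures.
From mathcomp Require Import all_boot all_order all_algebra.
From mathcomp Require Import all_classical all_reals all_analysis.

Set Implicit Arguments.
Unset Strict Implicit.
Unset Printing Implicit Defensive.

Import Order.TTheory GRing.Theory Num.Theory.
Import numFieldNormedType.Exports.

Local Open Scope ring_scope.

(** * Triangulations of a convex polygon *)

(** The vertices of a convex [m]-gon are labelled by ['I_m] in cyclic order;
    a side or a diagonal is the set of its two endpoints. *)
Section Polygon.
Variable m : nat.
Implicit Types (d e t : {set 'I_m}) (D T : {set {set 'I_m}}).

Definition side e := [exists i : 'I_m, e == [set i; ordS i]].

Definition diagonal d := (#|d| == 2)%N && ~~ side d.

Definition interleave d e :=
  [exists a : 'I_m, exists b : 'I_m, exists c : 'I_m, exists f : 'I_m,
    [&& (a < b)%N, (b < c)%N, (c < f)%N, d == [set a; c] & e == [set b; f]]].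

(** Two diagonals of a convex polygon meet in their interiors iff their
    endpoints alternate along its boundary. *)
Definition crossing d e := interleave d e || interleave e d.

Definition noncrossing_diagonals D :=
  [forall d in D, diagonal d] &&
  [forall d in D, forall e in D, ~~ crossing d e].

Definition is_triangulation T := maxset noncrossing_diagonals T.

(** No vertex lies inside the polygon, so in a triangulation [T] any three
    vertices pairwise joined by sides or by diagonals of [T] bound one of the
    triangles into which [T] cuts the polygon. *)
Definition triangle T t :=
  (#|t| == 3)%N &&
  [forall e : {set 'I_m}, (e \subset t) && (#|e| == 2)%N ==>
     side e || (e \in T)].

(** [T'] is [T] with [d] replaced by the other diagonal of the quadrilateral
    [t1 :|: t2], where [t1] and [t2] are the two triangles containing [d]. *)
Definition flip T T' :=
  [exists d in T, exists t1 : {set 'I_m}, exists t2 : {set 'I_m},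
    [&& triangle T t1, triangle T t2, t1 != t2, d \subset t1, d \subset t2
      & T' == ((t1 :|: t2) :\: d) |: (T :\ d)]].

End Polygon.

(** * The associahedron graph *)

Definition triangulation n := {T : {set {set 'I_n.+2}} | is_triangulation T}.

Definition associahedron n : rel (triangulation n) :=
  fun T T' => flip (val T) (val T') || flip (val T') (val T).

(** * Edge expansion of the graph with adjacency relation [e] *)

Section Expansion.
Variables (R : realType) (V : finType) (e : rel V).

(** An edge leaving [S] is recorded as the pair (endpoint in [S], endpoint
    outside [S]). *)
Definition edge_boundary (S : {set V}) : {set V * V} :=
  [set p | [&& p.1 \in S, p.2 \notin S & e p.1 p.2]].

Definition expansion_set (S : {set V}) :=
  (0 < #|S|)%N && (#|S|.*2 <= #|V|)%N.

Definition edge_ratio (S : {set V}) : R := #|edge_boundary S|%:R / #|S|%:R.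

(** The minimum ratio; [S0] only witnesses that the range is nonempty. When
    [#|V| <= 1] there is no admissible set and the value is irrelevant. *)
Definition edge_expansion : R :=
  if [pick S0 | expansion_set S0] is Some S0
  then edge_ratio [arg min_(S < S0 | expansion_set S) edge_ratio S]%O
  else 0.

Lemma edge_expansion_min : (1 < #|V|)%N ->
  (exists2 S, expansion_set S & edge_expansion = edge_ratio S) /\
  (forall S, expansion_set S -> edge_expansion <= edge_ratio S).
Proof.
move=> V1; rewrite /edge_expansion; case: pickP => [S0 S0P|noS].
  by case: arg_minP => // S SP Smin; split=> //; exists S.
have /card_gt0P[x _] : (0 < #|V|)%N by apply: leq_trans V1.
by move: (noS [set x]%SET); rewrite /expansion_set cards1 /= V1.
Qed.

End Expansion.

(* Main.v *)
From HB Require Import structures.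
From mathcomp Require Import all_boot all_order all_algebra.
From mathcomp Require Import all_classical all_reals all_analysis.
From mathcomp Require Import fintype finset zify ring lra.
Require Import Defs.

(** A triangulation of the polygon with [n.+2] vertices, seen from the side
    [{0, n.+1}], is a binary tree with [n.+1] leaves, and flips are rotations.
    For a function [f] on the trees with [s] leaves, [energy s f] sums
    [|f T - f T'|] over the ordered pairs of trees that differ by a flip, and
    [mean_dev (trees s) f] sums the deviations of [f] from its mean. For the
    indicator of a set [S] with at most half of the trees, the energy is twice
    the size of the edge boundary and the deviation is at least [#|S| / 2]. So
    the lower bound follows from an L1 Poincare inequality,

      [mean_dev (trees s) f <= K * sqrt s * energy s f]   ([tree_poincare]),

    which gives an expansion of order at least [1 / sqrt n], without the
    logarithm.

    The inequality rests on three steps.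

    - Sort the trees by the size [i] of the left subtree. The amounts of [f] in
      these classes differ from the proportional ones by at most the energy in
      total, with constant one ([root_dev_le_energy]). Indeed, to equalize two
      classes one must exchange at most as much as there are flips between
      them, because the Catalan numbers are log-convex. These flips join trees
      that are not proportionally distributed inside their classes, but that
      is the same problem in the subtrees, and its contributions are weighted
      with coefficients of oscillation at most one; so nothing is lost in the
      induction.

    - Mark three sides of the polygon, at mutual distances of one third. Every
      triangulation has exactly one triangle [x < y < z] that separates them
      ([sum_separating_triangle]), and given this triangle the rest is a
      triple of independent trees. The first step, in the three polygons
      around the triangle, compares the means of [f] over the classes of two
      triangles that share a side, through the quadrilateral they span
      ([low_moves_energy] and its two companions). It remains to bound the
      deviation of a function of [x], [y], [z] by its variation when one vertex
      moves, for weights that are products of [j ^ (- 3 / 2)] over the three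
      arcs, with a constant of order [sqrt N] ([separating_poincare]). When the
      three arcs are long, the vertices are moved one at a time, uniformly. A
      triangle with a short side is first transported: both ends of that side
      move outwards by about [M] times its length ([corner_deviation]). The
      image of the weight under this transport is at most a constant times
      [M ^ (- 1 / 2)] of the weight itself, so for large [M] it is absorbed.

    - Inside the classes the inequality is applied to trees with at most three
      quarters of the leaves ([mean_dev_step]). The costs [sqrt s] of the
      successive scales form a geometric series.

    For the upper bound, cut the trees according to whether the middle vertex
    [y] of the separating triangle lies in the first half of its range
    ([sparse_cut]). Each part has of order [4 ^ s * s ^ (- 3 / 2)] trees, a
    positive proportion, whereas only of order [4 ^ s * s ^ (- 2)] flips
    exchange [y] for a vertex of the other half. *)

Set Implicit Arguments.
Unset Strict Implicit.
Unset Printing Implicit Defensive.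

Import Order.TTheory GRing.Theory Num.Theory.
Import numFieldNormedType.Exports.

Local Open Scope ring_scope.

(* Numerals are iterated sums of [1]; these facts keep them folded. *)
#[local] Hint Extern 0 (is_true (0 <= _%:R)) => (apply: ler0n) : core.
#[local] Hint Extern 0 (is_true (0 < _%:R)) => (rewrite ltr0n; reflexivity) : core.

(** * Binary trees with a given number of leaves *)

Inductive tree := Leaf | Node of tree & tree.

Fixpoint tree_eqb (S T : tree) :=
  match S, T with
  | Leaf, Leaf => true
  | Node A B, Node A' B' => tree_eqb A A' && tree_eqb B B'
  | _, _ => false
  end.

Lemma tree_eqbP : Equality.axiom tree_eqb.
Proof.
elim=> [|A IA B IB] [|A' B'] /=; try by constructor.
apply: (iffP andP) => [[/IA-> /IB->]//|[<- <-]].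
by split; [apply/IA|apply/IB].
Qed.

HB.instance Definition _ := hasDecEq.Build tree tree_eqbP.

Fixpoint leaves (T : tree) : nat :=
  if T is Node A B then (leaves A + leaves B)%N else 1%N.

Lemma leaves_gt0 T : (0 < leaves T)%N.
Proof. by elim: T => //= A IA B IB; rewrite addn_gt0 IA. Qed.

(** The recursion is on a bound [m] for the number of leaves [j]. *)
Fixpoint bounded_trees (m j : nat) : seq tree :=
  if m is m'.+1 then
    if j == 1%N then [:: Leaf] else
    flatten [seq [seq Node A B | A <- bounded_trees m' i,
                                 B <- bounded_trees m' (j - i)%N]
            | i <- iota 1 j.-1]
  else [::].

Definition trees j := bounded_trees j j.

Lemma bounded_treesE m j : (j <= m)%N -> bounded_trees m j = trees j.
Proof.
rewrite /trees.
have [k] := ubnP j; elim: k => // k IH in m j *; rewrite ltnS => jk jm.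
case: j => [|j] in jk jm *; first by case: m jm.
case: m jm => // m jm /=; case: eqP => // _.
congr flatten; apply/eq_in_map => i; rewrite mem_iota => /andP[i0 ij].
by rewrite !(IH m) ?(IH j) //; lia.
Qed.

Lemma trees1 : trees 1 = [:: Leaf]. Proof. by []. Qed.

Lemma treesE j : (1 < j)%N -> trees j =
  flatten [seq [seq Node A B | A <- trees i, B <- trees (j - i)%N]
          | i <- iota 1 j.-1].
Proof.
case: j => [|[|j]] // _; rewrite {1}/trees.
transitivity (flatten [seq [seq Node A B | A <- bounded_trees j.+1 i,
                                 B <- bounded_trees j.+1 (j.+2 - i)%N]
            | i <- iota 1 j.+2.-1]); first by [].
congr flatten; apply/eq_in_map => i; rewrite mem_iota => /andP[i0 ij].
by rewrite !(@bounded_treesE j.+1) //; lia.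
Qed.

Lemma big_trees (V : nmodType) j (phi : tree -> V) : (1 < j)%N ->
  \sum_(T <- trees j) phi T =
  \sum_(1 <= i < j) \sum_(A <- trees i) \sum_(B <- trees (j - i)) phi (Node A B).
Proof.
move=> j1; rewrite treesE // big_flatten big_map /index_iota subn1.
by apply: eq_bigr => i _; rewrite big_allpairs_dep.
Qed.

Lemma mem_trees T j : (T \in trees j) = (leaves T == j).
Proof.
elim: T j => [|A IA B IB] j.
  case: j => [|[|j]] //; rewrite treesE //; apply/flatten_mapP.
  by case=> i _ /allpairsP[[A B] []].
have AB2 : (1 < leaves (Node A B))%N.
  by rewrite /= (leq_add (leaves_gt0 A) (leaves_gt0 B)).
case: j => [|[|j]]; first by case: (leaves _) AB2.
  by rewrite trees1 inE gtn_eqF.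
rewrite treesE //; apply/flatten_mapP/eqP => [[i]|AB].
  rewrite mem_iota => ij /allpairsP[[A' B'] /= [+ + [AA BB]]].
  by rewrite -AA -BB IA IB => /eqP-> /eqP->; lia.
rewrite /= in AB; exists (leaves A).
  by rewrite mem_iota; have := leaves_gt0 A; have := leaves_gt0 B; lia.
apply/allpairsP; exists (A, B); split=> //=.
  by rewrite IA.
by rewrite IB -AB addnC addnK.
Qed.

Lemma mem_leaves T i : T \in trees i -> leaves T = i.
Proof. by rewrite mem_trees => /eqP. Qed.

Lemma trees_uniq j : uniq (trees j).
Proof.
have [k] := ubnP j; elim: k => // k IH in j *; rewrite ltnS => jk.
case: j => [|[|j]] // in jk *; rewrite treesE //.
have : forall i, i \in iota 1 j.+1 -> (0 < i <= j.+1)%N.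
  by move=> i; rewrite mem_iota; lia.
have : uniq (iota 1 j.+1) by exact: iota_uniq.
rewrite [j.+2.-1]/=; elim: (iota 1 j.+1) => //= i s IHs /andP[is_ us] si.
rewrite cat_uniq; apply/and3P; split.
- apply: allpairs_uniq; [apply: IH|apply: IH|by move=> [A B] [A' B'] _ _ [-> ->]];
  by have := si i (mem_head _ _); lia.
- apply/hasPn => T /flatten_mapP[i' i's /allpairsP[[A B] /= [Ai' _ ->]]].
  apply/negP => /allpairsP[[A' B'] /= [Ai _ [AA' _]]].
  move: Ai' Ai; rewrite AA' !mem_trees => /eqP-> /eqP ii.
  by rewrite -ii i's in is_.
- by apply: IHs => // i' i's; apply: si; rewrite inE i's orbT.
Qed.

Lemma trees_size_gt0 j : (0 < j)%N -> (0 < size (trees j))%N.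
Proof.
case: j => // j _; rewrite -has_predT; apply/hasP.
exists (iter j (Node Leaf) Leaf) => //; rewrite mem_trees.
by elim: j => //= j /eqP ->.
Qed.

Section Counting.
Variable R : realFieldType.

Definition ntrees j : R := (size (trees j))%:R.

Lemma sum_cst (I : Type) (s : seq I) (c : R) :
  \sum_(x <- s) c = (size s)%:R * c.
Proof. by rewrite big_const_seq iter_addr_0 count_predT mulr_natl. Qed.

Lemma ntrees1 : ntrees 1 = 1. Proof. by []. Qed.

Lemma ntrees_conv j : (1 < j)%N ->
  ntrees j = \sum_(1 <= i < j) ntrees i * ntrees (j - i).
Proof.
move=> j1; rewrite -[ntrees j]mulr1 -sum_cst big_trees //.
by apply: eq_bigr => i _; rewrite !sum_cst mulr1.
Qed.

Lemma ntrees_ge0 j : 0 <= ntrees j. Proof. exact: ler0n. Qed.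

Lemma ntrees_gt0 j : (0 < j)%N -> 0 < ntrees j.
Proof. by move=> j0; rewrite /ntrees ltr0n trees_size_gt0. Qed.

(** Both sides count trees with [j.+1] leaves and a marked leaf: deleting the
    leaf marks one of the [2 j - 1] vertices of a smaller tree, on one of
    whose two sides the leaf was attached. Here it follows from the common
    convolution recurrence of the two sides. *)
Lemma ntreesS j : (0 < j)%N ->
  (j.+1)%:R * ntrees j.+1 = 2 * (2 * j%:R - 1) * ntrees j.
Proof.
pose L j : R := j%:R * ntrees j; pose V j : R := (2 * j%:R - 1) * ntrees j.
have symm (k : nat) (F G : nat -> R) :
    \sum_(1 <= i < k) F i * G (k - i)%N = \sum_(1 <= i < k) G i * F (k - i)%N.
  case: k => [|k]; first by rewrite !big_geq.
  rewrite [RHS]big_nat_rev /= !big_nat; apply: eq_bigr => i ik.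
  have -> : (1 + k.+1 - i.+1)%N = (k.+1 - i)%N by lia.
  by rewrite mulrC; congr (_ * F _); lia.
have Lrec k : (1 < k)%N -> L k = 2 * \sum_(1 <= i < k) L i * ntrees (k - i).
  move=> k1; rewrite /L ntrees_conv // mulr_sumr mulr_natl mulr2n.
  rewrite [in X in _ = _ + X]symm -big_split /= !big_nat; apply: eq_bigr => i ik.
  have -> : (k%:R : R) = i%:R + (k - i)%:R by rewrite -natrD subnKC //; lia.
  by ring.
have Vrec k : (1 < k)%N ->
    V k = ntrees k + 2 * \sum_(1 <= i < k) V i * ntrees (k - i).
  move=> k1; rewrite /V [2 * \sum_(_ <= _ < _) _]mulr_natl mulr2n.
  rewrite [in X in _ = _ + (_ + X)]symm ntrees_conv //.
  rewrite -!big_split mulr_sumr /= !big_nat; apply: eq_bigr => i ik.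
  have -> : (k%:R : R) = i%:R + (k - i)%:R by rewrite -natrD subnKC //; lia.
  by rewrite /=; ring.
rewrite -mulrA -/(L _) -/(V _).
have [k] := ubnP j; elim: k => // k IH in j *; rewrite ltnS => jk j0.
rewrite Lrec; last lia.
case: j => [|[|j]] // in jk j0 *.
  by rewrite big_nat1 /L /V subSS subn0 ntrees1; ring.
rewrite Vrec // big_nat_recl // {1}/L ntrees1 subSS subn0 !mul1r.
congr (_ * (_ + _)); rewrite mulr_sumr !big_nat; apply: eq_bigr => i ij.
by rewrite IH; [rewrite subSS mulrA|lia|lia].
Qed.

(** The ratio [2 (2 j - 1) / (j + 1)] of consecutive Catalan numbers increases
    with [j]. *)
Lemma ntrees_log_convex a b c : (0 < a)%N -> (0 < b)%N -> (0 < c)%N ->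
  ntrees (b + c) * ntrees (a + b) <= ntrees b * ntrees (a + b + c).
Proof.
move=> a0 b0 c0.
have ratio k l : (0 < k)%N -> (k <= l)%N ->
    ntrees k.+1 * ntrees l <= ntrees k * ntrees l.+1.
  move=> k0 kl.
  have k1 : (0 : R) < k.+1%:R by rewrite ltr0n.
  have l1 : (0 : R) < l.+1%:R by rewrite ltr0n.
  rewrite -(ler_pM2l k1) -(ler_pM2r l1).
  have -> : k.+1%:R * (ntrees k.+1 * ntrees l) * l.+1%:R =
     2 * (ntrees k * ntrees l) * ((2 * k%:R - 1) * (l%:R + 1)).
    by rewrite mulrA ntreesS // -[l.+1%:R]natr1; ring.
  have -> : k.+1%:R * (ntrees k * ntrees l.+1) * l.+1%:R =
     2 * (ntrees k * ntrees l) * ((2 * l%:R - 1) * (k%:R + 1)).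
    transitivity (k.+1%:R * ntrees k * (l.+1%:R * ntrees l.+1)); first by ring.
    by rewrite ntreesS ?(leq_trans k0) // -[k.+1%:R]natr1; ring.
  apply: ler_wpM2l; first by rewrite !mulr_ge0 ?ntrees_ge0.
  by have : (k%:R : R) <= l%:R by [rewrite ler_nat]; lra.
elim: c c0 => // c IH _; case: c => [|c] in IH *.
  rewrite addn1 [ntrees b.+1 * _]mulrC [leRHS]mulrC !addn1 mulrC.
  by rewrite [leRHS]mulrC; apply: ratio; lia.
have bc : 0 < ntrees (b + c.+1) by apply: ntrees_gt0; lia.
rewrite -(ler_pM2l bc).
have := ratio (b + c.+1)%N (a + b + c.+1)%N; rewrite -!addnS => h.
have {h} h1 := h ltac:(lia) ltac:(lia); have h2 := IH isT.
apply: le_trans (_ : ntrees b * (ntrees (b + c.+2) * ntrees (a + b + c.+1)) <= _).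
  by rewrite mulrCA [leRHS]mulrCA; apply: ler_wpM2l; rewrite ?ntrees_ge0.
by rewrite [leRHS]mulrCA; apply: ler_wpM2l; rewrite ?ntrees_ge0.
Qed.

End Counting.

(** * Flips of trees and transport between root classes *)

Definition rotations_left A B :=
  if B is Node B1 B2 then [:: Node (Node A B1) B2] else [::].
Definition rotations_right A B :=
  if A is Node A1 A2 then [:: Node A1 (Node A2 B)] else [::].

Fixpoint flips (T : tree) : seq tree :=
  if T is Node A B then
    [seq Node A' B | A' <- flips A] ++ [seq Node A B' | B' <- flips B] ++
    rotations_left A B ++ rotations_right A B
  else [::].

Section TriangularSums.
Variable R : realFieldType.

Lemma sum_upper_lower (V : nmodType) (m j : nat) (F : nat -> nat -> V) :
  \sum_(m <= i < j) \sum_(i.+1 <= k < j) F i k =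
  \sum_(m <= k < j) \sum_(m <= i < k) F i k.
Proof.
transitivity (\sum_(m <= i < j) \sum_(m <= k < j | (i < k)%N) F i k).
  rewrite !big_nat; apply: eq_bigr => i /andP[mi ij].
  by rewrite (big_nat_widenl i.+1 m) // ltnW.
rewrite (exchange_big_dep predT) //= !big_nat; apply: eq_bigr => k /andP[mk kj].
by rewrite (big_nat_widen m k j) // ltnW.
Qed.

Lemma sum_antisym (j : nat) (s : nat -> R) (c : nat -> nat -> R) :
  (forall i k, c i k = - c k i) ->
  \sum_(1 <= i < j) \sum_(1 <= k < j) s i * c i k =
  \sum_(1 <= i < j) \sum_(i.+1 <= k < j) (s i - s k) * c i k.
Proof.
move=> ca.
have split3 i : (1 <= i < j)%N -> \sum_(1 <= k < j) s i * c i k =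
    \sum_(i.+1 <= k < j) s i * c i k + \sum_(1 <= k < i) s i * c i k.
  move=> /andP[i1 ij]; rewrite (@big_cat_nat _ _ _ i) ?(ltnW ij) //=.
  rewrite addrC (big_ltn ij).
  have -> : c i i = 0 by have := ca i i; lra.
  by rewrite mulr0 add0r.
rewrite big_nat (eq_bigr _ split3) -big_nat big_split /=.
rewrite -(@sum_upper_lower _ 1 j (fun i k => s k * c k i)) -big_split /=.
apply: eq_bigr => i _; rewrite -big_split /=; apply: eq_bigr => k _.
by rewrite [c k i]ca; ring.
Qed.

(** A factor may be shifted by a constant when the other one has sum zero;
    centred, it is at most one half. *)
Lemma sum_oscillation_le (m n : nat) (tau D : nat -> R) (t : R) :
  (forall k, (m <= k < n)%N -> t <= tau k <= t + 1) ->
  \sum_(m <= k < n) D k = 0 ->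
  2 * \sum_(m <= k < n) tau k * D k <= \sum_(m <= k < n) `|D k|.
Proof.
move=> taub D0.
have -> : \sum_(m <= k < n) tau k * D k =
          \sum_(m <= k < n) (tau k - t - 2^-1) * D k.
  transitivity (\sum_(m <= k < n) tau k * D k
                - (t + 2^-1) * \sum_(m <= k < n) D k).
    by rewrite D0 mulr0 subr0.
  rewrite mulr_sumr -sumrB; apply: eq_bigr => k _; ring.
rewrite mulr_sumr !big_nat; apply: ler_sum => k /taub tk.
apply: le_trans (ler_norm _) _; rewrite !normrM [`|2|]ger0_norm // mulrA.
rewrite -[leRHS]mul1r ler_wpM2r //.
have : `|tau k - t - 2^-1| <= 2^-1 by rewrite ler_norml; lra.
by lra.
Qed.

End TriangularSums.

(** [S i] is an amount carried by class [i], of mass [w i * w (j - i)]. Between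
    the classes [i < k] run [w i * w (k - i) * w (j - k)] flips; [g i k] and
    [h i k] are the amounts seen at their two ends, and [Dg], [Dh] compare them
    with the proportional shares of [S i] and [S k]. What must be exchanged
    between two classes in order to equalize them is at most the number of
    flips between them, by log-convexity. The coefficients that [Dg i k] and
    [Dh i k] get in this exchange have oscillation at most one in [k] and in
    [i], and [sum_oscillation_le] then costs no constant. *)
Section RootTransport.
Variable R : realFieldType.
Variables (j : nat) (w S : nat -> R) (g h : nat -> nat -> R).

Let mass i := w i * w (j - i)%N.
Let mu := (\sum_(1 <= k < j) S k) / w j.
Let Dg i k := g i k - w (k - i)%N * w (j - k)%N / w (j - i)%N * S i.
Let Dh i k := h i k - w i * w (k - i)%N / w k * S k.

Hypothesis w_gt0 : forall i, (0 < i)%N -> 0 < w i.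
Hypothesis w_logconvex : forall i k, (0 < i < k)%N -> (k < j)%N ->
  w (j - i)%N * w k <= w (k - i)%N * w j.
Hypothesis w_mass : (1 < j)%N -> \sum_(1 <= i < j) mass i = w j.
Hypothesis Dg_sum : forall i, (0 < i < j)%N -> \sum_(i.+1 <= k < j) Dg i k = 0.
Hypothesis Dh_sum : forall k, (0 < k < j)%N -> \sum_(1 <= i < k) Dh i k = 0.

Lemma root_transport :
  \sum_(1 <= i < j) `|S i - mass i * mu| <=
  2 * (\sum_(1 <= i < j) \sum_(i.+1 <= k < j) `|g i k - h i k|)
  + \sum_(1 <= i < j) \sum_(i.+1 <= k < j) `|Dg i k|
  + \sum_(1 <= k < j) \sum_(1 <= i < k) `|Dh i k|.
Proof.
case: (leqP j 1) => [j1|j1].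
  by rewrite !big_geq // mulr0 !addr0.
have wj : 0 < w j by apply: w_gt0; lia.
pose D i := S i - mass i * mu.
have Dsum : \sum_(1 <= i < j) D i = 0.
  rewrite sumrB -mulr_suml w_mass // /mu mulrCA divff ?mulr1 ?subrr //.
  by rewrite gt_eqF.
pose s i : R := if 0 < D i then 1 else 0.
have sb i : 0 <= s i <= 1 by rewrite /s; case: ifP; rewrite ?ler01 ?lexx.
pose c i k := (mass k * S i - mass i * S k) / w j.
have absD : \sum_(1 <= i < j) `|D i| = 2 * \sum_(1 <= i < j) s i * D i.
  transitivity (\sum_(1 <= i < j) `|D i| + \sum_(1 <= i < j) D i).
    by rewrite Dsum addr0.
  rewrite -big_split mulr_sumr; apply: eq_bigr => i _ /=.
  rewrite /s; case: (ltrP 0 (D i)) => Di /=.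
    by rewrite gtr0_norm //; lra.
  by rewrite ler0_norm //; lra.
have -> : \sum_(1 <= i < j) `|S i - mass i * mu| = 2 *
    \sum_(1 <= i < j) \sum_(i.+1 <= k < j) (s i - s k) * c i k.
  rewrite -(sum_antisym j s (c := c)); last by move=> i k; rewrite /c; ring.
  rewrite -[LHS]/(\sum_(1 <= i < j) `|D i|) absD; congr (_ * _).
  apply: eq_bigr => i _; rewrite -mulr_sumr; congr (_ * _).
  rewrite /c -mulr_suml sumrB -mulr_suml -mulr_sumr w_mass // /D /mu.
  by field; rewrite gt_eqF.
pose r i k := w (j - i)%N * w k / (w (k - i)%N * w j).
have rb i k : (0 < i < k)%N -> (k < j)%N -> 0 <= r i k <= 1.
  move=> ik kj.
  have p1 : 0 < w (k - i)%N * w j by rewrite mulr_gt0 ?w_gt0 //; lia.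
  have p2 : 0 < w (j - i)%N * w k by rewrite mulr_gt0 ?w_gt0 //; lia.
  rewrite divr_ge0 ?(ltW p1) ?(ltW p2) //=.
  by rewrite ler_pdivrMr // mul1r w_logconvex.
have cE i k : (0 < i < k)%N -> (k < j)%N ->
    (s i - s k) * c i k = (s i - s k) * r i k * - Dg i k
     + (s i - s k) * r i k * (g i k - h i k) + (s i - s k) * r i k * Dh i k.
  move=> ik kj; rewrite -!mulrDr -mulrA; congr (_ * _).
  rewrite /c /r /Dg /Dh /mass; field.
  by rewrite !gt_eqF ?w_gt0 //; lia.
(* Intervals of length one: this keeps the constant of the later induction
     equal to one. *)
have tau_range i k : (0 < i < k)%N -> (k < j)%N ->
    (s i - 1 <= (s i - s k) * r i k <= s i) /\
    (- s k <= (s i - s k) * r i k <= 1 - s k).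
  move=> ik kj; have := rb _ _ ik kj; have := sb i; have := sb k.
  move: (s i) (s k) (r i k) => x y z /andP[y0 y1] /andP[x0 x1] /andP[z0 z1].
  have : 0 <= (1 - z) * x by rewrite mulr_ge0 // subr_ge0.
  have : 0 <= (1 - z) * (1 - x) by rewrite mulr_ge0 // subr_ge0.
  have : 0 <= (1 - z) * y by rewrite mulr_ge0 // subr_ge0.
  have : 0 <= (1 - z) * (1 - y) by rewrite mulr_ge0 // subr_ge0.
  have : 0 <= z * x by rewrite mulr_ge0.
  have : 0 <= z * (1 - x) by rewrite mulr_ge0 // subr_ge0.
  have : 0 <= z * y by rewrite mulr_ge0.
  have : 0 <= z * (1 - y) by rewrite mulr_ge0 // subr_ge0.
  by split; lra.
have -> : \sum_(1 <= i < j) \sum_(i.+1 <= k < j) (s i - s k) * c i k =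
    \sum_(1 <= i < j) \sum_(i.+1 <= k < j) (s i - s k) * r i k * - Dg i k
  + \sum_(1 <= i < j) \sum_(i.+1 <= k < j) (s i - s k) * r i k * (g i k - h i k)
  + \sum_(1 <= i < j) \sum_(i.+1 <= k < j) (s i - s k) * r i k * Dh i k.
  rewrite -!big_split /= !big_nat; apply: eq_bigr => i /andP[i0 ij].
  rewrite -!big_split /= !big_nat; apply: eq_bigr => k /andP[ik kj].
  by rewrite cE ?i0.
rewrite !mulrDr [2 * _ + 2 * _]addrC.
apply: lerD; first apply: lerD.
- rewrite ler_pM2l // !big_nat; apply: ler_sum => i /andP[i0 ij].
  rewrite !big_nat; apply: ler_sum => k /andP[ik kj].
  apply: le_trans (ler_norm _) _; rewrite normrM -[leRHS]mul1r ler_wpM2r //.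
  have [] := tau_range i k; rewrite ?i0 // ler_norml.
  by have := sb i; lra.
- rewrite mulr_sumr !big_nat; apply: ler_sum => i ij.
  under [leRHS]eq_bigr do rewrite -normrN.
  apply: (sum_oscillation_le (t := s i - 1)).
    move=> k /andP[ik kj]; have [] := tau_range i k; last lra.
      by case/andP: ij => ->.
    by [].
  by rewrite sumrN Dg_sum ?oppr0.
- rewrite sum_upper_lower mulr_sumr !big_nat; apply: ler_sum => k kj.
  apply: (sum_oscillation_le (t := - s k)) (Dh_sum kj) => i ik.
  by have [] := tau_range i k; [lia|lia|lra].
Qed.

End RootTransport.

(** * The energy of a function on trees *)

Section Energy.
Variable R : realFieldType.
Implicit Types (f : tree -> R) (i j k : nat).

Definition gradient f T := \sum_(T' <- flips T) `|f T - f T'|.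
Definition energy j f := \sum_(T <- trees j) gradient f T.
Definition tree_mean j f := (\sum_(T <- trees j) f T) / ntrees R j.
Definition root_sum f i k :=
  \sum_(A <- trees i) \sum_(B <- trees k) f (Node A B).
Definition root_dev j f := \sum_(1 <= i < j)
  `|root_sum f i (j - i) - ntrees R i * ntrees R (j - i) * tree_mean j f|.

Lemma gradient_ge0 f T : 0 <= gradient f T.
Proof. by apply: sumr_ge0. Qed.

Lemma energy_ge0 j f : 0 <= energy j f.
Proof. by apply: sumr_ge0 => T _; exact: gradient_ge0. Qed.

Definition left_rotation_diff f A B :=
  if B is Node B1 B2 then `|f (Node A B) - f (Node (Node A B1) B2)| else 0.
Definition right_rotation_diff f A B :=
  if A is Node A1 A2 then `|f (Node A B) - f (Node A1 (Node A2 B))| else 0.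

Lemma gradient_Node f A B : gradient f (Node A B) =
  gradient (fun X => f (Node X B)) A + gradient (fun X => f (Node A X)) B +
  left_rotation_diff f A B + right_rotation_diff f A B.
Proof.
rewrite /gradient /= !big_cat !big_map /= !addrA; congr (_ + _ + _ + _).
- by case: B => [|B1 B2]; rewrite ?big_nil ?big_seq1.
- by case: A => [|A1 A2]; rewrite ?big_nil ?big_seq1.
Qed.

Definition root_flip_diff j f i k :=
  \sum_(A <- trees i) \sum_(B <- trees (k - i)) \sum_(C <- trees (j - k))
    `|f (Node A (Node B C)) - f (Node (Node A B) C)|.

Lemma big_trees_Leaf0 (V : nmodType) k (phi : tree -> V) : phi Leaf = 0 ->
  \sum_(T <- trees k) phi T =
  \sum_(1 <= i < k) \sum_(A <- trees i) \sum_(B <- trees (k - i)) phi (Node A B).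
Proof.
move=> phi0; case: k => [|[|k]]; last exact: big_trees.
  by rewrite big_nil big_geq.
by rewrite big_seq1 big_geq.
Qed.

Lemma sum_shift (V : nmodType) i j (F : nat -> V) :
  \sum_(i.+1 <= k < j) F k = \sum_(1 <= m < j - i) F (m + i)%N.
Proof. by rewrite -[i.+1]add1n big_addn. Qed.

Lemma energy_rec j f : (1 < j)%N -> energy j f =
  \sum_(1 <= i < j) \sum_(B <- trees (j - i)) energy i (fun X => f (Node X B)) +
  \sum_(1 <= i < j) \sum_(A <- trees i) energy (j - i) (fun X => f (Node A X)) +
  2 * \sum_(1 <= i < j) \sum_(i.+1 <= k < j) root_flip_diff j f i k.
Proof.
move=> j1; rewrite /energy big_trees //.
under eq_bigr do under eq_bigr do under eq_bigr do rewrite gradient_Node.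
under eq_bigr do under eq_bigr do rewrite !big_split /=.
under eq_bigr do rewrite !big_split /=.
rewrite !big_split /= -!addrA; congr (_ + _).
  by apply: eq_bigr => i _; rewrite exchange_big.
congr (_ + _); rewrite mulr_natl mulr2n; congr (_ + _).
  rewrite !big_nat; apply: eq_bigr => i /andP[i0 ij].
  rewrite /root_flip_diff [RHS]exchange_big /=; apply: eq_bigr => A _.
  rewrite big_trees_Leaf0 // [RHS]sum_shift; apply: eq_bigr => m _.
  by rewrite addnK addnC subnDA.
rewrite sum_upper_lower !big_nat; apply: eq_bigr => k /andP[k0 kj].
rewrite exchange_big /=.
under eq_bigr do rewrite big_trees_Leaf0 //.
rewrite exchange_big /= !big_nat; apply: eq_bigr => i /andP[i0 ik].
rewrite /root_flip_diff [LHS]exchange_big /=; apply: eq_bigr => A _.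
rewrite [LHS]exchange_big /=; apply: eq_bigr => B _; apply: eq_bigr => C _.
by rewrite distrC.
Qed.

Lemma root_sum_total j f : (1 < j)%N ->
  \sum_(1 <= i < j) root_sum f i (j - i) = \sum_(T <- trees j) f T.
Proof. by move=> j1; rewrite big_trees. Qed.

Lemma root_dev_sum0 j f : \sum_(1 <= i < j)
  (root_sum f i (j - i) - ntrees R i * ntrees R (j - i) * tree_mean j f) = 0.
Proof.
case: (ltnP 1 j) => j1; last by rewrite big_geq.
rewrite sumrB root_sum_total // -mulr_suml -ntrees_conv // /tree_mean.
by rewrite mulrCA divff ?mulr1 ?subrr // gt_eqF // ntrees_gt0 // ltnW.
Qed.

(** Redistributing the mean over the classes of trees with a given root costs
    no more than the energy: the number of flips between two classes is at
    least the amount to be exchanged ([ntrees_log_convex]), and what this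
    leaves to redistribute within the subtrees has coefficients of oscillation
    at most one, so that the induction closes with constant one. *)
Theorem root_dev_le_energy j f : root_dev j f <= energy j f.
Proof.
have [n] := ubnP j; elim: n => // n IH in j f *; rewrite ltnS => jn.
case: (ltnP 1 j) => j1; last by rewrite /root_dev big_geq ?energy_ge0.
rewrite /root_dev {1}/tree_mean -root_sum_total //.
pose S i := root_sum f i (j - i).
pose g i k := \sum_(A <- trees i) root_sum (fun X => f (Node A X)) (k - i) (j - k).
pose h i k := \sum_(C <- trees (j - k)) root_sum (fun X => f (Node X C)) i (k - i).
have DgE i k : (i < k < j)%N -> g i k -
    ntrees R (k - i) * ntrees R (j - k) / ntrees R (j - i) * S i =
    \sum_(A <- trees i) (root_sum (fun X => f (Node A X)) (k - i) (j - k) -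
      ntrees R (k - i) * ntrees R (j - k) *
      tree_mean (j - i) (fun X => f (Node A X))).
  move=> ik; rewrite sumrB -mulr_sumr /tree_mean -mulr_suml; congr (_ - _).
  by rewrite -mulrA [_^-1 * _]mulrC.
have DhE i k : (i < k < j)%N -> h i k -
    ntrees R i * ntrees R (k - i) / ntrees R k * S k =
    \sum_(C <- trees (j - k)) (root_sum (fun X => f (Node X C)) i (k - i) -
      ntrees R i * ntrees R (k - i) * tree_mean k (fun X => f (Node X C))).
  move=> ik; rewrite sumrB -mulr_sumr /tree_mean -mulr_suml; congr (_ - _).
  by rewrite -mulrA [_^-1 * _]mulrC /S /root_sum exchange_big.
have sub_sub i m : ((j - (m + i)) = (j - i) - m)%N by rewrite addnC subnDA.
apply: le_trans (root_transport (j := j) (w := ntrees R) (S := S) (g := g)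
  (h := h) _ _ _ _ _) _.
- by move=> i; exact: ntrees_gt0.
- move=> i k /andP[i0 ik] kj.
  have := @ntrees_log_convex R i (k - i) (j - k) i0.
  have -> : (k - i + (j - k) = j - i)%N by lia.
  rewrite (subnKC (ltnW ik)) (subnKC (ltnW kj)) !subn_gt0 => lc.
  exact: lc.
- by move=> _; rewrite [RHS]ntrees_conv.
- move=> i /andP[i0 ij]; rewrite big_nat.
  under eq_bigr => k ikj do rewrite DgE //.
  rewrite -big_nat exchange_big big1 //= => A _; rewrite sum_shift.
  under eq_bigr do rewrite addnK sub_sub.
  exact: root_dev_sum0.
- move=> k /andP[k0 kj]; have ikj i : (1 <= i < k)%N -> (i < k < j)%N by lia.
  rewrite big_nat (eq_bigr _ (fun i ik => DhE i k (ikj i ik))).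
  by rewrite -big_nat exchange_big big1 //= => C _; exact: root_dev_sum0.
rewrite energy_rec // [leRHS]addrC -addrA; apply: lerD; last rewrite addrC.
  rewrite ler_pM2l // !big_nat; apply: ler_sum => i /andP[i0 ij].
  rewrite !big_nat; apply: ler_sum => k /andP[ik kj].
  have -> : g i k - h i k = \sum_(A <- trees i) \sum_(B <- trees (k - i))
     \sum_(C <- trees (j - k)) (f (Node A (Node B C)) - f (Node (Node A B) C)).
    rewrite /h exchange_big /g -sumrB; apply: eq_bigr => A _.
    rewrite /root_sum [X in _ - X]exchange_big /= -sumrB; apply: eq_bigr => B _.
    by rewrite -sumrB.
  do 3! (apply: le_trans (ler_norm_sum _ _ _) _; apply: ler_sum => ? _).
  by [].
apply: lerD.
  rewrite !big_nat; apply: ler_sum => k /andP[k0 kj].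
  apply: le_trans (_ : \sum_(C <- trees (j - k))
     root_dev k (fun X => f (Node X C)) <= _).
    rewrite exchange_big !big_nat /=; apply: ler_sum => i /andP[i0 ik].
    by rewrite DhE ?ik //; exact: ler_norm_sum.
  by apply: ler_sum => C _; apply: IH; lia.
rewrite !big_nat; apply: ler_sum => i /andP[i0 ij].
apply: le_trans (_ : \sum_(A <- trees i)
   root_dev (j - i) (fun X => f (Node A X)) <= _).
  rewrite sum_shift exchange_big !big_nat /=; apply: ler_sum => m mj.
  rewrite DgE; last lia.
  by rewrite addnK sub_sub; exact: ler_norm_sum.
by apply: ler_sum => A _; apply: IH; lia.
Qed.

End Energy.

(** * The triangle that separates three sides *)

(** A tree is a triangulation of the polygon formed by its leaves and a root
    side; [P] triangulates what lies beyond the chord that is the root side of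
    [S], seen from that chord, and its leaf [k] is the root side of the whole
    polygon. *)
Fixpoint attach (P : tree) (k : nat) (S : tree) : tree :=
  if P is Node A B then
    if (k < leaves A)%N then attach A k (Node B S)
    else attach B (k - leaves A) (Node S A)
  else S.

Lemma leaves_flips T T' : T' \in flips T -> leaves T' = leaves T.
Proof.
elim: T T' => [|A IA B IB] T' //=.
rewrite !mem_cat => /or4P[/mapP[A' /IA lA ->]|/mapP[B' /IB lB ->]||] /=.
- by rewrite lA.
- by rewrite lB.
- by case: B {IB} => // B1 B2; rewrite inE => /eqP-> /=; rewrite addnA.
- by case: A {IA} => // A1 A2; rewrite inE => /eqP-> /=; rewrite addnA.
Qed.

Section Attach.
Variable R : realFieldType.
Implicit Types (f : tree -> R).

Lemma eq_gradient f g T :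
  (forall T', leaves T' = leaves T -> f T' = g T') -> gradient f T = gradient g T.
Proof.
move=> fg; rewrite /gradient !big_seq; apply: eq_bigr => T' /leaves_flips TT'.
by rewrite !fg.
Qed.

(** The flip of the chord between [P] and [S]: beyond it lies the triangle at
    the root of [P]. *)
Definition chord_flip_diff f P k S :=
  if P is Node A B then
    if S is Node L M then
      if (k < leaves A)%N then
        `|f (attach A k (Node B S)) - f (attach A k (Node (Node B L) M))|
      else `|f (attach B (k - leaves A) (Node S A)) -
             f (attach B (k - leaves A) (Node L (Node M A)))|
    else 0
  else 0.

(** The diagonals of [attach P k S] are those of [P], those of [S] and the
    chord between them. *)
Lemma gradient_attach f P k S : gradient f (attach P k S) =
  gradient (fun X => f (attach X k S)) P + gradient (fun X => f (attach P k X)) S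
  + chord_flip_diff f P k S.
Proof.
elim: P k S => [|A IA B IB] k S.
  by rewrite /= {2}/gradient /= big_nil add0r addr0.
rewrite [attach _ _ _]/=; case: ltnP => kA.
  rewrite IA !gradient_Node.
  have -> : gradient (fun X => f (attach (Node X B) k S)) A =
            gradient (fun X => f (attach X k (Node B S))) A.
    by apply: eq_gradient => A' lA /=; rewrite lA kA.
  have -> : gradient (fun X => f (attach (Node A X) k S)) B =
            gradient (fun X => f (attach A k (Node X S))) B.
    by apply: eq_gradient => B' lB /=; rewrite kA.
  have -> : gradient (fun X => f (attach (Node A B) k X)) S =
            gradient (fun X => f (attach A k (Node B X))) S.
    by apply: eq_gradient => S' lS /=; rewrite kA.
  have -> : left_rotation_diff (fun X => f (attach A k X)) B S =
            chord_flip_diff f (Node A B) k S.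
    by rewrite /=; case: S {IA IB} => //= L M; rewrite kA.
  have -> : right_rotation_diff (fun X => f (attach A k X)) B S =
            left_rotation_diff (fun X => f (attach X k S)) A B.
    by case: B {IA IB} => //= B1 B2; rewrite kA ltn_addr ?kA.
  have -> : chord_flip_diff f A k (Node B S) =
            right_rotation_diff (fun X => f (attach X k S)) A B.
    case: A kA {IA IB} => //= A1 A2 kA; rewrite kA.
    case: ltnP => // kA1; case: ifP => //; lia.
  by ring.
rewrite IB !gradient_Node.
have kAF : (k < leaves A)%N = false by rewrite ltnNge kA.
have -> : gradient (fun X => f (attach (Node X B) k S)) A =
          gradient (fun X => f (attach B (k - leaves A) (Node S X))) A.
  by apply: eq_gradient => A' lA /=; rewrite lA kAF.
have -> : gradient (fun X => f (attach (Node A X) k S)) B =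
          gradient (fun X => f (attach X (k - leaves A) (Node S A))) B.
  by apply: eq_gradient => B' lB /=; rewrite kAF.
have -> : gradient (fun X => f (attach (Node A B) k X)) S =
          gradient (fun X => f (attach B (k - leaves A) (Node X A))) S.
  by apply: eq_gradient => S' lS /=; rewrite kAF.
have -> : right_rotation_diff (fun X => f (attach B (k - leaves A) X)) S A =
          chord_flip_diff f (Node A B) k S.
  by rewrite /=; case: S {IA IB} => //= L M; rewrite kAF.
have -> : left_rotation_diff (fun X => f (attach B (k - leaves A) X)) S A =
          right_rotation_diff (fun X => f (attach X k S)) A B.
  case: A kA kAF {IA IB} => //= A1 A2 kA kAF; rewrite kAF.
  have -> : (k < leaves A1)%N = false by lia.
  have -> : (k - leaves A1 < leaves A2)%N = false by lia.
  by rewrite subnDA.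
have -> : chord_flip_diff f B (k - leaves A) (Node S A) =
          left_rotation_diff (fun X => f (attach X k S)) A B.
  case: B {IA IB} => //= B1 B2; rewrite kAF.
  have -> : (k < leaves A + leaves B1)%N = (k - leaves A < leaves B1)%N by lia.
  by case: ifP => _; rewrite ?kAF ?subnDA.
by ring.
Qed.

End Attach.

Section Separation.
Variables (V : zmodType) (s : nat) (phi : tree -> V).

(** Sum over the triangulations that contain the triangle [x < y < z]; the
    leaves of a tree with [s] leaves are the sides [(i, i.+1)] with [i < s],
    and its root side is [(0, s)]. *)
Definition triangle_sum x y z :=
  \sum_(P <- trees (s - z + x).+1) \sum_(L <- trees (y - x))
     \sum_(M <- trees (z - y)) phi (attach P (s - z) (Node L M)).

Let chord_sum x z :=
  \sum_(P <- trees (s - z + x).+1) \sum_(S <- trees (z - x))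
     phi (attach P (s - z) S).

Lemma chord_sum_inner x z : (x.+1 < z)%N ->
  chord_sum x z = \sum_(x.+1 <= y < z) triangle_sum x y z.
Proof.
move=> xz; rewrite /chord_sum /triangle_sum [RHS]exchange_big /=.
apply: eq_bigr => P _; rewrite big_trees; last lia.
rewrite [RHS]sum_shift; apply: eq_bigr => m _; rewrite addnK.
by rewrite addnC subnDA.
Qed.

(** Sorting by the triangle beyond the chord [(x, z)]; there is none beyond the
    root side [(0, s)]. *)
Lemma chord_sum_outer x z : (x < z)%N -> (z <= s)%N ->
  chord_sum x z = (if (x == 0)%N && (z == s) then \sum_(T <- trees s) phi T else 0)
  + \sum_(0 <= x' < x) triangle_sum x' x z
  + \sum_(z.+1 <= z' < s.+1) triangle_sum x z z'.
Proof.
move=> xz zs; case: ifP => [/andP[/eqP-> /eqP->]|xzs].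
  by rewrite !big_geq // !addr0 /chord_sum subnn addn0 big_seq1 subn0.
rewrite add0r /chord_sum big_trees; last lia.
rewrite (@big_cat_nat _ _ _ (s - z).+1) //=; last lia.
rewrite addrC; congr (_ + _).
  (* the root side lies in the left subtree *)
  have -> : ((s - z + x).+1 = x.+1 + (s - z))%N by lia.
  rewrite sum_shift addnK big_add1 /=.
  apply: eq_big_nat => x' /andP[_ xx'].
  rewrite /triangle_sum.
  have -> : (x.+1 + (s - z) - (x'.+1 + (s - z)) = x - x')%N by lia.
  have -> : (x'.+1 + (s - z) = (s - z + x').+1)%N by lia.
  rewrite !big_seq; apply: eq_bigr => P1 /mem_leaves lP1.
  apply: eq_bigr => P2 _; apply: eq_bigr => S _ /=.
  by rewrite lP1 ltnS leq_addr.
rewrite [RHS]sum_shift subSn //; apply: eq_big_nat => i /andP[i0 iz].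
rewrite /triangle_sum addnK exchange_big /=.
have -> : ((s - z + x).+1 - i = (s - (i + z) + x).+1)%N by lia.
apply: eq_bigr => P2 _; rewrite exchange_big /=.
apply: eq_bigr => S _; rewrite !big_seq; apply: eq_bigr => P1 /mem_leaves lP1.
rewrite /= lP1 ltnNge -ltnS iz /=.
by rewrite addnC subnDA.
Qed.

(** Counting the pairs of a tree and a chord that separates the root side
    from the sides [(a.-1, a)] and [(b.-1, b)], once by the triangle on either
    side of the chord: all triangles occur equally often, except for the one
    that separates the three sides. *)
Lemma sum_separating_triangle a b : (0 < a < b)%N -> (b <= s)%N ->
  \sum_(T <- trees s) phi T =
  \sum_(0 <= x < a) \sum_(a <= y < b) \sum_(b <= z < s.+1) triangle_sum x y z.
Proof.
move=> /andP[a0 ab] bs.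
pose below := \sum_(0 <= x < a) \sum_(b <= z < s.+1) \sum_(x.+1 <= y < a)
  triangle_sum x y z.
pose above := \sum_(0 <= x < a) \sum_(b <= z < s.+1) \sum_(b <= y < z)
  triangle_sum x y z.
pose total := \sum_(0 <= x < a) \sum_(b <= z < s.+1) chord_sum x z.
have inner : total = below + \sum_(0 <= x < a) \sum_(a <= y < b)
    \sum_(b <= z < s.+1) triangle_sum x y z + above.
  rewrite -!big_split; apply: eq_big_nat => x /andP[_ xa] /=.
  rewrite [X in _ + X + _]exchange_big -!big_split.
  apply: eq_big_nat => z /andP[bz zs] /=.
  rewrite chord_sum_inner; last lia.
  rewrite (@big_cat_nat _ _ _ a) //=; last lia.
  by rewrite (@big_cat_nat _ _ _ b a) ?addrA //; lia.
have outer : total = \sum_(T <- trees s) phi T + below + above.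
  transitivity (\sum_(0 <= x < a) \sum_(b <= z < s.+1)
     ((if (x == 0)%N && (z == s) then \sum_(T <- trees s) phi T else 0)
  + \sum_(0 <= x' < x) triangle_sum x' x z
  + \sum_(z.+1 <= z' < s.+1) triangle_sum x z z')).
    apply: eq_big_nat => x /andP[_ xa]; apply: eq_big_nat => z /andP[bz zs].
    by apply: chord_sum_outer; lia.
  under eq_bigr do rewrite !big_split /=.
  rewrite !big_split /=; congr (_ + _ + _).
  - rewrite big_ltn // big_nat_recr //= eqxx.
    have -> : \sum_(b <= z < s)
        (if z == s then \sum_(T <- trees s) phi T else 0) = 0.
      by rewrite big_nat big1 // => z /andP[_ zs]; rewrite (ltn_eqF zs).
    rewrite add0r [X in _ + X]big_nat [X in _ + X]big1 ?addr0 // => x /andP[x0 _].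
    by rewrite big1 // => z _; rewrite (gtn_eqF x0).
  - rewrite /below; under [RHS]eq_bigr do rewrite exchange_big /=.
    by rewrite sum_upper_lower; apply: eq_bigr => x _; rewrite exchange_big.
  - by apply: eq_bigr => x _; rewrite sum_upper_lower.
apply: (addIr below); apply: (addIr above).
by rewrite -outer inner [below + _]addrC.
Qed.

End Separation.

(** * Flips around a triangle *)

Section Triangles.
Variables (R : realFieldType) (s : nat) (f : tree -> R).
Local Notation n := (ntrees R).

Definition triangle_weight x y z : R := n (s - z + x).+1 * n (y - x) * n (z - y).
Definition triangle_mean x y z := triangle_sum s f x y z / triangle_weight x y z.
Definition quad_weight x u v z : R :=
  n (s - z + x).+1 * n (u - x) * n (v - u) * n (z - v).

(** The two ways to cut the quadrilateral [x < u < v < z], by the diagonal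
    [(x, v)] or by [(u, z)]. *)
Definition quad_sum_low x u v z :=
  \sum_(P <- trees (s - z + x).+1) \sum_(A <- trees (u - x))
  \sum_(B <- trees (v - u)) \sum_(C <- trees (z - v))
    f (attach P (s - z) (Node (Node A B) C)).
Definition quad_sum_high x u v z :=
  \sum_(P <- trees (s - z + x).+1) \sum_(A <- trees (u - x))
  \sum_(B <- trees (v - u)) \sum_(C <- trees (z - v))
    f (attach P (s - z) (Node A (Node B C))).
Definition quad_diff x u v z :=
  \sum_(P <- trees (s - z + x).+1) \sum_(A <- trees (u - x))
  \sum_(B <- trees (v - u)) \sum_(C <- trees (z - v))
    `|f (attach P (s - z) (Node (Node A B) C)) -
      f (attach P (s - z) (Node A (Node B C)))|.

Lemma quad_diff_ge0 x u v z : 0 <= quad_diff x u v z.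
Proof. by do 4! (apply: sumr_ge0 => ? _). Qed.

Lemma quad_sum_diff x u v z :
  `|quad_sum_low x u v z - quad_sum_high x u v z| <= quad_diff x u v z.
Proof.
rewrite /quad_sum_low /quad_sum_high /quad_diff -sumrB.
apply: le_trans (ler_norm_sum _ _ _) _; apply: ler_sum => P _; rewrite -sumrB.
apply: le_trans (ler_norm_sum _ _ _) _; apply: ler_sum => A _; rewrite -sumrB.
apply: le_trans (ler_norm_sum _ _ _) _; apply: ler_sum => B _; rewrite -sumrB.
exact: ler_norm_sum.
Qed.

(** The parts of the energy that come from flips in one of the three polygons
    around the triangle [x < y < z]. *)
Definition energy_outer x y z :=
  \sum_(L <- trees (y - x)) \sum_(M <- trees (z - y))
    energy (s - z + x).+1 (fun P => f (attach P (s - z) (Node L M))).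
Definition energy_left x y z :=
  \sum_(P <- trees (s - z + x).+1) \sum_(M <- trees (z - y))
    energy (y - x) (fun L => f (attach P (s - z) (Node L M))).
Definition energy_right x y z :=
  \sum_(P <- trees (s - z + x).+1) \sum_(L <- trees (y - x))
    energy (z - y) (fun M => f (attach P (s - z) (Node L M))).

Lemma triangle_weight_gt0 x y z : (x < y < z)%N -> 0 < triangle_weight x y z.
Proof.
by move=> /andP[xy yz]; rewrite !mulr_gt0 ?ntrees_gt0 ?subn_gt0.
Qed.

(** [root_dev_le_energy] in the polygon that the side [(x, y)] cuts off: the
    root classes there are given by the third vertex of the triangle beyond
    that side. *)
Lemma left_deviation x y z : (x < y < z)%N -> \sum_(x.+1 <= u < y)
  `|quad_sum_low x u y z - quad_weight x u y z * triangle_mean x y z|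
  <= energy_left x y z.
Proof.
move=> xyz; pose phi P M L := f (attach P (s - z) (Node L M)).
apply: le_trans (_ : \sum_(P <- trees (s - z + x).+1) \sum_(M <- trees (z - y))
   root_dev (y - x) (phi P M) <= _); last first.
  by apply: ler_sum => P _; apply: ler_sum => M _; exact: root_dev_le_energy.
rewrite /root_dev; under [leRHS]eq_bigr do rewrite exchange_big.
rewrite [leRHS]exchange_big /= sum_shift; apply: ler_sum => m _.
have -> : quad_sum_low x (m + x) y z
   - quad_weight x (m + x) y z * triangle_mean x y z =
   \sum_(P <- trees (s - z + x).+1) \sum_(M <- trees (z - y))
    (root_sum (phi P M) m (y - x - m) -
     n m * n (y - x - m) * tree_mean (y - x) (phi P M)).
  under [RHS]eq_bigr do rewrite sumrB -mulr_sumr -mulr_suml.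
  rewrite sumrB -mulr_sumr -mulr_suml; congr (_ - _).
    rewrite /quad_sum_low addnK [(m + x)%N]addnC subnDA; apply: eq_bigr => P _.
    rewrite [RHS]exchange_big; apply: eq_bigr => A _ /=.
    by rewrite [RHS]exchange_big.
  rewrite /quad_weight /triangle_mean /triangle_weight addnK [(m + x)%N]addnC.
  rewrite subnDA.
  have -> : \sum_(P <- trees (s - z + x).+1) \sum_(M <- trees (z - y))
     \sum_(L <- trees (y - x)) phi P M L = triangle_sum s f x y z.
    by apply: eq_bigr => P _; rewrite exchange_big.
  have := triangle_weight_gt0 xyz; rewrite /triangle_weight.
  rewrite !pmulr_lgt0 ?ntrees_gt0 ?subn_gt0 //; try lia; move=> _.
  by field; rewrite !gt_eqF ?ntrees_gt0 //; lia.
do 2! (apply: le_trans (ler_norm_sum _ _ _) _; apply: ler_sum => ? _).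
by [].
Qed.

Lemma right_deviation x y z : (x < y < z)%N -> \sum_(y.+1 <= v < z)
  `|quad_sum_high x y v z - quad_weight x y v z * triangle_mean x y z|
  <= energy_right x y z.
Proof.
move=> xyz; pose phi P L M := f (attach P (s - z) (Node L M)).
apply: le_trans (_ : \sum_(P <- trees (s - z + x).+1) \sum_(L <- trees (y - x))
   root_dev (z - y) (phi P L) <= _); last first.
  by apply: ler_sum => P _; apply: ler_sum => L _; exact: root_dev_le_energy.
rewrite /root_dev; under [leRHS]eq_bigr do rewrite exchange_big.
rewrite [leRHS]exchange_big /= sum_shift; apply: ler_sum => m _.
have -> : quad_sum_high x y (m + y) z
   - quad_weight x y (m + y) z * triangle_mean x y z =
   \sum_(P <- trees (s - z + x).+1) \sum_(L <- trees (y - x))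
    (root_sum (phi P L) m (z - y - m) -
     n m * n (z - y - m) * tree_mean (z - y) (phi P L)).
  under [RHS]eq_bigr do rewrite sumrB -mulr_sumr -mulr_suml.
  rewrite sumrB -mulr_sumr -mulr_suml; congr (_ - _).
    by rewrite /quad_sum_high addnK [(m + y)%N]addnC subnDA.
  rewrite /quad_weight /triangle_mean /triangle_weight addnK [(m + y)%N]addnC.
  rewrite subnDA.
  have -> : \sum_(P <- trees (s - z + x).+1) \sum_(L <- trees (y - x))
     \sum_(M <- trees (z - y)) phi P L M = triangle_sum s f x y z by [].
  by field; rewrite !gt_eqF ?ntrees_gt0 //; lia.
do 2! (apply: le_trans (ler_norm_sum _ _ _) _; apply: ler_sum => ? _).
by [].
Qed.

(** In the polygon beyond [(x, z)] the root side [(0, s)] is one of the leaves,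
    so the third vertex may lie below [x] or above [z]. *)
Lemma outer_deviation x y z : (x < y < z)%N -> (z <= s)%N ->
  \sum_(0 <= x' < x)
    `|quad_sum_high x' x y z - quad_weight x' x y z * triangle_mean x y z| +
  \sum_(z.+1 <= z' < s.+1)
    `|quad_sum_low x y z z' - quad_weight x y z z' * triangle_mean x y z|
  <= energy_outer x y z.
Proof.
move=> xyz zs; pose phi L M P := f (attach P (s - z) (Node L M)).
pose p := (s - z + x).+1.
pose D i := \sum_(L <- trees (y - x)) \sum_(M <- trees (z - y))
    (root_sum (phi L M) i (p - i) - n i * n (p - i) * tree_mean p (phi L M)).
apply: le_trans (_ : \sum_(1 <= i < p) `|D i| <= _); last first.
  apply: le_trans (_ : \sum_(L <- trees (y - x)) \sum_(M <- trees (z - y))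
     root_dev p (phi L M) <= _); last first.
    by apply: ler_sum => L _; apply: ler_sum => M _; exact: root_dev_le_energy.
  rewrite /root_dev; under [leRHS]eq_bigr do rewrite exchange_big.
  rewrite [leRHS]exchange_big /=; apply: ler_sum => i _.
  do 2! (apply: le_trans (ler_norm_sum _ _ _) _; apply: ler_sum => ? _).
  by [].
have DE i : D i = \sum_(L <- trees (y - x)) \sum_(M <- trees (z - y))
    root_sum (phi L M) i (p - i) -
    n i * n (p - i) * n (y - x) * n (z - y) * triangle_mean x y z.
  rewrite /D; under eq_bigr do rewrite sumrB -mulr_sumr -mulr_suml.
  rewrite sumrB -mulr_sumr -mulr_suml; congr (_ - _).
  rewrite /triangle_mean /triangle_weight.
  have -> : \sum_(L <- trees (y - x)) \sum_(M <- trees (z - y))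
     \sum_(P <- trees p) phi L M P = triangle_sum s f x y z.
    rewrite /triangle_sum [RHS]exchange_big; apply: eq_bigr => L _ /=.
    by rewrite [RHS]exchange_big.
  by rewrite /p; field; rewrite !gt_eqF ?ntrees_gt0 //; lia.
have kp : ((s - z).+1 <= p)%N by rewrite ltnS leq_addr.
rewrite [leRHS](@big_cat_nat _ _ _ (s - z).+1) //=.
rewrite [leLHS]addrC; apply: lerD.
  rewrite [leLHS]sum_shift subSn // !big_nat; apply: ler_sum => i /andP[i0 iz].
  rewrite DE le_eqVlt; apply/orP; left; apply/eqP; congr (`|_ - _|).
    rewrite /quad_sum_low addnK.
    have -> : ((s - (i + z) + x).+1 = p - i)%N by rewrite /p; lia.
    rewrite exchange_big; apply: eq_bigr => L _ /=.
    rewrite exchange_big; apply: eq_bigr => M _ /=.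
    rewrite /root_sum exchange_big !big_seq; apply: eq_bigr => P1 /mem_leaves lP1.
    apply: eq_bigr => P2 _; rewrite /phi /= lP1 ltnNge -ltnS iz /=.
    by rewrite [(i + z)%N]addnC subnDA.
  rewrite /quad_weight addnK.
  have -> : ((s - (i + z) + x).+1 = p - i)%N by rewrite /p; lia.
  by rewrite -/n; ring.
have -> : p = (x.+1 + (s - z))%N by rewrite /p; lia.
rewrite [leRHS]sum_shift addnK [leRHS]big_add1 /= !big_nat; apply: ler_sum => x' /andP[_ xx'].
rewrite DE le_eqVlt; apply/orP; left; apply/eqP; congr (`|_ - _|).
  rewrite /quad_sum_high.
  have -> : (p - (x'.+1 + (s - z)) = x - x')%N by rewrite /p; lia.
  have -> : (x'.+1 + (s - z) = (s - z + x').+1)%N by lia.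
  under [RHS]eq_bigr do rewrite exchange_big /=.
  rewrite [RHS]exchange_big !big_seq /=; apply: eq_bigr => P1 /mem_leaves lP1.
  under [RHS]eq_bigr do rewrite exchange_big /=.
  rewrite [RHS]exchange_big /=; apply: eq_bigr => P2 _.
  apply: eq_bigr => L _; apply: eq_bigr => M _.
  by rewrite /phi /= lP1 ltnS leq_addr.
rewrite /quad_weight.
have -> : (p - (x'.+1 + (s - z)) = x - x')%N by rewrite /p; lia.
by have -> : (x'.+1 + (s - z) = (s - z + x').+1)%N by lia.
Qed.

(** Every flip at a tree of the class of [x < y < z] is a flip in one of the
    three outer polygons or removes a side of the triangle. *)
Lemma triangle_sum_gradient x y z : (x < y < z)%N -> (z <= s)%N ->
  triangle_sum s (gradient f) x y z =
  energy_outer x y z + energy_left x y z + energy_right x y z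
  + \sum_(x.+1 <= u < y) quad_diff x u y z
  + \sum_(y.+1 <= v < z) quad_diff x y v z
  + (\sum_(0 <= x' < x) quad_diff x' x y z
     + \sum_(z.+1 <= z' < s.+1) quad_diff x y z z').
Proof.
move=> xyz zs; rewrite /triangle_sum.
pose k := (s - z)%N; pose p := (s - z + x).+1.
transitivity (\sum_(P <- trees p) \sum_(L <- trees (y - x)) \sum_(M <- trees (z - y))
  (gradient (fun X => f (attach X k (Node L M))) P +
  (gradient (fun X => f (attach P k (Node X M))) L +
   gradient (fun X => f (attach P k (Node L X))) M +
   left_rotation_diff (fun X => f (attach P k X)) L M +
   right_rotation_diff (fun X => f (attach P k X)) L M) +
  chord_flip_diff f P k (Node L M))).
  apply: eq_bigr => P _; apply: eq_bigr => L _; apply: eq_bigr => M _.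
  by rewrite gradient_attach gradient_Node.
under eq_bigr do under eq_bigr do rewrite !big_split /=.
under eq_bigr do rewrite !big_split /=.
rewrite !big_split /=.
have -> : \sum_(P <- trees p) \sum_(L <- trees (y - x)) \sum_(M <- trees (z - y))
    gradient (fun X => f (attach X k (Node L M))) P = energy_outer x y z.
  rewrite exchange_big; apply: eq_bigr => L _ /=.
  by rewrite exchange_big.
have -> : \sum_(P <- trees p) \sum_(L <- trees (y - x)) \sum_(M <- trees (z - y))
    gradient (fun X => f (attach P k (Node X M))) L = energy_left x y z.
  by apply: eq_bigr => P _; rewrite exchange_big.
have -> : \sum_(P <- trees p) \sum_(L <- trees (y - x)) \sum_(M <- trees (z - y))
    gradient (fun X => f (attach P k (Node L X))) M = energy_right x y z.
  by [].
have -> : \sum_(P <- trees p) \sum_(L <- trees (y - x)) \sum_(M <- trees (z - y))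
    left_rotation_diff (fun X => f (attach P k X)) L M =
    \sum_(y.+1 <= v < z) quad_diff x y v z.
  rewrite [RHS]exchange_big; apply: eq_bigr => P _ /=.
  rewrite [RHS]exchange_big; apply: eq_bigr => L _ /=.
  rewrite big_trees_Leaf0 // [RHS]sum_shift; apply: eq_bigr => m _.
  rewrite addnK [(m + y)%N]addnC subnDA; apply: eq_bigr => B _.
  by apply: eq_bigr => C _; rewrite distrC.
have -> : \sum_(P <- trees p) \sum_(L <- trees (y - x)) \sum_(M <- trees (z - y))
    right_rotation_diff (fun X => f (attach P k X)) L M =
    \sum_(x.+1 <= u < y) quad_diff x u y z.
  rewrite [RHS]exchange_big; apply: eq_bigr => P _ /=.
  rewrite big_trees_Leaf0; last by rewrite big1.
  rewrite [RHS]sum_shift; apply: eq_bigr => m _.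
  by rewrite addnK [(m + x)%N]addnC subnDA.
have -> : \sum_(P <- trees p) \sum_(L <- trees (y - x)) \sum_(M <- trees (z - y))
    chord_flip_diff f P k (Node L M) =
    \sum_(0 <= x' < x) quad_diff x' x y z
     + \sum_(z.+1 <= z' < s.+1) quad_diff x y z z'; last by ring.
rewrite big_trees_Leaf0; last by rewrite big1 // => L _; rewrite big1.
have kp : (k.+1 <= p)%N by rewrite ltnS leq_addr.
rewrite [LHS](@big_cat_nat _ _ _ k.+1) //= addrC; congr (_ + _).
  have pE : p = (x.+1 + k)%N by rewrite /p /k; lia.
  rewrite {1}pE sum_shift addnK big_add1 /= !big_nat.
  apply: eq_bigr => x' /andP[_ xx'].
  rewrite /quad_diff.
  have -> : (p - (x'.+1 + k) = x - x')%N by rewrite pE; lia.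
  have -> : (x'.+1 + k = (s - z + x').+1)%N by rewrite /k; lia.
  rewrite !big_seq; apply: eq_bigr => P1 /mem_leaves lP1.
  apply: eq_bigr => P2 _; apply: eq_bigr => L _; apply: eq_bigr => M _.
  by rewrite /= lP1 ltnS leq_addr distrC.
rewrite [RHS]sum_shift subSn // !big_nat; apply: eq_bigr => i /andP[i0 ik].
rewrite /quad_diff addnK.
have -> : (p - i = (s - (i + z) + x).+1)%N by rewrite /p; lia.
rewrite exchange_big /=; apply: eq_bigr => P2 _.
transitivity (\sum_(P1 <- trees i) \sum_(L <- trees (y - x)) \sum_(M <- trees (z - y))
  `|f (attach P2 (s - (i + z)) (Node (Node L M) P1))
  - f (attach P2 (s - (i + z)) (Node L (Node M P1)))|).
  rewrite !big_seq; apply: eq_bigr => P1 /mem_leaves lP1.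
  apply: eq_bigr => L _; apply: eq_bigr => M _.
  by rewrite lP1 ltnNge -ltnS ik /= [(i + z)%N]addnC subnDA.
by rewrite exchange_big; apply: eq_bigr => L _; rewrite exchange_big.
Qed.

End Triangles.

(** * Deviation from the mean *)

Section MeanDeviation.
Variable R : realFieldType.

Definition mean (I : Type) (s : seq I) (F : I -> R) : R :=
  (\sum_(i <- s) F i) / (size s)%:R.
Definition mean_dev (I : Type) (s : seq I) (F : I -> R) : R :=
  \sum_(i <- s) `|F i - mean s F|.

Lemma mean_dev_ge0 (I : Type) (s : seq I) (F : I -> R) : 0 <= mean_dev s F.
Proof. exact: sumr_ge0. Qed.

Lemma mean_cstB (I : Type) (s : seq I) (F : I -> R) (c : R) : (0 < size s)%N ->
  (size s)%:R * (c - mean s F) = \sum_(i <- s) (c - F i).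
Proof.
move=> s0; rewrite sumrB big_const_seq iter_addr_0 count_predT mulr_natl.
by rewrite mulrnBl /mean -[_ / _ *+ _]mulr_natr divfK ?pnatr_eq0 -?lt0n.
Qed.

Lemma norm_sub_mean (I : Type) (s : seq I) (F : I -> R) (c : R) : (0 < size s)%N ->
  (size s)%:R * `|c - mean s F| <= \sum_(i <- s) `|c - F i|.
Proof.
move=> s0; rewrite -[X in X * _](@ger0_norm _ (size s)%:R) // -normrM mean_cstB //.
exact: ler_norm_sum.
Qed.

Lemma mean_dev_pairs (I : Type) (s : seq I) (F : I -> R) :
  (size s)%:R * mean_dev s F <= \sum_(i <- s) \sum_(j <- s) `|F i - F j|.
Proof.
case: (posnP (size s)) => [/size0nil ->|s0].
  by rewrite /mean_dev !big_nil mulr0.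
by rewrite mulr_sumr; apply: ler_sum => i _; exact: norm_sub_mean.
Qed.

Lemma size_mean (I : Type) (s : seq I) (F : I -> R) : (0 < size s)%N ->
  (size s)%:R * mean s F = \sum_(i <- s) F i.
Proof. by move=> s0; rewrite mulrC divfK // pnatr_eq0 -lt0n. Qed.

Lemma mean_exchange (I J : Type) (s : seq I) (t : seq J) (F : I -> J -> R) :
  mean s (fun x => mean t (F x)) = mean t (fun y => mean s (F^~ y)).
Proof. by rewrite /mean -!mulr_suml exchange_big mulrAC. Qed.

Lemma size_mean2 (I J : Type) (s : seq I) (t : seq J) (F : I -> J -> R) :
  (0 < size s)%N -> (0 < size t)%N ->
  (size s * size t)%:R * mean s (fun x => mean t (F x)) =
  \sum_(x <- s) \sum_(y <- t) F x y.
Proof.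
move=> s0 t0; rewrite mulnC natrM -mulrA size_mean // mulr_sumr.
by apply: eq_bigr => x _; rewrite size_mean.
Qed.

(** One coordinate is averaged at a time; averaging over the others does not
    increase the deviation in a coordinate. *)
Lemma mean_dev_product2 (I J : Type) (s : seq I) (t : seq J) (F : I -> J -> R) :
  (0 < size t)%N ->
  \sum_(x <- s) \sum_(y <- t) `|F x y - mean s (fun x' => mean t (F x'))| <=
  \sum_(x <- s) mean_dev t (F x) + \sum_(y <- t) mean_dev s (F^~ y).
Proof.
move=> t0; set m := mean s _.
apply: le_trans (_ : \sum_(x <- s) \sum_(y <- t)
   (`|F x y - mean t (F x)| + `|mean t (F x) - m|) <= _).
  by apply: ler_sum => x _; apply: ler_sum => y _; exact: ler_distD.
under eq_bigr do rewrite big_split /=; rewrite big_split lerD2l /=.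
have mE x : (size t)%:R * (mean t (F x) - m) =
    \sum_(y <- t) (F x y - mean s (F^~ y)).
  by rewrite /m mean_exchange mulrBr !size_mean // sumrB.
apply: le_trans (_ : \sum_(x <- s) `|\sum_(y <- t) (F x y - mean s (F^~ y))| <= _).
  apply: ler_sum => x _; rewrite -mE normrM ger0_norm //.
  by rewrite sum_cst.
rewrite [leRHS]exchange_big /=; apply: ler_sum => x _; exact: ler_norm_sum.
Qed.

Lemma mean_dev_product3 (I J K : Type) (s : seq I) (t : seq J) (u : seq K)
    (F : I -> J -> K -> R) : (0 < size t)%N -> (0 < size u)%N ->
  \sum_(x <- s) \sum_(y <- t) \sum_(z <- u)
    `|F x y z - mean s (fun x' => mean t (fun y' => mean u (F x' y')))| <=
  \sum_(x <- s) \sum_(y <- t) mean_dev u (F x y) +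
  \sum_(x <- s) \sum_(z <- u) mean_dev t (fun y => F x y z) +
  \sum_(y <- t) \sum_(z <- u) mean_dev s (fun x => F x y z).
Proof.
move=> t0 u0; set m := mean s _; pose G x := mean t (fun y => mean u (F x y)).
apply: le_trans (_ : \sum_(x <- s) \sum_(y <- t) \sum_(z <- u)
   (`|F x y z - G x| + `|G x - m|) <= _).
  by do 3! (apply: ler_sum => ? _); exact: ler_distD.
under eq_bigr do under eq_bigr do rewrite big_split /=.
under eq_bigr do rewrite big_split /=; rewrite big_split; apply: lerD => /=.
  rewrite -big_split; apply: ler_sum => x _ /=.
  exact: mean_dev_product2.
rewrite [leRHS](_ : _ = \sum_(x <- s) \sum_(y <- t) \sum_(z <- u)
  `|F x y z - mean s (fun x' => F x' y z)|); last first.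
  rewrite [RHS]exchange_big; apply: eq_bigr => y _ /=.
  by rewrite [RHS]exchange_big.
apply: ler_sum => x _; rewrite !sum_cst mulrA -natrM.
have mE : m = mean t (fun y => mean u (fun z => mean s (fun x' => F x' y z))).
  rewrite /m mean_exchange {1 4}/mean; congr (_ / _).
  by apply: eq_bigr => y _; exact: mean_exchange.
rewrite -[X in X * _](@ger0_norm _ (size t * size u)%:R) // -normrM.
have -> : (size t * size u)%:R * (G x - m) = \sum_(y <- t) \sum_(z <- u)
    (F x y z - mean s (fun x' => F x' y z)).
  rewrite mulrBr mE /G !size_mean2 // -sumrB.
  by apply: eq_bigr => y _; rewrite sumrB.
apply: le_trans (ler_norm_sum _ _ _) _; apply: ler_sum => y _.
exact: ler_norm_sum.
Qed.

End MeanDeviation.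

(** * Transport of triangles with a short side *)

(** Real inequalities in the context do not bear on goals about [nat], and
    [lia] is slow on them. *)
Ltac nat_clear := repeat match goal with
  | H : is_true (@Order.le _ _ _ _) |- _ => clear H
  | H : is_true (@Order.lt _ _ _ _) |- _ => clear H
  end.
Ltac nat_lia := nat_clear; lia.
Ltac nat_nia := nat_clear; nia.

Section Windows.
Variable R : realFieldType.

Lemma sum_window (m n i j : nat) (c : R) : (m <= i)%N -> (i <= j)%N -> (j <= n)%N ->
  \sum_(m <= k < n) (if (i <= k < j)%N then c else 0) = (j - i)%:R * c.
Proof.
move=> mi ij jn; rewrite (@big_cat_nat _ _ _ i) //=; last lia.
rewrite (@big_cat_nat _ _ _ j i) //=.
rewrite [X in X + _]big_nat [X in X + _]big1 ?add0r; last by move=> k kr; case: ifP => //; lia.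
rewrite [X in _ + X]big_nat [X in _ + X]big1 ?addr0; last by move=> k kr; case: ifP => //; lia.
rewrite big_nat (eq_bigr (fun=> c)); last by move=> k ->.
by rewrite -big_nat sumr_const_nat mulr_natl.
Qed.

Lemma sum_window_le (m n i j : nat) (c : R) : 0 <= c -> (i <= j)%N ->
  \sum_(m <= k < n) (if (i <= k < j)%N then c else 0) <= (j - i)%:R * c.
Proof.
move=> c0 ij; rewrite -(@sum_window 0 (maxn n j) i j) ?leq_maxr //.
case: (leqP m n) => mn; last first.
  rewrite big_geq 1?ltnW //; apply: sumr_ge0 => k _; case: ifP => //.
have nn : (n <= maxn n j)%N by rewrite leq_maxl.
rewrite [leRHS](@big_cat_nat _ _ _ m) //=; last exact: leq_trans nn.
rewrite [X in _ <= _ + X](@big_cat_nat _ _ _ n) //=.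
rewrite -[leLHS]add0r -[X in 0 + X]addr0; apply: lerD.
  by apply: sumr_ge0 => k _; case: ifP.
by apply: lerD => //; apply: sumr_ge0 => k _; case: ifP.
Qed.

End Windows.

(** [v] stands for the Catalan numbers divided by their exponential growth,
    which are of order [j ^ (- 3 / 2)]. A triangle or quadrilateral inscribed in
    a cycle of [N] sides has as weight the product of [v] over its arcs; the
    vertices [x], [y], [z] range over consecutive intervals, the first two of
    length at least [A]. *)
Section Corner.
Variables (R : rcfType) (v : nat -> R) (N M A b0 b1 b2 b3 : nat).
Variables (F : nat -> nat -> nat -> R) (c : R).

Definition pow32 (j : nat) : R := j%:R * Num.sqrt j%:R.

Hypothesis v_gt0 : forall j, (0 < j)%N -> 0 < v j.
Hypothesis v_noninc : forall i j, (0 < i <= j)%N -> v j <= v i.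
Hypothesis v_le : forall j, (0 < j)%N -> v j * pow32 j <= 4^-1.
Hypothesis v_ge : forall j, (0 < j)%N -> 8^-1 <= v j * pow32 j.
Hypotheses (M0 : (0 < M)%N) (A1 : (b0 + A <= b1)%N) (A2 : (b1 + A <= b2)%N).
Hypotheses (b23 : (b2 <= b3)%N) (b30 : (b3 <= b0 + N)%N).

Definition triangle_arcs x y z := v (y - x)%N * v (z - y)%N * v (N - (z - x))%N.
Definition quad_arcs x u w z :=
  v (u - x)%N * v (w - u)%N * v (z - w)%N * v (N - (z - x))%N.

Definition corner x y := ((2 * M + 1) * (y - x) <= A)%N.

Let reach x y := (M * (y - x))%N.
(* Both ends of a short side move outwards by a uniform random distance
   between one and two times [reach]. *)
Let step x y d : R :=
  if corner x y && (reach x y <= d < 2 * reach x y)%N then (reach x y)%:R^-1 else 0.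

Lemma step_ge0 x y d : 0 <= step x y d.
Proof. by rewrite /step; case: ifP; rewrite // invr_ge0. Qed.

Lemma sum_step_low x y : (x < b1)%N -> (b1 <= y)%N -> corner x y ->
  \sum_(b0 <= x1 < b1) step x y (x - x1)%N = 1.
Proof.
move=> xb by_ cxy; rewrite /step cxy /=; move: cxy; rewrite /corner => cxy.
have r0 : (0 < reach x y)%N by rewrite muln_gt0 M0 subn_gt0; nat_lia.
have rl : (2 * reach x y + (y - x) <= A)%N by rewrite /reach; nat_nia.
rewrite (eq_bigr (fun x1 => if ((x - 2 * reach x y).+1 <= x1 < (x - reach x y).+1)%N
   then (reach x y)%:R^-1 else 0)); last first.
  by move=> x1 _; congr (if _ then _ else _); nat_lia.
rewrite sum_window; [|nat_lia..].
have -> : ((x - reach x y).+1 - (x - 2 * reach x y).+1 = reach x y)%N by nat_lia.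
by rewrite divff // pnatr_eq0; nat_lia.
Qed.

Lemma sum_step_high x y : (x < b1)%N -> (b1 <= y)%N -> corner x y ->
  \sum_(b1 <= y2 < b2) step x y (y2 - y)%N = 1.
Proof.
move=> xb by_ cxy; rewrite /step cxy /=; move: cxy; rewrite /corner => cxy.
have r0 : (0 < reach x y)%N by rewrite muln_gt0 M0 subn_gt0; nat_lia.
have rl : (2 * reach x y + (y - x) <= A)%N by rewrite /reach; nat_nia.
rewrite (eq_bigr (fun y2 => if (y + reach x y <= y2 < y + 2 * reach x y)%N
   then (reach x y)%:R^-1 else 0)); last first.
  by move=> y2 _; congr (if _ then _ else _); nat_lia.
rewrite sum_window; [|nat_lia..].
have -> : (y + 2 * reach x y - (y + reach x y) = reach x y)%N by nat_lia.
by rewrite divff // pnatr_eq0; nat_lia.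
Qed.

Lemma pow32_gt0 j : (0 < j)%N -> 0 < pow32 j.
Proof. by move=> j0; rewrite mulr_gt0 ?sqrtr_gt0 ?ltr0n. Qed.

Lemma pow32_le i j : (i <= j)%N -> pow32 i <= pow32 j.
Proof.
move=> ij; rewrite ler_pM ?sqrtr_ge0 ?ler_nat //.
by rewrite ler_wsqrtr ?ler_nat.
Qed.

Lemma pow32M i j : pow32 (i * j) = pow32 i * pow32 j.
Proof. by rewrite /pow32 natrM sqrtrM ?ler0n //; ring. Qed.

Lemma profile_ratio i j m : (0 < i)%N -> (0 < j)%N -> (j <= m * i)%N ->
  v i <= 2 * pow32 m * v j.
Proof.
move=> i0 j0 jm; have pi := pow32_gt0 i0; have pj := pow32_gt0 j0.
have h1 : v i <= 4^-1 / pow32 i by rewrite ler_pdivlMr ?v_le.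
have h2 : 8^-1 / pow32 j <= v j by rewrite ler_pdivrMr ?v_ge.
have h3 : pow32 j <= pow32 m * pow32 i by rewrite -pow32M pow32_le.
have pm : 0 <= pow32 m by rewrite mulr_ge0 ?sqrtr_ge0.
apply: le_trans h1 (le_trans _ (ler_wpM2l _ h2)); last by rewrite mulr_ge0.
have -> : 2 * pow32 m * (8^-1 / pow32 j) = 4^-1 * (pow32 m / pow32 j) by field; rewrite gt_eqF.
rewrite ler_pM2l ?invr_gt0 //.
by rewrite ler_pdivlMr // mulrC ler_pdivrMr.
Qed.

(** A step of length [d] has density of order [1 / d], which [v d] exceeds up
    to a factor [sqrt N]; the outer arc shrinks, so its [v] only grows. *)
Lemma first_step_le x y z x1 : (b0 <= x1)%N -> (x < b1)%N -> (b1 <= y < b2)%N ->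
  (b2 <= z < b3)%N ->
  triangle_arcs x y z * step x y (x - x1)%N <=
  16 * Num.sqrt N%:R * (if (x1 < x)%N then quad_arcs x1 x y z else 0).
Proof.
move=> bx xb yb zb; rewrite /step; case: ifP => [/andP[cxy near]|_]; last first.
  rewrite mulr0; case: ifP => [xx|_]; last by rewrite mulr0.
  rewrite !mulr_ge0 ?sqrtr_ge0 // ltW // v_gt0; nat_lia.
have r0 : (0 < reach x y)%N by rewrite muln_gt0 M0 subn_gt0; nat_lia.
have -> : (x1 < x)%N by nat_lia.
rewrite /triangle_arcs /quad_arcs.
set d := (x - x1)%N in near *; set D := reach x y in near r0 *.
have vp : v (N - (z - x))%N <= v (N - (z - x1))%N by apply: v_noninc; nat_lia.
have d0 : (0 < d)%N by nat_lia.
have vl : 0 < v (y - x)%N by apply: v_gt0; nat_lia.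
have vr : 0 < v (z - y)%N by apply: v_gt0; nat_lia.
have vp0 : 0 < v (N - (z - x))%N by apply: v_gt0; nat_lia.
suff key : D%:R^-1 <= 16 * Num.sqrt N%:R * v d.
  apply: le_trans (_ : v (y - x) * v (z - y) * v (N - (z - x1)) * D%:R^-1 <= _).
    by rewrite ler_wpM2r ?invr_ge0 // ler_wpM2l // mulr_ge0 ?ltW.
  have -> : 16 * Num.sqrt N%:R * (v d * v (y - x) * v (z - y) * v (N - (z - x1))) =
    v (y - x) * v (z - y) * v (N - (z - x1)) * (16 * Num.sqrt N%:R * v d) by ring.
  by rewrite ler_wpM2l // !mulr_ge0 // ltW // v_gt0; nat_lia.
have h2 : 8^-1 / pow32 d <= v d by rewrite ler_pdivrMr ?v_ge ?pow32_gt0.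
apply: le_trans (ler_wpM2l _ h2); last by rewrite mulr_ge0 ?sqrtr_ge0.
have -> : 16 * Num.sqrt N%:R * (8^-1 / pow32 d) = 2 * Num.sqrt N%:R / pow32 d.
  by field; rewrite gt_eqF ?pow32_gt0.
rewrite ler_pdivlMr ?pow32_gt0 // mulrC ler_pdivrMr ?ltr0n //.
have dD : (d%:R : R) <= 2 * D%:R by rewrite -natrM ler_nat; nat_lia.
have dN : Num.sqrt (d%:R : R) <= Num.sqrt N%:R by rewrite ler_wsqrtr ?ler_nat; nat_lia.
have sd : 0 <= Num.sqrt (d%:R : R) by rewrite sqrtr_ge0.
rewrite /pow32; apply: le_trans (_ : 2 * D%:R * Num.sqrt N%:R <= _); last by lra.
by rewrite ler_pM.
Qed.

Lemma step_cornerP x y d : corner x y -> (x < b1)%N -> (b1 <= y)%N ->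
  (reach x y <= d < 2 * reach x y)%N ->
  [/\ (0 < reach x y)%N, (y - x <= reach x y)%N & step x y d = (reach x y)%:R^-1].
Proof.
move=> cxy xb yb near; rewrite /step cxy near; split=> //.
  by rewrite muln_gt0 M0 subn_gt0; nat_lia.
by rewrite /reach leq_pmull.
Qed.

(** The first step is summed out: the density [1 / (y - x1)] of that step is
    compensated by the number of positions [x] that lead to [x1]. *)
Lemma second_step_le y z x1 y2 : (b0 <= x1 < b1)%N -> (b1 <= y < b2)%N -> (y2 < b2)%N ->
  (b2 <= z < b3)%N ->
  \sum_(b0 <= x < b1)
    triangle_arcs x y z * step x y (x - x1)%N * step x y (y2 - y)%N <=
  32 * (2 * M + 1)%:R * pow32 (2 * M + 1) * Num.sqrt N%:R *
    (if (y < y2)%N then quad_arcs x1 y y2 z else 0).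
Proof.
move=> bx yb y2b zb; set m := (2 * M + 1)%N.
set K := 32 * m%:R * pow32 m * Num.sqrt N%:R.
have K0 : 0 <= K by rewrite !mulr_ge0 ?sqrtr_ge0.
set Q := if _ then _ else _.
have Q0 : 0 <= Q.
  rewrite /Q; case: ifP => // yy; rewrite !mulr_ge0 // ltW // v_gt0; nat_lia.
have x1y : (x1 < y)%N by nat_lia.
have l0 : (0 : R) < (y - x1)%:R by rewrite ltr0n subn_gt0.
have KQ0 : 0 <= K * Q / (y - x1)%:R := divr_ge0 (mulr_ge0 K0 Q0) (ler0n _ _).
apply: le_trans (_ : \sum_(b0 <= x < b1) (if (x1.+1 <= x < y)%N
   then K * Q / (y - x1)%:R else 0) <= _); last first.
  apply: le_trans (sum_window_le _ _ _ _) _ => //.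
  rewrite mulrCA ler_piMr ?(mulr_ge0 K0 Q0) // ler_pdivrMr // mul1r ler_nat; nat_lia.
rewrite !big_nat; apply: ler_sum => x /andP[bx' xb].
case: (boolP [&& corner x y, (reach x y <= x - x1 < 2 * reach x y)%N &
    (reach x y <= y2 - y < 2 * reach x y)%N]) => [/and3P[cxy n1 n2]|no]; last first.
  suff -> : triangle_arcs x y z * step x y (x - x1)%N * step x y (y2 - y)%N = 0.
    by case: ifP.
  rewrite /step; case: ifP => [/andP[c1 n1]|_]; last by rewrite mulr0 mul0r.
  case: ifP => [/andP[_ n2]|_]; last by rewrite mulr0.
  by rewrite c1 n1 n2 in no.
have by1 : (b1 <= y)%N by case/andP: yb.
have [r0 lr ->] := step_cornerP cxy xb by1 n1.
have [_ _ ->] := step_cornerP cxy xb by1 n2.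
have -> : (x1 < x < y)%N by nat_lia.
rewrite /Q; have -> : (y < y2)%N by nat_lia.
set D := reach x y in r0 lr n1 n2 *.
have D0 : (0 : R) < D%:R by rewrite ltr0n.
rewrite /triangle_arcs /quad_arcs.
set lam := (y - x1)%N in l0 *; set d' := (y2 - y)%N in n2 *.
have d0 : (0 : R) < d'%:R by rewrite ltr0n; nat_lia.
have lamm : (lam <= m * (y - x))%N by rewrite /lam /m; move: n1; rewrite /D /reach; nat_nia.
have vl : v (y - x)%N <= 2 * pow32 m * v lam.
  by apply: profile_ratio => //; rewrite /lam; nat_lia.
have vr : v (z - y)%N <= v (z - y2)%N by apply: v_noninc; nat_lia.
have vp : v (N - (z - x))%N <= v (N - (z - x1))%N by apply: v_noninc; nat_lia.
have vr0 : 0 < v (z - y)%N by apply: v_gt0; nat_lia.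
have vp0 : 0 < v (N - (z - x))%N by apply: v_gt0; nat_lia.
have vr0' := lt_le_trans vr0 vr; have vp0' := lt_le_trans vp0 vp.
have vl0 : 0 < v (y - x)%N by apply: v_gt0; nat_lia.
have vlam : 0 < v lam by apply: v_gt0; rewrite /lam; nat_lia.
have vd : 0 < v d' by apply: v_gt0; rewrite /d'; nat_lia.
have pm : 0 <= pow32 m by rewrite mulr_ge0 ?sqrtr_ge0.
have inv1 : D%:R^-1 <= m%:R / lam%:R :> R.
  rewrite ler_pdivlMr // mulrC ler_pdivrMr // -natrM ler_nat.
  by apply: leq_trans lamm _; rewrite leq_mul2l lr orbT.
have inv2 : D%:R^-1 <= 2 / d'%:R :> R.
  by rewrite ler_pdivlMr // mulrC ler_pdivrMr // -natrM ler_nat; nat_lia.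
have inv3 : 2 / d'%:R <= 16 * Num.sqrt N%:R * v d'.
  have h2 : 8^-1 / pow32 d' <= v d' by rewrite ler_pdivrMr ?v_ge ?pow32_gt0; nat_lia.
  apply: le_trans (ler_wpM2l _ h2); last by rewrite mulr_ge0 ?sqrtr_ge0.
  have s0 : 0 < Num.sqrt (d'%:R : R) by rewrite sqrtr_gt0.
  have -> : 16 * Num.sqrt N%:R * (8^-1 / pow32 d') =
     2 / d'%:R * (Num.sqrt N%:R / Num.sqrt d'%:R).
    by rewrite /pow32; field; rewrite !gt_eqF.
  rewrite ler_peMr ?divr_ge0 // ler_pdivlMr // mul1r ler_wsqrtr ?ler_nat //.
  by rewrite /d'; nat_lia.
have i0 : 0 <= D%:R^-1 :> R by rewrite invr_ge0 ltW.
apply: le_trans (_ : (2 * pow32 m * v lam) * v (z - y2) * v (N - (z - x1)) *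
   (m%:R / lam%:R) * (16 * Num.sqrt N%:R * v d') <= _).
  apply: (ler_pM _ i0 _ (le_trans inv2 inv3)).
    by rewrite !mulr_ge0 // ltW.
  apply: (ler_pM _ i0 _ inv1); first by rewrite !mulr_ge0 // ltW.
  apply: (ler_pM (mulr_ge0 (ltW vl0) (ltW vr0)) (ltW vp0) _ vp).
  exact: (ler_pM (ltW vl0) (ltW vr0) vl vr).
rewrite le_eqVlt; apply/orP; left; apply/eqP; rewrite /K; field.
by rewrite gt_eqF.
Qed.

(** The sides [(x, y)] that are sent to [(x1, y2)] are shorter by a factor of
    order [M]. With [l := y2 - x1] there are about [(l / M) ^ 2] of them and the
    density of the two steps is of order [l ^ (- 2)]; the gain [M ^ (- 2)]
    outweighs the loss [M ^ (3 / 2)] in [v]. *)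
Lemma far_step_le z x1 y2 : (b0 <= x1 < b1)%N -> (b1 <= y2 < b2)%N ->
  (b2 <= z < b3)%N ->
  \sum_(b0 <= x < b1) \sum_(b1 <= y < b2)
    triangle_arcs x y z * step x y (x - x1)%N * step x y (y2 - y)%N <=
  8 * pow32 (4 * M + 1) / M%:R ^+ 2 * triangle_arcs x1 y2 z.
Proof.
move=> bx by2 zb; set m := (2 * M + 1)%N; set m' := (4 * M + 1)%N.
set lam := (y2 - x1)%N; pose Lam := (lam %/ m)%N.
have lam0 : (0 : R) < lam%:R by rewrite ltr0n /lam subn_gt0; nat_lia.
have MR : (0 : R) < M%:R by rewrite ltr0n.
have T0 : 0 <= triangle_arcs x1 y2 z by rewrite !mulr_ge0 // ltW // v_gt0; nat_lia.
have pm : 0 <= pow32 m' by rewrite mulr_ge0 ?sqrtr_ge0.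
pose K := 2 * pow32 m' * m'%:R ^+ 2 / (M%:R ^+ 2 * lam%:R ^+ 2) * triangle_arcs x1 y2 z.
have K0 : 0 <= K.
  apply: (mulr_ge0 (divr_ge0 _ _) T0).
    exact: mulr_ge0 (mulr_ge0 (ler0n R 2) pm) (exprn_ge0 2 (ler0n R m')).
  exact: mulr_ge0 (exprn_ge0 2 (ltW MR)) (exprn_ge0 2 (ltW lam0)).
apply: le_trans (_ : \sum_(b0 <= x < b1) (if (b1 - Lam <= x < b1)%N
   then \sum_(b1 <= y < b2) (if (b1 <= y < b1 + Lam)%N then K else 0) else 0) <= _);
   last first.
  apply: le_trans (_ : \sum_(b0 <= x < b1) (if (b1 - Lam <= x < b1)%N
     then Lam%:R * K else 0) <= _).
    apply: ler_sum => x _; case: ifP => // _.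
    by apply: le_trans (sum_window_le _ _ K0 (leq_addr _ _)) _; rewrite addKn.
  have LK0 : 0 <= Lam%:R * K := mulr_ge0 (ler0n R Lam) K0.
  apply: le_trans (sum_window_le _ _ LK0 (leq_subr _ _)) _.
  have L1 : (b1 - (b1 - Lam))%:R <= Lam%:R :> R by rewrite ler_nat; nat_lia.
  apply: le_trans (ler_wpM2r LK0 L1) _.
  have L2 : (Lam%:R : R) * m'%:R <= 2 * lam%:R.
    rewrite -!natrM ler_nat; have := leq_divM lam m.
    by rewrite -/Lam /m /m'; nat_nia.
  have L3 : (Lam%:R * m'%:R) ^+ 2 <= (2 * lam%:R) ^+ 2 :> R.
    by rewrite lerXn2r // nnegrE mulr_ge0 ?ler0n.
  have -> : Lam%:R * (Lam%:R * K) = 2 * pow32 m' / (M%:R ^+ 2 * lam%:R ^+ 2) *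
    (Lam%:R * m'%:R) ^+ 2 * triangle_arcs x1 y2 z by rewrite /K; ring.
  apply: (ler_wpM2r T0).
  apply: le_trans (ler_wpM2l _ L3) _.
    apply: divr_ge0 (mulr_ge0 (ler0n R 2) pm) _.
    exact: mulr_ge0 (exprn_ge0 2 (ltW MR)) (exprn_ge0 2 (ltW lam0)).
  rewrite le_eqVlt; apply/orP; left; apply/eqP; field.
  by rewrite !gt_eqF.
rewrite !big_nat; apply: ler_sum => x /andP[bx' xb].
have term y : (b1 <= y < b2)%N ->
    triangle_arcs x y z * step x y (x - x1)%N * step x y (y2 - y)%N <=
    if (b1 - Lam <= x < b1)%N && (b1 <= y < b1 + Lam)%N then K else 0.
  move=> yb.
  case: (boolP [&& corner x y, (reach x y <= x - x1 < 2 * reach x y)%N &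
    (reach x y <= y2 - y < 2 * reach x y)%N]) => [/and3P[cxy n1 n2]|no]; last first.
    suff -> : triangle_arcs x y z * step x y (x - x1)%N * step x y (y2 - y)%N = 0.
      by case: ifP.
    rewrite /step; case: ifP => [/andP[c1 n1]|_]; last by rewrite mulr0 mul0r.
    case: ifP => [/andP[_ n2]|_]; last by rewrite mulr0.
    by rewrite c1 n1 n2 in no.
  have by1 : (b1 <= y)%N by case/andP: yb.
  have [r0 lr ->] := step_cornerP cxy xb by1 n1.
  have [_ _ ->] := step_cornerP cxy xb by1 n2.
  have lm : (y - x <= Lam)%N.
    rewrite leq_divRL; last by rewrite /m; nat_lia.
    have -> : ((y - x) * m = 2 * (M * (y - x)) + (y - x))%N by rewrite /m; ring.
    by rewrite /lam; move: n1 n2; rewrite /reach; move: (M * (y - x))%N => l; nat_lia.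
  have -> : (b1 - Lam <= x < b1)%N by nat_lia.
  have -> : (b1 <= y < b1 + Lam)%N by nat_lia.
  rewrite /=; have l0 : (0 : R) < (y - x)%:R by rewrite ltr0n subn_gt0; nat_lia.
  have lamm : (lam <= m' * (y - x))%N.
    rewrite /m' mulnDl mul1n -mulnA -/(reach x y) /lam; nat_lia.
  have vl : v (y - x)%N <= 2 * pow32 m' * v lam.
    by apply: profile_ratio => //; rewrite /lam; nat_lia.
  have vr : v (z - y)%N <= v (z - y2)%N.
    by apply: v_noninc; move: n2; rewrite /reach; nat_lia.
  have x1x : (x1 <= x)%N by rewrite leqNgt -subn_gt0; nat_lia.
  have vp : v (N - (z - x))%N <= v (N - (z - x1))%N.
    by apply: v_noninc; clear -A1 A2 b23 b30 bx zb x1x xb; lia.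
  have vr0 : 0 < v (z - y)%N by apply: v_gt0; nat_lia.
  have vp0 : 0 < v (N - (z - x))%N by apply: v_gt0; nat_lia.
  have vl0 : 0 < v (y - x)%N by apply: v_gt0; nat_lia.
  have inv1 : (reach x y)%:R^-1 <= m'%:R / (M%:R * lam%:R) :> R.
    rewrite ler_pdivlMr ?mulr_gt0 // mulrC ler_pdivrMr ?ltr0n //.
    by rewrite -!natrM ler_nat /reach mulnCA leq_mul2l lamm orbT.
  have i0 : 0 <= (reach x y)%:R^-1 :> R by rewrite invr_ge0.
  apply: le_trans (_ : (2 * pow32 m' * v lam) * v (z - y2) * v (N - (z - x1)) *
   (m'%:R / (M%:R * lam%:R)) * (m'%:R / (M%:R * lam%:R)) <= _).
    apply: (ler_pM _ i0 _ inv1); first by rewrite !mulr_ge0 // ltW.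
    apply: (ler_pM _ i0 _ inv1); first by rewrite !mulr_ge0 // ltW.
    apply: (ler_pM (mulr_ge0 (ltW vl0) (ltW vr0)) (ltW vp0) _ vp).
    exact: (ler_pM (ltW vl0) (ltW vr0) vl vr).
  rewrite le_eqVlt; apply/orP; left; apply/eqP; rewrite /K /triangle_arcs -/lam.
  by field; rewrite !gt_eqF.
case: ifP => xr.
  by rewrite !big_nat; apply: ler_sum => y yb; have := term _ yb; rewrite xr.
by rewrite big_nat; apply: sumr_le0 => y yb; have := term _ yb; rewrite xr.
Qed.

Definition low_moves : R :=
  \sum_(b0 <= x < b1) \sum_(b1 <= y < b2) \sum_(b2 <= z < b3) \sum_(b0 <= x1 < b1)
    (if (x1 < x)%N then quad_arcs x1 x y z else 0) * `|F x y z - F x1 y z|.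
Definition middle_moves : R :=
  \sum_(b0 <= x < b1) \sum_(b1 <= y < b2) \sum_(b2 <= z < b3) \sum_(b1 <= y2 < b2)
    (if (y < y2)%N then quad_arcs x y y2 z else 0) * `|F x y z - F x y2 z|.
Definition high_moves : R :=
  \sum_(b0 <= x < b1) \sum_(b1 <= y < b2) \sum_(b2 <= z < b3) \sum_(b2 <= z2 < b3)
    (if (z < z2)%N then quad_arcs x y z z2 else 0) * `|F x y z - F x y z2|.
Definition deviation : R :=
  \sum_(b0 <= x < b1) \sum_(b1 <= y < b2) \sum_(b2 <= z < b3)
    triangle_arcs x y z * `|F x y z - c|.

(** Transport of the triangles with a short side between [x] and [y]: both
    ends move outwards by about [M] times its length. This is cheap, and
    since it spreads the triangles over a longer range, the image of their
    weight is a small multiple of the weight, hence absorbed by it. *)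
Lemma corner_deviation :
  \sum_(b0 <= x < b1) \sum_(b1 <= y < b2) \sum_(b2 <= z < b3)
    (if corner x y then triangle_arcs x y z * `|F x y z - c| else 0) <=
  16 * Num.sqrt N%:R * low_moves +
  32 * (2 * M + 1)%:R * pow32 (2 * M + 1) * Num.sqrt N%:R * middle_moves +
  8 * pow32 (4 * M + 1) / M%:R ^+ 2 * deviation.
Proof.
pose T1 := \sum_(b0 <= x < b1) \sum_(b1 <= y < b2) \sum_(b2 <= z < b3)
  \sum_(b0 <= x1 < b1)
    triangle_arcs x y z * step x y (x - x1)%N * `|F x y z - F x1 y z|.
pose T2 := \sum_(b0 <= x < b1) \sum_(b1 <= y < b2) \sum_(b2 <= z < b3)
  \sum_(b0 <= x1 < b1) \sum_(b1 <= y2 < b2)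
    triangle_arcs x y z * step x y (x - x1)%N * step x y (y2 - y)%N *
    `|F x1 y z - F x1 y2 z|.
pose T3 := \sum_(b0 <= x < b1) \sum_(b1 <= y < b2) \sum_(b2 <= z < b3)
  \sum_(b0 <= x1 < b1) \sum_(b1 <= y2 < b2)
    triangle_arcs x y z * step x y (x - x1)%N * step x y (y2 - y)%N *
    `|F x1 y2 z - c|.
apply: le_trans (_ : T1 + T2 + T3 <= _).
  rewrite -!big_split !big_nat; apply: ler_sum => x /andP[bx xb] /=.
  rewrite -!big_split !big_nat; apply: ler_sum => y yb /=.
  rewrite -!big_split !big_nat; apply: ler_sum => z zb /=.
  have tw : 0 <= triangle_arcs x y z by rewrite !mulr_ge0 // ltW // v_gt0; nat_lia.
  case: ifP => [cxy|_]; last first.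
    have t1 x1 := mulr_ge0 tw (step_ge0 x y (x - x1)).
    apply: addr_ge0; first apply: addr_ge0; apply: sumr_ge0 => x1 _.
    - exact: mulr_ge0 (t1 x1) (normr_ge0 _).
    - apply: sumr_ge0 => y2 _.
      exact: mulr_ge0 (mulr_ge0 (t1 x1) (step_ge0 _ _ _)) (normr_ge0 _).
    - apply: sumr_ge0 => y2 _.
      exact: mulr_ge0 (mulr_ge0 (t1 x1) (step_ge0 _ _ _)) (normr_ge0 _).
  have s1 := sum_step_low xb (proj1 (andP yb)) cxy.
  have s2 := sum_step_high xb (proj1 (andP yb)) cxy.
  have -> : triangle_arcs x y z * `|F x y z - c| = \sum_(b0 <= x1 < b1)
    \sum_(b1 <= y2 < b2) triangle_arcs x y z * step x y (x - x1)%N *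
      step x y (y2 - y)%N * `|F x y z - c|.
    under eq_bigr do rewrite -mulr_suml -mulr_sumr s2 mulr1.
    by rewrite -mulr_suml -mulr_sumr s1 mulr1.
  have -> : \sum_(b0 <= x1 < b1)
     triangle_arcs x y z * step x y (x - x1)%N * `|F x y z - F x1 y z| =
    \sum_(b0 <= x1 < b1) \sum_(b1 <= y2 < b2) triangle_arcs x y z *
      step x y (x - x1)%N * step x y (y2 - y)%N * `|F x y z - F x1 y z|.
    by apply: eq_bigr => x1 _; rewrite -mulr_suml -mulr_sumr s2 mulr1.
  rewrite -!big_split; apply: ler_sum => x1 _ /=.
  rewrite -!big_split; apply: ler_sum => y2 _ /=.
  rewrite -!mulrDr.
  apply: (ler_wpM2l (mulr_ge0 (mulr_ge0 tw (step_ge0 _ _ _)) (step_ge0 _ _ _))).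
  rewrite -addrA; apply: le_trans (ler_distD (F x1 y z) _ _) _.
  by rewrite lerD2l ler_distD.
apply: lerD; first apply: lerD.
- rewrite /T1 /low_moves mulr_sumr !big_nat; apply: ler_sum => x /andP[bx xb].
  rewrite mulr_sumr !big_nat; apply: ler_sum => y yb.
  rewrite mulr_sumr !big_nat; apply: ler_sum => z zb.
  rewrite mulr_sumr !big_nat; apply: ler_sum => x1 /andP[bx1 xb1].
  by rewrite mulrA ler_wpM2r // first_step_le.
- have -> : T2 = \sum_(b0 <= x1 < b1) \sum_(b1 <= y < b2) \sum_(b2 <= z < b3)
    \sum_(b1 <= y2 < b2) (\sum_(b0 <= x < b1)
    triangle_arcs x y z * step x y (x - x1)%N * step x y (y2 - y)%N) *
    `|F x1 y z - F x1 y2 z|.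
    rewrite /T2 exchange_big [RHS]exchange_big /=; apply: eq_bigr => y _.
    rewrite exchange_big [RHS]exchange_big /=; apply: eq_bigr => z _.
    rewrite exchange_big /=; apply: eq_bigr => x1 _.
    rewrite exchange_big /=; apply: eq_bigr => y2 _.
    by rewrite mulr_suml.
  rewrite /middle_moves mulr_sumr !big_nat; apply: ler_sum => x1 x1b.
  rewrite mulr_sumr !big_nat; apply: ler_sum => y yb.
  rewrite mulr_sumr !big_nat; apply: ler_sum => z zb.
  rewrite mulr_sumr !big_nat; apply: ler_sum => y2 /andP[by2 yb2].
  by rewrite mulrA ler_wpM2r // second_step_le.
- have -> : T3 = \sum_(b0 <= x1 < b1) \sum_(b1 <= y2 < b2) \sum_(b2 <= z < b3)
    (\sum_(b0 <= x < b1) \sum_(b1 <= y < b2)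
    triangle_arcs x y z * step x y (x - x1)%N * step x y (y2 - y)%N) *
    `|F x1 y2 z - c|.
    transitivity (\sum_(b0 <= x < b1) \sum_(b0 <= x1 < b1) \sum_(b1 <= y2 < b2)
     \sum_(b2 <= z < b3) \sum_(b1 <= y < b2)
      triangle_arcs x y z * step x y (x - x1)%N * step x y (y2 - y)%N *
      `|F x1 y2 z - c|).
      apply: eq_bigr => x _.
      under eq_bigr do rewrite exchange_big /=.
      rewrite exchange_big /=; apply: eq_bigr => x1 _.
      under eq_bigr do rewrite exchange_big /=.
      rewrite exchange_big /=; apply: eq_bigr => y2 _.
      by rewrite exchange_big.
    rewrite exchange_big /=; apply: eq_bigr => x1 _.
    rewrite exchange_big /=; apply: eq_bigr => y2 _.
    rewrite exchange_big /=; apply: eq_bigr => z _.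
    by rewrite mulr_suml; apply: eq_bigr => x _; rewrite mulr_suml.
  rewrite /deviation mulr_sumr !big_nat; apply: ler_sum => x1 x1b.
  rewrite mulr_sumr !big_nat; apply: ler_sum => y2 y2b.
  rewrite mulr_sumr !big_nat; apply: ler_sum => z zb.
  by rewrite mulrA ler_wpM2r // far_step_le.
Qed.

End Corner.

(** * A Poincare inequality for separating triangles *)

(** The factor is of order [M ^ (- 1 / 2)]. One sixth for each of the three
    sides leaves half of the deviation. *)
Lemma small_transport_factor (R : rcfType) : exists2 M : nat, (0 < M)%N &
  8 * pow32 R (4 * M + 1) / M%:R ^+ 2 <= 6^-1.
Proof.
have [q q0 q720] : exists2 q : nat, (0 < q)%N & 720 <= q%:R :> R by exists 720%N.
exists (q * q)%N; first by rewrite muln_gt0 q0.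
have qR : (0 : R) < q%:R by rewrite ltr0n.
have sq : Num.sqrt ((q * q)%:R : R) = q%:R by rewrite natrM -expr2 sqrtr_sqr ger0_norm.
rewrite ler_pdivrMr ?exprn_gt0 ?ltr0n ?muln_gt0 ?q0 //.
apply: le_trans (_ : 8 * pow32 R (5 * (q * q)) <= _).
  by rewrite ler_pM2l // pow32_le //; lia.
have s5 : Num.sqrt 5%:R <= 3 :> R.
  have -> : (3 : R) = Num.sqrt (3 ^+ 2) by rewrite sqrtr_sqr ger0_norm.
  by rewrite ler_wsqrtr // -natrX ler_nat.
rewrite pow32M /pow32 sq natrM.
have -> : 8 * (5%:R * Num.sqrt 5%:R * (q%:R * q%:R * q%:R)) =
  40 * q%:R ^+ 3 * Num.sqrt 5%:R :> R by ring.
have q3 : 0 <= 40 * q%:R ^+ 3 :> R by rewrite mulr_ge0 // exprn_ge0 // ltW.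
apply: le_trans (ler_wpM2l q3 s5) _.
have -> : 40 * q%:R ^+ 3 * 3 = 120 * q%:R ^+ 3 :> R by ring.
have -> : 6^-1 * (q%:R * q%:R) ^+ 2 = (6^-1 * q%:R) * q%:R ^+ 3 :> R by ring.
by apply: ler_wpM2r; [exact/exprn_ge0/ltW|lra].
Qed.

Section SumReordering.
Variables (V : nmodType) (I J K : Type).
Variables (r : seq I) (s : seq J) (t : seq K).

Lemma sum_rotate3 (f : I -> J -> K -> V) :
  \sum_(x <- r) \sum_(y <- s) \sum_(z <- t) f x y z =
  \sum_(z <- t) \sum_(x <- r) \sum_(y <- s) f x y z.
Proof.
rewrite [RHS]exchange_big; apply: eq_bigr => x _ /=.
by rewrite [RHS]exchange_big.
Qed.

Lemma sum_swap_ends (f : I -> J -> I -> V) :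
  \sum_(x <- r) \sum_(y <- s) \sum_(x' <- r) f x y x' =
  \sum_(x <- r) \sum_(y <- s) \sum_(x' <- r) f x' y x.
Proof.
rewrite exchange_big [RHS]exchange_big /=; apply: eq_bigr => y _.
by rewrite exchange_big.
Qed.

End SumReordering.

Lemma triangle_arcs_rotate (R : rcfType) (v : nat -> R) N x y z : (x <= y <= z)%N -> (z <= x + N)%N ->
  triangle_arcs v N y z (x + N) = triangle_arcs v N x y z.
Proof.
move=> xyz zN; rewrite /triangle_arcs.
have -> : (x + N - z = N - (z - x))%N by lia.
have -> : (N - (x + N - y) = y - x)%N by lia.
by ring.
Qed.

Section Rotation.
Variables (R : rcfType) (v : nat -> R) (N b0 b1 b2 : nat).
Variables (F : nat -> nat -> nat -> R).
Hypotheses (b01 : (b0 <= b1)%N) (b12 : (b1 <= b2)%N) (b2N : (b2 <= b0 + N)%N).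

(** The cycle of sides is read from another starting point, so that [x] becomes
    the last vertex [x + N]. *)
Definition rotated y z x := F (x - N) y z.

Lemma sum_shift_window (H : nat -> R) :
  \sum_(b0 + N <= k < b1 + N) H k = \sum_(b0 <= k < b1) H (k + N)%N.
Proof. by rewrite big_addn addnK. Qed.

Lemma sum_rotate_window (H H' : nat -> nat -> nat -> R) :
  (forall x y z, (b0 <= x < b1)%N -> (b1 <= y < b2)%N -> (b2 <= z < b0 + N)%N ->
     H y z (x + N)%N = H' x y z) ->
  \sum_(b1 <= y < b2) \sum_(b2 <= z < b0 + N) \sum_(b0 + N <= x < b1 + N) H y z x =
  \sum_(b0 <= x < b1) \sum_(b1 <= y < b2) \sum_(b2 <= z < b0 + N) H' x y z.
Proof.
move=> HH; under eq_bigr do under eq_bigr do rewrite sum_shift_window.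
rewrite sum_rotate3 !big_nat; apply: eq_bigr => x xb.
rewrite !big_nat; apply: eq_bigr => y yb.
by rewrite !big_nat; apply: eq_bigr => z zb; exact: HH.
Qed.

Lemma deviation_rotate c :
  deviation v N b1 b2 (b0 + N) (b1 + N) rotated c =
  deviation v N b0 b1 b2 (b0 + N) F c.
Proof.
apply: sum_rotate_window => x y z xb yb zb.
by rewrite /rotated addnK triangle_arcs_rotate //; lia.
Qed.

Lemma low_moves_rotate : low_moves v N b1 b2 (b0 + N) (b1 + N) rotated =
  middle_moves v N b0 b1 b2 (b0 + N) F.
Proof.
pose H x y z y2 := (if (y < y2)%N then quad_arcs v N x y y2 z else 0) *
  `|F x y z - F x y2 z|.
rewrite /low_moves (sum_rotate_window (H' := fun x y z => \sum_(b1 <= y1 < b2)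
  H x y1 z y)); first by apply: eq_bigr => x _; rewrite sum_swap_ends.
move=> x y z xb yb zb; rewrite !big_nat; apply: eq_bigr => y1 yb1.
rewrite /rotated addnK distrC /H; case: ifP => // yy; congr (_ * _).
rewrite /quad_arcs.
have -> : (x + N - z = N - (z - x))%N by lia.
have -> : (N - (x + N - y1) = y1 - x)%N by lia.
by ring.
Qed.

Lemma middle_moves_rotate : middle_moves v N b1 b2 (b0 + N) (b1 + N) rotated =
  high_moves v N b0 b1 b2 (b0 + N) F.
Proof.
apply: sum_rotate_window => x y z xb yb zb.
rewrite !big_nat; apply: eq_bigr => z2 zb2.
rewrite /rotated addnK; case: ifP => // zz; congr (_ * _); rewrite /quad_arcs.
have -> : (x + N - z2 = N - (z2 - x))%N by lia.
have -> : (N - (x + N - y) = y - x)%N by lia.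
by ring.
Qed.

Lemma high_moves_rotate : high_moves v N b1 b2 (b0 + N) (b1 + N) rotated =
  low_moves v N b0 b1 b2 (b0 + N) F.
Proof.
pose H x y z x1 := (if (x1 < x)%N then quad_arcs v N x1 x y z else 0) *
  `|F x y z - F x1 y z|.
rewrite /high_moves (sum_rotate_window (H' := fun x y z => \sum_(b0 <= x1 < b1)
  H x1 y z x)).
  rewrite exchange_big [RHS]exchange_big; apply: eq_bigr => y _ /=.
  by rewrite sum_swap_ends.
move=> x y z xb yb zb; rewrite sum_shift_window !big_nat.
apply: eq_bigr => x1 xb1; rewrite /rotated !addnK ltn_add2r distrC /H.
case: ifP => // xx; congr (_ * _); rewrite /quad_arcs.
have -> : (x + N - z = N - (z - x))%N by lia.
have -> : (x1 + N - (x + N) = x1 - x)%N by lia.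
have -> : (N - (x1 + N - y) = y - x1)%N by lia.
by ring.
Qed.

End Rotation.

Section Separating.
Variables (R : rcfType) (v : nat -> R) (N M a : nat).
Variables (F : nat -> nat -> nat -> R).

Hypothesis v_gt0 : forall j, (0 < j)%N -> 0 < v j.
Hypothesis v_noninc : forall i j, (0 < i <= j)%N -> v j <= v i.
Hypothesis v_le : forall j, (0 < j)%N -> v j * pow32 R j <= 4^-1.
Hypothesis v_ge : forall j, (0 < j)%N -> 8^-1 <= v j * pow32 R j.
Hypotheses (M0 : (0 < M)%N) (a0 : (0 < a)%N) (aN : (3 * a <= N)%N) (Na : (N <= 5 * a)%N).

Local Notation tw := (triangle_arcs v N).
Local Notation qw := (quad_arcs v N).
Local Notation W_low := (low_moves v N 0 a (2 * a) N F).
Local Notation W_mid := (middle_moves v N 0 a (2 * a) N F).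
Local Notation W_high := (high_moves v N 0 a (2 * a) N F).

Lemma corner_xy c : \sum_(0 <= x < a) \sum_(a <= y < 2 * a) \sum_(2 * a <= z < N)
    (if corner M a x y then tw x y z * `|F x y z - c| else 0) <=
  16 * Num.sqrt N%:R * W_low +
  32 * (2 * M + 1)%:R * pow32 R (2 * M + 1) * Num.sqrt N%:R * W_mid +
  8 * pow32 R (4 * M + 1) / M%:R ^+ 2 * deviation v N 0 a (2 * a) N F c.
Proof. by apply: corner_deviation => //; lia. Qed.

Lemma corner_yz c : \sum_(0 <= x < a) \sum_(a <= y < 2 * a) \sum_(2 * a <= z < N)
    (if corner M a y z then tw x y z * `|F x y z - c| else 0) <=
  16 * Num.sqrt N%:R * W_mid +
  32 * (2 * M + 1)%:R * pow32 R (2 * M + 1) * Num.sqrt N%:R * W_high +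
  8 * pow32 R (4 * M + 1) / M%:R ^+ 2 * deviation v N 0 a (2 * a) N F c.
Proof.
have := @corner_deviation R v N M a a (2 * a) (0 + N) (a + N) (rotated N F) c
  v_gt0 v_noninc v_le v_ge M0.
move=> /(_ ltac:(lia) ltac:(lia) ltac:(lia) ltac:(lia)).
rewrite deviation_rotate ?low_moves_rotate ?middle_moves_rotate; try lia.
rewrite (@sum_rotate_window _ _ _ _ _ _ (fun x y z =>
  if corner M a y z then tw x y z * `|F x y z - c| else 0)) ?add0n //.
by move=> x y z xa ya za; rewrite /rotated addnK triangle_arcs_rotate //; lia.
Qed.

Lemma corner_zx c : \sum_(0 <= x < a) \sum_(a <= y < 2 * a) \sum_(2 * a <= z < N)
    (if corner M a z (x + N) then tw x y z * `|F x y z - c| else 0) <=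
  16 * Num.sqrt N%:R * W_high +
  32 * (2 * M + 1)%:R * pow32 R (2 * M + 1) * Num.sqrt N%:R * W_low +
  8 * pow32 R (4 * M + 1) / M%:R ^+ 2 * deviation v N 0 a (2 * a) N F c.
Proof.
have := @corner_deviation R v N M a (2 * a) (0 + N) (a + N) (2 * a + N)
  (rotated N (rotated N F)) c v_gt0 v_noninc v_le v_ge M0.
move=> /(_ ltac:(lia) ltac:(lia) ltac:(lia) ltac:(lia)).
rewrite deviation_rotate ?low_moves_rotate ?middle_moves_rotate; try lia.
rewrite deviation_rotate ?middle_moves_rotate ?high_moves_rotate; try lia.
rewrite (@sum_rotate_window _ _ _ _ _ _ (fun y z x =>
  if corner M a z x then tw y z x * `|rotated N F y z x - c| else 0)); last first.
  by move=> y z x ya za xa; rewrite {1}/rotated addnK triangle_arcs_rotate //; lia.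
rewrite (@sum_rotate_window _ _ _ _ _ _ (fun x y z =>
  if corner M a z (x + N) then tw x y z * `|F x y z - c| else 0)) ?add0n //.
by move=> x y z xa ya za; rewrite /rotated addnK triangle_arcs_rotate //; lia.
Qed.

Local Notation q := (pow32 R N).

Lemma pow32_N_gt0 : 0 < q. Proof. by apply: pow32_gt0; lia. Qed.

Lemma profile_lower j : (0 < j <= N)%N -> 8^-1 / q <= v j.
Proof.
move=> /andP[j0 jN]; rewrite ler_pdivrMr ?pow32_N_gt0 //.
apply: le_trans (v_ge j0) _; apply: ler_wpM2l; last exact: pow32_le.
by rewrite ltW // v_gt0.
Qed.

Lemma quad_weight_lower x u w z : (x < u)%N -> (u < w)%N -> (w < z)%N -> (z < N)%N ->
  4096^-1 / q ^+ 4 <= qw x u w z.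
Proof.
move=> xu uw wz zN; have q0 := pow32_N_gt0.
have -> : 4096^-1 / q ^+ 4 = (8^-1 / q) * (8^-1 / q) * (8^-1 / q) * (8^-1 / q).
  by field; rewrite gt_eqF.
have c0 : 0 <= 8^-1 / q by apply: divr_ge0; [rewrite invr_ge0|exact: ltW].
have c1 := profile_lower; have cc := mulr_ge0 c0 c0.
apply: (ler_pM (mulr_ge0 cc c0) c0); last by apply: c1; lia.
apply: (ler_pM cc c0); last by apply: c1; lia.
by apply: (ler_pM c0 c0); apply: c1; lia.
Qed.

Definition long_arc j := (a < (2 * M + 1) * j)%N.

Lemma profile_upper j : (0 < j)%N -> long_arc j ->
  v j <= pow32 R (5 * (2 * M + 1)) / (4 * q).
Proof.
move=> j0 lj; have q0 := pow32_N_gt0; have pj := pow32_gt0 R j0.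
have h1 : v j <= 4^-1 / pow32 R j by rewrite ler_pdivlMr ?v_le.
apply: le_trans h1 _.
have h2 : q <= pow32 R (5 * (2 * M + 1)) * pow32 R j.
  by rewrite -pow32M pow32_le // -mulnA; move: lj; rewrite /long_arc; lia.
have -> : pow32 R (5 * (2 * M + 1)) / (4 * q) = 4^-1 * (pow32 R (5 * (2 * M + 1)) / q).
  by field; rewrite gt_eqF.
by rewrite ler_pM2l ?invr_gt0 // ler_pdivlMr // mulrC ler_pdivrMr.
Qed.

Lemma move_pairs (G : nat -> R) (h : nat -> nat -> R) (k : R) (s : seq nat) :
  {in s &, forall i j, (i < j)%N -> k <= h i j} ->
  k * \sum_(i <- s) \sum_(j <- s) `|G i - G j| <=
  2 * \sum_(i <- s) \sum_(j <- s) (if (i < j)%N then h i j else 0) * `|G i - G j|.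
Proof.
move=> kh; rewrite mulr_natl mulr2n.
rewrite [X in _ <= X + _]exchange_big /= -big_split /= mulr_sumr !big_seq.
apply: ler_sum => i si; rewrite -big_split /= mulr_sumr !big_seq.
apply: ler_sum => j sj; rewrite [`|G j - _|]distrC -mulrDl.
case: (ltngtP i j) => ij; rewrite ?addr0 ?add0r.
- by rewrite ler_wpM2r // kh.
- by rewrite ler_wpM2r // kh.
- by rewrite ij subrr normr0 !mulr0.
Qed.

Definition box_mean : R := mean (index_iota 0 a) (fun x =>
  mean (index_iota a (2 * a)) (fun y => mean (index_iota (2 * a) N) (F x y))).

Lemma moves_ge0 : [/\ 0 <= W_low, 0 <= W_mid & 0 <= W_high].
Proof.
have qw0 x u w z : (x < u)%N -> (u < w)%N -> (w < z)%N -> (z < N)%N -> 0 <= qw x u w z.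
  move=> xu uw wz zN; apply: le_trans (quad_weight_lower xu uw wz zN).
  by apply: divr_ge0; [rewrite invr_ge0|apply/exprn_ge0/ltW/pow32_N_gt0].
split; rewrite /low_moves /middle_moves /high_moves !big_nat;
  apply: sumr_ge0 => x xa; rewrite !big_nat; apply: sumr_ge0 => y ya;
  rewrite !big_nat; apply: sumr_ge0 => z za;
  rewrite !big_nat; apply: sumr_ge0 => x1 xa1; apply: (mulr_ge0 _ (normr_ge0 _));
  by case: ifP => // xx; apply: qw0; lia.
Qed.

(** The weight of a quadrilateral is at least of order [N ^ (- 6)], its order
    when no arc is short; the vertices may then be moved one at a time,
    uniformly over their ranges. *)
Lemma box_deviation : a%:R / (4096 * q ^+ 4) *
  (\sum_(0 <= x < a) \sum_(a <= y < 2 * a) \sum_(2 * a <= z < N)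
     `|F x y z - box_mean|) <= 2 * (W_low + W_mid + W_high).
Proof.
set k := 4096^-1 / q ^+ 4.
have k0 : 0 <= k.
  by apply: divr_ge0; [rewrite invr_ge0|apply/exprn_ge0/ltW/pow32_N_gt0].
have -> : a%:R / (4096 * q ^+ 4) = k * a%:R.
  by rewrite /k; field; rewrite gt_eqF ?pow32_N_gt0.
have ak : 0 <= k * a%:R by exact: mulr_ge0.
have dev_le (s : seq nat) (G : nat -> R) (h : nat -> nat -> R) : (a <= size s)%N ->
    {in s &, forall i j, (i < j)%N -> k <= h i j} ->
    k * a%:R * mean_dev s G <= 2 * \sum_(i <- s) \sum_(j <- s)
      (if (i < j)%N then h i j else 0) * `|G i - G j|.
  move=> sa kh; apply: le_trans (move_pairs G kh); rewrite -mulrA; apply: (ler_wpM2l k0).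
  apply: le_trans (mean_dev_pairs _ _); apply: ler_wpM2r; first exact: mean_dev_ge0.
  by rewrite ler_nat.
apply: le_trans (ler_wpM2l ak (mean_dev_product3 _ _ _ _)) _.
- by rewrite size_iota; lia.
- by rewrite size_iota; lia.
have -> : 2 * (W_low + W_mid + W_high) = 2 * W_high + 2 * W_mid + 2 * W_low.
  by ring.
rewrite mulrDr mulrDr; apply: lerD; first apply: lerD.
- rewrite /high_moves !mulr_sumr !big_nat; apply: ler_sum => x xa.
  rewrite !mulr_sumr !big_nat; apply: ler_sum => y ya.
  apply: (dev_le (index_iota (2 * a) N) (F x y) (fun z z2 => qw x y z z2)).
    by rewrite size_iota; lia.
  move=> z z2; rewrite !mem_index_iota => za za2 zz.
  by apply: quad_weight_lower; lia.
- rewrite /middle_moves !mulr_sumr !big_nat; apply: ler_sum => x xa.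
  rewrite [in leRHS]exchange_big /= !mulr_sumr !big_nat; apply: ler_sum => z za.
  apply: (dev_le (index_iota a (2 * a)) (fun y => F x y z) (fun y y2 => qw x y y2 z)).
    by rewrite size_iota; lia.
  move=> y y2; rewrite !mem_index_iota => ya ya2 yy.
  by apply: quad_weight_lower; lia.
- rewrite /low_moves [in leRHS]exchange_big /= !mulr_sumr !big_nat.
  apply: ler_sum => y ya.
  rewrite [in leRHS]exchange_big /= !mulr_sumr !big_nat; apply: ler_sum => z za.
  rewrite [in leRHS]exchange_big /=.
  under [in leRHS]eq_bigr do under eq_bigr do rewrite distrC.
  apply: (dev_le (index_iota 0 a) (fun x => F x y z) (fun x x1 => qw x x1 y z)).
    by rewrite size_iota; lia.
  move=> x x1; rewrite !mem_index_iota => xa xa1 xx.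
  by apply: quad_weight_lower; lia.
Qed.

Lemma long_deviation :
  \sum_(0 <= x < a) \sum_(a <= y < 2 * a) \sum_(2 * a <= z < N)
    (if [&& long_arc (y - x), long_arc (z - y) & long_arc (x + N - z)]
     then tw x y z * `|F x y z - box_mean| else 0) <=
  640 * pow32 R (5 * (2 * M + 1)) ^+ 3 * Num.sqrt N%:R *
    (W_low + W_mid + W_high).
Proof.
set B := pow32 R _; set W := W_low + _ + _.
have q0 := pow32_N_gt0; pose k := (B / (4 * q)) ^+ 3.
have B0 : 0 <= B by apply: mulr_ge0; rewrite ?sqrtr_ge0.
have Bq : 0 <= B / (4 * q) by apply: (divr_ge0 B0); apply: mulr_ge0 => //; exact: ltW.
have aR : (0 : R) < a%:R by rewrite ltr0n.
set S := \sum_(0 <= x < a) \sum_(a <= y < 2 * a) \sum_(2 * a <= z < N)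
     `|F x y z - box_mean|.
have boxd : a%:R / (4096 * q ^+ 4) * S <= 2 * W := box_deviation.
have W0 : 0 <= W by have [? ? ?] := moves_ge0; rewrite !addr_ge0.
have S_le : S <= 8192 * q ^+ 4 / a%:R * W.
  have p : 0 < a%:R / (4096 * q ^+ 4).
    by apply: (divr_gt0 aR); apply: mulr_gt0 => //; exact: exprn_gt0.
  rewrite -(ler_pM2l p); apply: le_trans boxd _.
  rewrite le_eqVlt; apply/orP; left; apply/eqP; field.
  by rewrite !gt_eqF.
apply: le_trans (_ : k * S <= _).
  rewrite /S mulr_sumr !big_nat; apply: ler_sum => x xa.
  rewrite mulr_sumr !big_nat; apply: ler_sum => y ya.
  rewrite mulr_sumr !big_nat; apply: ler_sum => z za.
  case: ifP => [/and3P[l1 l2 l3]|_]; last first.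
    by apply: (mulr_ge0 (exprn_ge0 _ Bq)).
  apply: ler_wpM2r => //; rewrite /k /triangle_arcs.
  have e1 : (N - (z - x) = x + N - z)%N by nat_lia.
  rewrite e1 exprSr expr2.
  have p1 : 0 <= v (y - x)%N by apply/ltW/v_gt0; nat_lia.
  have p2 : 0 <= v (z - y)%N by apply/ltW/v_gt0; nat_lia.
  have p3 : 0 <= v (x + N - z)%N by apply/ltW/v_gt0; nat_lia.
  apply: (ler_pM (mulr_ge0 p1 p2) p3); last by apply: profile_upper => //; nat_lia.
  by apply: (ler_pM p1 p2); apply: profile_upper => //; nat_lia.
apply: le_trans (ler_wpM2l (exprn_ge0 3 Bq) S_le) _.
rewrite mulrA; apply: (ler_wpM2r W0); rewrite /k.
have -> : (B / (4 * q)) ^+ 3 * (8192 * q ^+ 4 / a%:R) = 128 * B ^+ 3 * (q / a%:R).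
  by field; rewrite !gt_eqF.
have -> : 640 * B ^+ 3 * Num.sqrt N%:R = 128 * B ^+ 3 * (5 * Num.sqrt N%:R) by ring.
apply: ler_wpM2l; first by apply: mulr_ge0 => //; exact: exprn_ge0.
rewrite ler_pdivrMr // /pow32 mulrAC; apply: ler_wpM2r; first exact: sqrtr_ge0.
by rewrite -natrM ler_nat.
Qed.

Hypothesis M_large : 8 * pow32 R (4 * M + 1) / M%:R ^+ 2 <= 6^-1.

Definition separating_constant : R :=
  2 * (640 * pow32 R (5 * (2 * M + 1)) ^+ 3
       + (16 + 32 * (2 * M + 1)%:R * pow32 R (2 * M + 1))).

(** A triangle has three long arcs or a short one, and the three terms for
    short arcs return at most half of the deviation. *)
Theorem separating_poincare :
  deviation v N 0 a (2 * a) N F box_mean <=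
  separating_constant * Num.sqrt N%:R * (W_low + W_mid + W_high).
Proof.
have [W1 W2 W3] := moves_ge0.
set D := deviation _ _ _ _ _ _ _ _; set W := _ + _ + _.
have tw0 x y z : (0 <= x < a)%N -> (a <= y < 2 * a)%N -> (2 * a <= z < N)%N ->
    0 <= tw x y z * `|F x y z - box_mean|.
  move=> xa ya za; apply: (mulr_ge0 _ (normr_ge0 _)).
  apply: mulr_ge0; first apply: mulr_ge0; apply/ltW/v_gt0; nat_lia.
have D0 : 0 <= D.
  rewrite /D /deviation !big_nat; apply: sumr_ge0 => x xa.
  rewrite !big_nat; apply: sumr_ge0 => y ya.
  by rewrite !big_nat; apply: sumr_ge0 => z za; exact: tw0.
have := M_large; set t := 8 * _ / _ => tM.
have split4 : D <= (640 * pow32 R (5 * (2 * M + 1)) ^+ 3 * Num.sqrt N%:R * W) +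
   (16 * Num.sqrt N%:R * W_low +
  32 * (2 * M + 1)%:R * pow32 R (2 * M + 1) * Num.sqrt N%:R * W_mid + t * D) +
   (16 * Num.sqrt N%:R * W_mid +
  32 * (2 * M + 1)%:R * pow32 R (2 * M + 1) * Num.sqrt N%:R * W_high + t * D) +
   (16 * Num.sqrt N%:R * W_high +
  32 * (2 * M + 1)%:R * pow32 R (2 * M + 1) * Num.sqrt N%:R * W_low + t * D).
  apply: le_trans (lerD (lerD (lerD long_deviation (corner_xy box_mean))
    (corner_yz box_mean)) (corner_zx box_mean)).
  rewrite /D /deviation -!big_split !big_nat; apply: ler_sum => x xa /=.
  rewrite -!big_split !big_nat; apply: ler_sum => y ya /=.
  rewrite -!big_split !big_nat; apply: ler_sum => z za /=.
  have := tw0 _ _ _ xa ya za; set T := _ * _ => T0.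
  rewrite /long_arc /corner !ltnNge.
  by case: leqP => _; case: leqP => _; case: leqP => _; rewrite /=; lra.
have tD : t * D <= 6^-1 * D := ler_wpM2r D0 tM.
move: split4; rewrite /separating_constant.
set B := pow32 R (5 * _); set B' := pow32 R (2 * M + 1) => {}split4.
pose X := (640 * B ^+ 3 + (16 + 32 * (2 * M + 1)%:R * B')) * Num.sqrt N%:R * W.
have DX : D <= X + 3 * (t * D).
  apply: le_trans split4 _; rewrite le_eqVlt; apply/orP; left; apply/eqP.
  by rewrite /X /W; ring.
have -> : 2 * (640 * B ^+ 3 + (16 + 32 * (2 * M + 1)%:R * B')) * Num.sqrt N%:R * W
  = 2 * X by rewrite /X; ring.
by lra.
Qed.

End Separating.

Lemma separating_constant_ge0 (R : rcfType) M : 0 <= separating_constant R M.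
Proof.
have pow0 j : 0 <= pow32 R j by rewrite mulr_ge0 ?sqrtr_ge0.
rewrite /separating_constant; move: (pow0 (5 * (2 * M + 1))%N) (pow0 (2 * M + 1)%N).
move: (pow32 R _) (pow32 R _) => x y x0 y0.
apply: (mulr_ge0 (ler0n _ 2)); apply: addr_ge0.
  exact: (mulr_ge0 (ler0n _ 640) (exprn_ge0 3 x0)).
apply: (addr_ge0 (ler0n _ 16)).
exact: (mulr_ge0 (mulr_ge0 (ler0n _ 32) (ler0n _ _)) y0).
Qed.

(** * Growth of the Catalan numbers *)

Section CatalanAsymptotics.
Variable R : rcfType.

Definition scaled_count j : R := ntrees R j / 4 ^+ j.
Local Notation v := scaled_count.

Lemma scaled_count_gt0 j : (0 < j)%N -> 0 < v j.
Proof. by move=> j0; apply: divr_gt0; [exact: ntrees_gt0|exact: exprn_gt0]. Qed.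

Lemma scaled_countS j : (0 < j)%N ->
  v j.+1 = (2 * j%:R - 1) / (2 * (j%:R + 1)) * v j.
Proof.
move=> j0; have j1 : (j%:R + 1 : R) != 0 by rewrite natr1 pnatr_eq0.
have := @ntreesS R j j0; rewrite -[j.+1%:R]natr1 => h.
rewrite /scaled_count exprS.
have : (4 : R) ^+ j != 0 by rewrite expf_neq0 // pnatr_eq0.
move: (4 ^+ j) => c c0; apply: (mulfI j1); rewrite mulrA h; field.
by rewrite j1 c0.
Qed.

Lemma scaled_count_noninc i j : (0 < i <= j)%N -> v j <= v i.
Proof.
case/andP=> i0; elim: j => [|j IH] ij; first by lia.
case: (ltngtP i j.+1) => [lt_ij|lt_ij|->] //; last by lia.
have j0 : (0 < j)%N by lia.
have jR : (0 : R) < j%:R by rewrite ltr0n.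
apply: le_trans (IH lt_ij); rewrite scaled_countS // ler_piMl //.
  exact/ltW/scaled_count_gt0.
by rewrite ler_pdivrMr; lra.
Qed.

(** [v j ^ 2 * j ^ 3] decreases, and with a small shift it increases. *)
Lemma scaled_count_sqr_le j : (0 < j)%N -> v j ^+ 2 * j%:R ^+ 3 <= 16^-1.
Proof.
elim: j => // j IH _; case: (posnP j) => [->|j0].
  by rewrite /scaled_count ntrees1 expr1; lra.
apply: le_trans (IH j0); rewrite scaled_countS // -[j.+1%:R]natr1.
have jR : (1 : R) <= j%:R by rewrite ler1n.
move: (j%:R : R) (v j) jR => x y x1.
have -> : ((2 * x - 1) / (2 * (x + 1)) * y) ^+ 2 * (x + 1) ^+ 3 =
   y ^+ 2 * ((2 * x - 1) ^+ 2 * (x + 1) / 4).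
  by field; lra.
apply: ler_wpM2l; first exact: sqr_ge0.
by nra.
Qed.

Lemma scaled_count_sqr_ge j : (0 < j)%N ->
  64^-1 <= v j ^+ 2 * j%:R ^+ 2 * (j%:R - 3 / 4).
Proof.
elim: j => // j IH _; case: (posnP j) => [->|j0].
  by rewrite /scaled_count ntrees1 expr1; lra.
apply: le_trans (IH j0) _; rewrite scaled_countS // -[j.+1%:R]natr1.
have jR : (1 : R) <= j%:R by rewrite ler1n.
move: (j%:R : R) (v j) jR => x y x1.
have -> : ((2 * x - 1) / (2 * (x + 1)) * y) ^+ 2 * (x + 1) ^+ 2 * (x + 1 - 3 / 4) =
   y ^+ 2 * ((2 * x - 1) ^+ 2 * (x + 4^-1) / 4).
  by field; lra.
rewrite -mulrA; apply: ler_wpM2l; first exact: sqr_ge0.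
by nra.
Qed.

Lemma sqr_scaled_count j : (v j * pow32 R j) ^+ 2 = v j ^+ 2 * j%:R ^+ 3.
Proof. by rewrite /pow32 !exprMn sqr_sqrtr ?ler0n //; ring. Qed.

Lemma scaled_count_le j : (0 < j)%N -> v j * pow32 R j <= 4^-1.
Proof.
move=> j0; have p : 0 <= v j * pow32 R j.
  by apply: mulr_ge0; apply: ltW; [exact: scaled_count_gt0|exact: pow32_gt0].
rewrite -(@ler_sqr _ (v j * pow32 R j)) ?nnegrE // ?invr_ge0 // sqr_scaled_count.
by apply: le_trans (scaled_count_sqr_le j0) _; lra.
Qed.

Lemma scaled_count_ge j : (0 < j)%N -> 8^-1 <= v j * pow32 R j.
Proof.
move=> j0; have p : 0 <= v j * pow32 R j.
  by apply: mulr_ge0; apply: ltW; [exact: scaled_count_gt0|exact: pow32_gt0].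
rewrite -(@ler_sqr _ 8^-1) ?nnegrE // ?invr_ge0 // sqr_scaled_count.
have -> : (8^-1 : R) ^+ 2 = 64^-1 by field.
apply: le_trans (scaled_count_sqr_ge j0) _.
have -> : v j ^+ 2 * j%:R ^+ 3 = v j ^+ 2 * j%:R ^+ 2 * j%:R by ring.
apply: ler_wpM2l; last by lra.
by apply: mulr_ge0; exact: sqr_ge0.
Qed.

End CatalanAsymptotics.

Lemma triangle_weightE (R : rcfType) s x y z : (x < y < z)%N -> (z <= s)%N ->
  triangle_weight R s x y z = 4 ^+ s.+1 * triangle_arcs (scaled_count R) s.+1 x y z.
Proof.
move=> xyz zs; rewrite /triangle_weight /triangle_arcs /scaled_count.
have -> : (s.+1 - (z - x) = (s - z + x).+1)%N by lia.
have NE : s.+1 = ((s - z + x).+1 + (y - x) + (z - y))%N by lia.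
by rewrite {1}NE !exprD; field; rewrite !expf_neq0 // pnatr_eq0.
Qed.

Lemma quad_weightE (R : rcfType) s x u w z :
  (x < u)%N -> (u < w)%N -> (w < z)%N -> (z <= s)%N ->
  quad_weight R s x u w z = 4 ^+ s.+1 * quad_arcs (scaled_count R) s.+1 x u w z.
Proof.
move=> xu uw wz zs; rewrite /quad_weight /quad_arcs /scaled_count.
have -> : (s.+1 - (z - x) = (s - z + x).+1)%N by lia.
have NE : s.+1 = ((s - z + x).+1 + (u - x) + (w - u) + (z - w))%N by lia.
by rewrite {1}NE !exprD; field; rewrite !expf_neq0 // pnatr_eq0.
Qed.

(** * Moves of a separating triangle and the energy *)
Section MovesEnergy.
Variables (R : realFieldType) (s a b : nat) (f : tree -> R).
Hypotheses (a0 : (0 < a)%N) (ab : (a < b)%N) (bs : (b <= s)%N).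
Local Notation TM := (triangle_mean s f).
Local Notation qw := (quad_weight R s).
Local Notation G := (triangle_sum s (gradient f)).

Lemma energy_separating : energy s f =
  \sum_(0 <= x < a) \sum_(a <= y < b) \sum_(b <= z < s.+1) G x y z.
Proof. by rewrite /energy; apply: sum_separating_triangle; rewrite ?a0. Qed.

Lemma sum_pairs (m n : nat) (h : nat -> nat -> R) :
  \sum_(m <= i < n) \sum_(m <= j < n) (if (i < j)%N then h i j else 0) =
  \sum_(m <= i < n) \sum_(i.+1 <= j < n) h i j.
Proof.
rewrite !big_nat; apply: eq_bigr => i /andP[mi ij].
rewrite -big_mkcond (big_nat_widenl i.+1 m) //; exact: leq_trans mi _.
Qed.

Lemma sum_subrange (m n n' : nat) (h : nat -> R) : (m <= n)%N -> (n <= n')%N ->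
  (forall i, 0 <= h i) -> \sum_(m <= i < n) h i <= \sum_(m <= i < n') h i.
Proof.
move=> mn nn h0; rewrite [leRHS](@big_cat_nat _ _ _ n) //= lerDl.
exact: sumr_ge0.
Qed.

Lemma sum_subrange_low (m m' n : nat) (h : nat -> R) : (m <= m')%N -> (m' <= n)%N ->
  (forall i, 0 <= h i) -> \sum_(m' <= i < n) h i <= \sum_(m <= i < n) h i.
Proof.
move=> mm mn h0; rewrite [leRHS](@big_cat_nat _ _ _ m') //= lerDr.
exact: sumr_ge0.
Qed.

Lemma norm_sum_ge0 (m n : nat) (h : nat -> R) : 0 <= \sum_(m <= i < n) `|h i|.
Proof. exact: sumr_ge0. Qed.

Lemma energy_parts_ge0 x y z :
  [/\ 0 <= energy_outer s f x y z, 0 <= energy_left s f x y z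
    & 0 <= energy_right s f x y z].
Proof.
by split; do 2 (apply: sumr_ge0 => ? _); exact: energy_ge0.
Qed.

Lemma quad_parts_ge0 x y z :
  [/\ 0 <= \sum_(x.+1 <= u < y) quad_diff s f x u y z,
      0 <= \sum_(y.+1 <= u < z) quad_diff s f x y u z,
      0 <= \sum_(0 <= u < x) quad_diff s f u x y z
    & 0 <= \sum_(z.+1 <= u < s.+1) quad_diff s f x y z u].
Proof. by split; apply: sumr_ge0 => u _; exact: quad_diff_ge0. Qed.

(** A flip in the quadrilateral exchanges a triangle for another one; [m1] and
    [m2] are going to be the means over their classes. *)
Lemma quad_move_le x u w z (m1 m2 : R) :
  qw x u w z * `|m1 - m2| <=
  `|quad_sum_low s f x u w z - qw x u w z * m1| + quad_diff s f x u w z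
  + `|quad_sum_high s f x u w z - qw x u w z * m2|.
Proof.
have q0 : 0 <= qw x u w z by rewrite /qw !mulr_ge0 ?ntrees_ge0.
rewrite -[X in X * _](ger0_norm q0) -normrM mulrBr.
set A := quad_sum_low _ _ _ _ _ _; set B := quad_sum_high _ _ _ _ _ _.
apply: le_trans (_ : `|A - qw x u w z * m1| + `|A - B| + `|B - qw x u w z * m2| <= _).
  have -> : qw x u w z * m1 - qw x u w z * m2 =
    - (A - qw x u w z * m1) + (A - B) + (B - qw x u w z * m2) by ring.
  apply: le_trans (ler_normD _ _) _; rewrite lerD2r.
  by apply: le_trans (ler_normD _ _) _; rewrite normrN.
by rewrite lerD2r lerD2l quad_sum_diff.
Qed.

(** Summed over the moves, the terms of [quad_move_le] are distinct parts of
    [triangle_sum_gradient] at the two triangles. *)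
Lemma low_moves_energy :
  \sum_(0 <= x < a) \sum_(a <= y < b) \sum_(b <= z < s.+1) \sum_(0 <= x1 < a)
    (if (x1 < x)%N then qw x1 x y z * `|TM x y z - TM x1 y z| else 0)
  <= energy s f.
Proof.
rewrite energy_separating exchange_big [leRHS]exchange_big /= !big_nat.
apply: ler_sum => y ya; rewrite exchange_big [leRHS]exchange_big /= !big_nat.
apply: ler_sum => z zb; rewrite exchange_big sum_pairs /=.
apply: le_trans (_ : \sum_(0 <= x1 < a) \sum_(x1.+1 <= x < a)
  (`|quad_sum_low s f x1 x y z - qw x1 x y z * TM x1 y z| + quad_diff s f x1 x y z
  + `|quad_sum_high s f x1 x y z - qw x1 x y z * TM x y z|) <= _).
  by apply: ler_sum => x1 _; apply: ler_sum => x _; rewrite distrC quad_move_le.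
under [leLHS]eq_bigr do rewrite !big_split /=.
rewrite !big_split /=.
rewrite [X in _ + X <= _]sum_upper_lower -!big_split /= !big_nat.
apply: ler_sum => x xa; rewrite triangle_sum_gradient; [|lia|lia].
have xyz : (x < y < z)%N by lia.
have h1 := left_deviation s f xyz.
have zs : (z <= s)%N by lia.
have h2 := outer_deviation f xyz zs.
have xa1 : (x.+1 <= a)%N by lia.
have ay : (a <= y)%N by lia.
have h3 := sum_subrange xa1 ay (fun u => normr_ge0 (quad_sum_low s f x u y z
  - qw x u y z * TM x y z)).
have h4 := sum_subrange xa1 ay (fun u => quad_diff_ge0 s f x u y z).
have [e1 e2 e3] := energy_parts_ge0 x y z.
have [p1 p2 p3 p4] := quad_parts_ge0 x y z.
have p5 := norm_sum_ge0 z.+1 s.+1 (fun z' => quad_sum_low s f x y z z'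
  - qw x y z z' * TM x y z).
move: h1 h2 h3 h4 => /=; lra.
Qed.

Lemma middle_moves_energy :
  \sum_(0 <= x < a) \sum_(a <= y < b) \sum_(b <= z < s.+1) \sum_(a <= y2 < b)
    (if (y < y2)%N then qw x y y2 z * `|TM x y z - TM x y2 z| else 0)
  <= energy s f.
Proof.
rewrite energy_separating !big_nat; apply: ler_sum => x xa.
rewrite exchange_big [leRHS]exchange_big /= !big_nat; apply: ler_sum => z zb.
rewrite sum_pairs /=.
apply: le_trans (_ : \sum_(a <= y < b) \sum_(y.+1 <= y2 < b)
  (`|quad_sum_low s f x y y2 z - qw x y y2 z * TM x y2 z| + quad_diff s f x y y2 z
  + `|quad_sum_high s f x y y2 z - qw x y y2 z * TM x y z|) <= _).
  by apply: ler_sum => y _; apply: ler_sum => y2 _; rewrite distrC quad_move_le.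
under [leLHS]eq_bigr do rewrite !big_split /=.
rewrite !big_split /=.
rewrite [X in X + _ + _ <= _]sum_upper_lower [X in _ + X + _ <= _]sum_upper_lower.
rewrite -!big_split /= !big_nat; apply: ler_sum => y ya.
rewrite triangle_sum_gradient; [|lia|lia].
have xyz : (x < y < z)%N by lia.
have h1 := left_deviation s f xyz; have h2 := right_deviation s f xyz.
have xa1 : (x.+1 <= a)%N by lia.
have ay : (a <= y)%N by lia.
have yb : (y.+1 <= b)%N by lia.
have bz : (b <= z)%N by lia.
have h3 := sum_subrange_low xa1 ay (fun u => normr_ge0 (quad_sum_low s f x u y z
  - qw x u y z * TM x y z)).
have h4 := sum_subrange_low xa1 ay (fun u => quad_diff_ge0 s f x u y z).
have h5 := sum_subrange yb bz (fun u => normr_ge0 (quad_sum_high s f x y u z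
  - qw x y u z * TM x y z)).
have [e1 e2 e3] := energy_parts_ge0 x y z.
have [p1 p2 p3 p4] := quad_parts_ge0 x y z.
move: h1 h2 h3 h4 h5 => /=; lra.
Qed.

Lemma high_moves_energy :
  \sum_(0 <= x < a) \sum_(a <= y < b) \sum_(b <= z < s.+1) \sum_(b <= z2 < s.+1)
    (if (z < z2)%N then qw x y z z2 * `|TM x y z - TM x y z2| else 0)
  <= energy s f.
Proof.
rewrite energy_separating !big_nat; apply: ler_sum => x xa.
rewrite !big_nat; apply: ler_sum => y ya.
rewrite sum_pairs /=.
apply: le_trans (_ : \sum_(b <= z < s.+1) \sum_(z.+1 <= z2 < s.+1)
  (`|quad_sum_low s f x y z z2 - qw x y z z2 * TM x y z| + quad_diff s f x y z z2
  + `|quad_sum_high s f x y z z2 - qw x y z z2 * TM x y z2|) <= _).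
  by apply: ler_sum => z _; apply: ler_sum => z2 _; rewrite quad_move_le.
under [leLHS]eq_bigr do rewrite !big_split /=.
rewrite !big_split /=.
rewrite [X in _ + X <= _]sum_upper_lower.
rewrite -!big_split /= !big_nat; apply: ler_sum => z zb.
have zs : (z <= s)%N by lia.
rewrite triangle_sum_gradient //; last by lia.
have xyz : (x < y < z)%N by lia.
have h1 := right_deviation s f xyz; have h2 := outer_deviation f xyz zs.
have ya1 : (y.+1 <= b)%N by lia.
have bz : (b <= z)%N by lia.
have h3 := sum_subrange_low ya1 bz (fun u => normr_ge0 (quad_sum_high s f x y u z
  - qw x y u z * TM x y z)).
have [e1 e2 e3] := energy_parts_ge0 x y z.
have [p1 p2 p3 p4] := quad_parts_ge0 x y z.
have p5 := norm_sum_ge0 0 x (fun x' => quad_sum_high s f x' x y z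
  - qw x' x y z * TM x y z).
move: h1 h2 h3 => /=; lra.
Qed.

End MovesEnergy.

(** * The Poincare inequality for trees *)

Section Poincare.
Variable R : rcfType.
Implicit Type f : tree -> R.

Lemma mean_dev_root j f : (1 < j)%N ->
  mean_dev (trees j) f <=
  \sum_(1 <= i < j) (\sum_(B <- trees (j - i)) mean_dev (trees i) (fun X => f (Node X B))
   + \sum_(A <- trees i) mean_dev (trees (j - i)) (fun X => f (Node A X)))
  + root_dev j f.
Proof.
move=> j1; rewrite /mean_dev big_trees // /root_dev -big_split !big_nat /=.
apply: ler_sum => i ij; set m := mean (trees j) f.
set mi := mean (trees i) (fun A => mean (trees (j - i)) (fun B => f (Node A B))).
have i0 : (0 < size (trees i))%N by apply: trees_size_gt0; lia.
have ji0 : (0 < size (trees (j - i)))%N by apply: trees_size_gt0; lia.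
apply: le_trans (_ : \sum_(A <- trees i) \sum_(B <- trees (j - i))
  (`|f (Node A B) - mi| + `|mi - m|) <= _).
  by apply: ler_sum => A _; apply: ler_sum => B _; exact: ler_distD.
under [leLHS]eq_bigr do rewrite big_split /=.
rewrite big_split; apply: lerD => /=.
  rewrite addrC.
  exact: (@mean_dev_product2 _ _ _ (trees i) (trees (j - i)) (fun A B => f (Node A B))).
rewrite !sum_cst mulrA -natrM -[X in X * _](@ger0_norm _ (_ * _)%:R) // -normrM.
by rewrite mulrBr size_mean2 // natrM.
Qed.

(** The crude bound that starts the recursion. *)
Lemma mean_dev_linear j f : mean_dev (trees j) f <= j%:R * energy j f.
Proof.
have [n] := ubnP j; elim: n => // n IH in j f *; rewrite ltnS => jn.
case: (ltnP 1 j) => j1; last first.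
  case: j j1 {jn} => [|[|j]] // _.
    by rewrite /mean_dev big_nil mul0r.
  rewrite /mean_dev big_seq1 /mean big_seq1 divr1 subrr normr0.
  by rewrite mulr_ge0 // energy_ge0.
apply: le_trans (mean_dev_root _ j1) _.
have root_le := root_dev_le_energy j f.
set E1 := \sum_(1 <= i < j) \sum_(B <- trees (j - i)) energy i (fun X => f (Node X B)).
set E2 := \sum_(1 <= i < j) \sum_(A <- trees i) energy (j - i) (fun X => f (Node A X)).
have E12 : E1 + E2 <= energy j f.
  rewrite energy_rec // lerDl; apply: mulr_ge0 => //.
  by do 5! (apply: sumr_ge0 => ? _).
apply: le_trans (_ : (j%:R - 1) * (E1 + E2) + energy j f <= _).
  apply: lerD => //; rewrite -big_split mulr_sumr !big_nat; apply: ler_sum => i ij /=.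
  have ile : i%:R <= j%:R - 1 :> R by rewrite lerBrDr natr1 ler_nat; lia.
  have jile : (j - i)%:R <= j%:R - 1 :> R by rewrite lerBrDr natr1 ler_nat; lia.
  rewrite mulrDr !mulr_sumr; apply: lerD; apply: ler_sum => T _.
    by apply: le_trans (IH _ _ _) _; [lia|exact: (ler_wpM2r (energy_ge0 _ _) ile)].
  by apply: le_trans (IH _ _ _) _; [lia|exact: (ler_wpM2r (energy_ge0 _ _) jile)].
have j1R : 0 <= j%:R - 1 :> R by rewrite subr_ge0 ler1n ltnW.
apply: le_trans (_ : (j%:R - 1) * energy j f + energy j f <= _).
  by rewrite lerD2r; exact: ler_wpM2l.
by rewrite le_eqVlt; apply/orP; left; apply/eqP; ring.
Qed.

Lemma triangle_mean_nested s f x y z : triangle_mean s f x y z =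
  mean (trees (s - z + x).+1) (fun P => mean (trees (y - x)) (fun L =>
    mean (trees (z - y)) (fun M => f (attach P (s - z) (Node L M))))).
Proof.
rewrite /triangle_mean /triangle_weight /triangle_sum /mean -/(ntrees R _).
rewrite -/(ntrees R (y - x)) -/(ntrees R (z - y)).
under [in RHS]eq_bigr do rewrite -mulr_suml.
by rewrite -!mulr_suml !invfM -/(ntrees R _); ring.
Qed.

Lemma mean_dev_triangle s f (K : R) x y z : (x < y < z)%N -> (z <= s)%N ->
  (forall j g, (0 < j)%N ->
     (j <= maxn (s - z + x).+1 (maxn (y - x) (z - y)))%N ->
     mean_dev (trees j) g <= K * energy j g) ->
  \sum_(P <- trees (s - z + x).+1) \sum_(L <- trees (y - x))
    \sum_(M <- trees (z - y))
    `|f (attach P (s - z) (Node L M)) - triangle_mean s f x y z| <=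
  K * (energy_outer s f x y z + energy_left s f x y z + energy_right s f x y z).
Proof.
move=> xyz zs hK; rewrite triangle_mean_nested.
apply: le_trans (mean_dev_product3 _ (fun P L M => f (attach P (s - z) (Node L M))) _ _) _.
- by apply: trees_size_gt0; lia.
- by apply: trees_size_gt0; lia.
have -> : K * (energy_outer s f x y z + energy_left s f x y z + energy_right s f x y z)
 = K * energy_right s f x y z + K * energy_left s f x y z + K * energy_outer s f x y z.
  by ring.
apply: lerD; first apply: lerD; rewrite mulr_sumr; apply: ler_sum => P _;
  rewrite mulr_sumr; apply: ler_sum => L _; apply: hK; lia.
Qed.

(** One step of the recursion. Marking three sides at mutual distances of one
    third leaves polygons with at most three quarters of the leaves around the
    separating triangle; the deviation is that inside these polygons plus that
    of the class means, and [separating_poincare] bounds the latter. *)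
Lemma mean_dev_step M s f (K : R) : (0 < M)%N ->
  8 * pow32 R (4 * M + 1) / M%:R ^+ 2 <= 6^-1 -> (4 <= s)%N -> 0 <= K ->
  (forall j g, (0 < j)%N -> (4 * j <= 3 * s)%N ->
     mean_dev (trees j) g <= K * energy j g) ->
  mean_dev (trees s) f <=
    (K + 6 * separating_constant R M * Num.sqrt s.+1%:R) * energy s f.
Proof.
move=> M0 Ml s4 K0 hK; pose N := s.+1; pose a := (N %/ 3)%N; set m := mean (trees s) f.
have a0 : (0 < a)%N by rewrite /a /N; lia.
have aN : (3 * a <= N)%N by rewrite /a /N; lia.
have Na : (N <= 5 * a)%N by rewrite /a /N; lia.
have ab : (a < 2 * a)%N by lia.
have bs : (2 * a <= s)%N by lia.
pose C := separating_constant R M.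
pose F := triangle_mean s f; pose v := scaled_count R.
pose c := box_mean N a F.
have sep phi := @sum_separating_triangle R s phi a (2 * a) ltac:(lia) bs.
have range x y z : (0 <= x < a)%N -> (a <= y < 2 * a)%N -> (2 * a <= z < N)%N ->
    (x < y < z)%N /\ (z <= s)%N by rewrite /N; lia.
have four0 : 0 <= (4 : R) ^+ N by apply: exprn_ge0.
pose tw := triangle_weight R s.
pose D := \sum_(0 <= x < a) \sum_(a <= y < 2 * a) \sum_(2 * a <= z < N)
  tw x y z * `|F x y z - c|.
have D_le : D <= C * Num.sqrt N%:R * (3 * energy s f).
  have -> : D = 4 ^+ N * deviation v N 0 a (2 * a) N F c.
    rewrite /D /deviation mulr_sumr !big_nat; apply: eq_bigr => x xa.
    rewrite mulr_sumr !big_nat; apply: eq_bigr => y ya.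
    rewrite mulr_sumr !big_nat; apply: eq_bigr => z za.
    have [xyz zs] := range _ _ _ xa ya za.
    by rewrite mulrA /tw triangle_weightE.
  have poin := separating_poincare F (@scaled_count_gt0 R) (@scaled_count_noninc R)
    (@scaled_count_le R) (@scaled_count_ge R) M0 a0 aN Na Ml.
  apply: le_trans (ler_wpM2l four0 poin) _; rewrite -/C -/v mulrCA.
  have C0 : 0 <= C * Num.sqrt N%:R.
    by apply: mulr_ge0; [exact: separating_constant_ge0|exact: sqrtr_ge0].
  apply: (ler_wpM2l C0); rewrite !mulrDr.
  have -> : 3 * energy s f = energy s f + energy s f + energy s f by ring.
  apply: lerD; first apply: lerD.
  - apply: le_trans (low_moves_energy f a0 ab bs); rewrite le_eqVlt; apply/orP; left.
    apply/eqP; rewrite /low_moves mulr_sumr !big_nat; apply: eq_bigr => x xa.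
    rewrite mulr_sumr !big_nat; apply: eq_bigr => y ya.
    rewrite mulr_sumr !big_nat; apply: eq_bigr => z za.
    rewrite mulr_sumr !big_nat; apply: eq_bigr => x1 xa1.
    have [xyz zs] := range _ _ _ xa ya za.
    case: ifP => xx; last by rewrite mul0r mulr0.
    by rewrite mulrA quad_weightE //; clear -xyz zs xx; lia.
  - apply: le_trans (middle_moves_energy f a0 ab bs); rewrite le_eqVlt; apply/orP; left.
    apply/eqP; rewrite /middle_moves mulr_sumr !big_nat; apply: eq_bigr => x xa.
    rewrite mulr_sumr !big_nat; apply: eq_bigr => y ya.
    rewrite mulr_sumr !big_nat; apply: eq_bigr => z za.
    rewrite mulr_sumr !big_nat; apply: eq_bigr => y1 ya1.
    have [xyz zs] := range _ _ _ xa ya za.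
    case: ifP => xx; last by rewrite mul0r mulr0.
    by rewrite mulrA quad_weightE //; clear -xyz zs xx ya1 za; lia.
  - apply: le_trans (high_moves_energy f a0 ab bs); rewrite le_eqVlt; apply/orP; left.
    apply/eqP; rewrite /high_moves mulr_sumr !big_nat; apply: eq_bigr => x xa.
    rewrite mulr_sumr !big_nat; apply: eq_bigr => y ya.
    rewrite mulr_sumr !big_nat; apply: eq_bigr => z za.
    rewrite mulr_sumr !big_nat; apply: eq_bigr => z1 za1.
    have [xyz zs] := range _ _ _ xa ya za.
    case: ifP => xx; last by rewrite mul0r mulr0.
    by rewrite mulrA quad_weightE //; clear -xyz zs xx za1; rewrite /N in za1; lia.
have twF x y z : (x < y < z)%N -> tw x y z * F x y z = triangle_sum s f x y z.
  by move=> xyz; rewrite mulrC divfK // gt_eqF // triangle_weight_gt0.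
have tw_sum (k : R) : \sum_(0 <= x < a) \sum_(a <= y < 2 * a) \sum_(2 * a <= z < N)
    tw x y z * k = ntrees R s * k.
  rewrite -sum_cst sep; do 3! (apply: eq_bigr => ? _).
  by rewrite /triangle_sum !sum_cst /tw /triangle_weight !mulrA.
have tw0 x y z : 0 <= tw x y z by rewrite /tw !mulr_ge0 ?ntrees_ge0.
have cm : ntrees R s * `|c - m| <= D.
  rewrite -[X in X * _](ger0_norm (ntrees_ge0 R s)) -normrM mulrBr.
  have -> : ntrees R s * c - ntrees R s * m =
     \sum_(0 <= x < a) \sum_(a <= y < 2 * a) \sum_(2 * a <= z < N)
     tw x y z * (c - F x y z).
    rewrite -tw_sum size_mean; last by apply: trees_size_gt0; lia.
    rewrite sep -sumrB !big_nat; apply: eq_bigr => x xa.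
    rewrite -sumrB !big_nat; apply: eq_bigr => y ya.
    rewrite -sumrB !big_nat; apply: eq_bigr => z za.
    have [xyz zs] := range _ _ _ xa ya za.
    by rewrite mulrBr twF.
  do 3! (apply: le_trans (ler_norm_sum _ _ _) _; apply: ler_sum => ? _).
  by rewrite normrM ger0_norm // distrC.
have dev2 : \sum_(0 <= x < a) \sum_(a <= y < 2 * a) \sum_(2 * a <= z < N)
   tw x y z * `|F x y z - m| <= 2 * D.
  apply: le_trans (_ : D + ntrees R s * `|c - m| <= _); last first.
    by rewrite mulr_natl mulr2n lerD2l.
  rewrite -tw_sum -!big_split; apply: ler_sum => x _ /=.
  rewrite -!big_split; apply: ler_sum => y _ /=.
  rewrite -!big_split; apply: ler_sum => z _ /=.
  by rewrite -mulrDr; apply: (ler_wpM2l (tw0 x y z)); exact: ler_distD.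
rewrite mulrDl.
apply: le_trans (_ : K * energy s f + 2 * D <= _); last first.
  rewrite lerD2l; apply: le_trans (_ : 2 * (C * Num.sqrt N%:R * (3 * energy s f)) <= _).
    exact: ler_wpM2l.
  by rewrite le_eqVlt; apply/orP; left; apply/eqP; rewrite -/C -/N; ring.
rewrite /mean_dev -/m sep.
apply: le_trans (lerD (lexx _) dev2).
rewrite (energy_separating f a0 ab bs) mulr_sumr -big_split !big_nat.
apply: ler_sum => x xa /=; rewrite mulr_sumr -big_split !big_nat.
apply: ler_sum => y ya /=; rewrite mulr_sumr -big_split !big_nat.
apply: ler_sum => z za /=; have [xyz zs] := range _ _ _ xa ya za.
apply: le_trans (_ : \sum_(P <- trees (s - z + x).+1) \sum_(L <- trees (y - x))
    \sum_(T <- trees (z - y))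
    (`|f (attach P (s - z) (Node L T)) - F x y z| + `|F x y z - m|) <= _).
  by do 3! (apply: ler_sum => ? _); exact: ler_distD.
under [leLHS]eq_bigr do under eq_bigr do rewrite big_split /=.
under [leLHS]eq_bigr do rewrite big_split /=.
rewrite big_split; apply: lerD => /=; last first.
  by rewrite !sum_cst /tw /triangle_weight !mulrA.
apply: le_trans (mean_dev_triangle f (K := K) xyz zs _) _.
  move=> j g j0 jm; apply: hK => //; move: jm; rewrite !leq_max /a.
  by clear -xa ya za s4; rewrite /N /a /N in xa ya za *; lia.
apply: (ler_wpM2l K0); rewrite triangle_sum_gradient //.
have [p1 p2 p3 p4] := quad_parts_ge0 s f x y z; lra.
Qed.

Theorem tree_poincare : exists2 K : R, 0 < K &
  forall s f, (0 < s)%N -> mean_dev (trees s) f <= K * Num.sqrt s%:R * energy s f.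
Proof.
have [M M0 Ml] := small_transport_factor R.
set C := separating_constant R M.
have C0 : 0 <= C := separating_constant_ge0 R M.
(* [96 * C / 8] absorbs the cost [2 * 6 * C] of a step, and [4] the cases
   [s < 4]. *)
pose K := 96 * C + 4; have K0 : 0 < K by rewrite /K; lra.
exists K => // s f.
have [n] := ubnP s; elim: n => // n IH in s f *; rewrite ltnS => sn s0.
have sR : 1 <= Num.sqrt (s%:R : R) by rewrite -[leLHS]sqrtr1 ler_wsqrtr ?ler1n.
case: (leqP 4 s) => s4; last first.
  apply: le_trans (mean_dev_linear _ _) _; apply: ler_wpM2r; first exact: energy_ge0.
  apply: le_trans (_ : 4 * 1 <= _); first by rewrite mulr1 (ler_nat R s 4) ltnW.
  by apply: ler_pM => //; rewrite /K; lra.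
(* [7 / 8] exceeds the square root of [3 / 4]. *)
pose K' := K * (7 / 8 * Num.sqrt s%:R).
have K'0 : 0 <= K' by apply: mulr_ge0; [exact: ltW|lra].
apply: le_trans (mean_dev_step f (K := K') M0 Ml s4 K'0 _) _.
  move=> j g j0 js; apply: le_trans (IH _ _ _ j0) _; first by lia.
  apply: ler_wpM2r; first exact: energy_ge0.
  apply: ler_wpM2l; first exact: ltW.
  have -> : 7 / 8 * Num.sqrt s%:R = Num.sqrt ((7 / 8) ^+ 2 * s%:R) :> R.
    by rewrite sqrtrM ?sqr_ge0 // sqrtr_sqr ger0_norm //; lra.
  apply: ler_wsqrtr.
  have : 4 * j%:R <= 3 * s%:R :> R by rewrite -!natrM ler_nat.
  by have : 0 <= s%:R :> R by []; lra.
apply: ler_wpM2r; first exact: energy_ge0.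
have s1 : Num.sqrt s.+1%:R <= 2 * Num.sqrt s%:R :> R.
  have -> : 2 * Num.sqrt s%:R = Num.sqrt (2 ^+ 2 * s%:R) :> R.
    by rewrite sqrtrM ?sqr_ge0 // sqrtr_sqr ger0_norm.
  apply: ler_wsqrtr; rewrite -natr1.
  by have : 1 <= s%:R :> R by [rewrite ler1n]; lra.
have : C * Num.sqrt s.+1%:R <= C * (2 * Num.sqrt s%:R) by exact: ler_wpM2l.
have Cr : 0 <= C * Num.sqrt s%:R by apply: mulr_ge0 C0 (sqrtr_ge0 _).
have -> : K' + 6 * C * Num.sqrt s.+1%:R =
  7 / 8 * (96 * (C * Num.sqrt s%:R) + 4 * Num.sqrt s%:R) + 6 * (C * Num.sqrt s.+1%:R).
  by rewrite /K' /K; ring.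
have -> : K * Num.sqrt s%:R = 96 * (C * Num.sqrt s%:R) + 4 * Num.sqrt s%:R.
  by rewrite /K; ring.
by lra.
Qed.

End Poincare.

(** * A sparse cut *)

Section CrossingSums.
Variable R : rcfType.
Local Notation v := (scaled_count R).

(** This sum and the next one telescope by [scaled_countS]. *)
Lemma scaled_count_tail (m n : nat) : (0 < m <= n)%N ->
  \sum_(m <= l < n) v l = 2 * m%:R * v m - 2 * n%:R * v n.
Proof.
case/andP=> m0; elim: n => [|n IH] mn; first by lia.
case: (ltngtP m n.+1) => [lt_mn|lt_mn|->]; first last.
- by rewrite big_geq // subrr.
- by lia.
rewrite big_nat_recr //= IH // scaled_countS; last by lia.
rewrite -[n.+1%:R]natr1; field.
by rewrite natr1 pnatr_eq0.
Qed.

Lemma scaled_count_moment n :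
  \sum_(0 <= i < n) i.+1%:R * v i.+1 = 2 * n%:R * n.+1%:R * v n.+1.
Proof.
elim: n => [|n IH]; first by rewrite big_geq // mulr0 !mul0r.
rewrite big_nat_recr //= IH [v n.+2]scaled_countS // -![_.+1%:R]natr1; field.
by rewrite !natr1 pnatr_eq0.
Qed.

(** The total weight of the arcs that cross a fixed point: the inner sum is of
    order [i ^ (- 1 / 2)]. *)
Lemma crossing_sum_le m n : \sum_(0 <= i < m) \sum_(0 <= j < n) v (i + j).+1
  <= Num.sqrt m.+1%:R.
Proof.
apply: le_trans (_ : \sum_(0 <= i < m) 2 * (i.+1%:R * v i.+1) <= _).
  apply: ler_sum => i _.
  have -> : \sum_(0 <= j < n) v (i + j).+1 = \sum_(i.+1 <= l < i.+1 + n) v l.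
    rewrite -{1}[i.+1]add0n big_addn addKn; apply: eq_bigr => j _.
    by rewrite addnC addnS.
  rewrite scaled_count_tail ?leq_addr // mulrA lerBlDr lerDl.
  apply: mulr_ge0; first exact: mulr_ge0.
  by apply/ltW/scaled_count_gt0; lia.
rewrite -mulr_sumr scaled_count_moment.
have := scaled_count_le R (ltn0Sn m); rewrite /pow32 => h.
have r0 := sqrtr_ge0 (m.+1%:R : R).
have r2 : Num.sqrt m.+1%:R * Num.sqrt m.+1%:R = m.+1%:R :> R.
  by rewrite -expr2 sqr_sqrtr.
have mm : m%:R <= m.+1%:R :> R by rewrite ler_nat.
have v0 : 0 <= v m.+1 by apply/ltW/scaled_count_gt0.
apply: le_trans (_ : 2 * (2 * m.+1%:R * m.+1%:R * v m.+1) <= _).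
  apply: ler_wpM2l => //; apply: ler_wpM2r => //; apply: ler_wpM2r => //.
  exact: ler_wpM2l.
have -> : 2 * (2 * m.+1%:R * m.+1%:R * v m.+1) =
  4 * Num.sqrt m.+1%:R * (v m.+1 * (m.+1%:R * Num.sqrt m.+1%:R)).
  by rewrite -[X in _ * X * v _]r2; ring.
apply: le_trans (ler_wpM2l _ h) _; first exact: mulr_ge0.
by rewrite mulrAC divff ?mul1r // pnatr_eq0.
Qed.

Lemma crossing_window_le m k n : (m <= k)%N -> (k <= n)%N ->
  \sum_(m <= u < k) \sum_(k <= w < n) v (w - u) <= Num.sqrt (k - m).+1%:R.
Proof.
move=> mk kn; apply: le_trans (crossing_sum_le (k - m) (n - k)).
rewrite big_nat_rev /= -{1}[m]add0n big_addn !big_nat le_eqVlt; apply/orP; left.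
apply/eqP; apply: eq_bigr => i /andP[_ im].
rewrite -{1}[k]add0n big_addn; apply: eq_bigr => j _.
by congr (v _); lia.
Qed.

Lemma crossing_outer_le m k n : (m <= k)%N -> (k <= n)%N ->
  \sum_(0 <= x < m) \sum_(k <= z < n) v (n - (z - x)) <= Num.sqrt m.+1%:R.
Proof.
move=> mk kn; apply: le_trans (crossing_sum_le m (n - k)).
rewrite !big_nat le_eqVlt; apply/orP; left; apply/eqP.
apply: eq_bigr => x /andP[_ xm].
rewrite big_nat_rev /= -{1}[k]add0n big_addn !big_nat.
apply: eq_bigr => j /andP[_ jn].
by congr (v _); lia.
Qed.

End CrossingSums.

Section SeparatingApex.
Variables (a b : nat).

(** The vertex [y] of the triangle [x < a <= y < b <= z] of a triangulation
    of the polygon with vertices [off], [off.+1], and so on. *)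
Fixpoint separating_apex (off : nat) (T : tree) : nat :=
  if T is Node A B then
    let m := (off + leaves A)%N in
    if (m < a)%N then separating_apex m B
    else if (b <= m)%N then separating_apex off A else m
  else 0.

Hypothesis ab : (a <= b)%N.

Lemma separating_apex_attach off P k S : (k < leaves P)%N ->
  (off + (leaves P).-1 - k < a)%N -> (b <= off + (leaves P).-1 - k + leaves S)%N ->
  separating_apex off (attach P k S) =
  separating_apex (off + (leaves P).-1 - k) S.
Proof.
elim: P k S off => [|A IA B IB] k S off /=.
  by case: k => // _; rewrite addn0 subn0.
move=> kP ak bk; have lA := leaves_gt0 A; have lB := leaves_gt0 B.
case: ltnP => kA.
  rewrite IA //=; last 2 first.
  - by lia.
  - by lia.
  have -> : (off + (leaves A).-1 - k + leaves B = off + (leaves A + leaves B).-1 - k)%N.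
    by lia.
  by rewrite ak.
have e : (off + (leaves B).-1 - (k - leaves A) = off + (leaves A + leaves B).-1 - k)%N.
  by lia.
rewrite IB //=; last 3 first.
- by lia.
- by rewrite e.
- by rewrite e; apply: leq_trans bk _; lia.
rewrite e bk ifF //; apply/negbTE; rewrite -leqNgt.
exact: leq_trans ab bk.
Qed.

End SeparatingApex.

Section Cut.
Variables (R : rcfType) (s a h b : nat).
Hypotheses (a0 : (0 < a)%N) (ah : (a <= h)%N) (hb : (h <= b)%N) (ab : (a < b)%N)
  (bs : (b <= s)%N).

Definition low_apex (T : tree) := (separating_apex a b 0 T < h)%N.
Definition cut_indicator (T : tree) : R := (low_apex T)%:R.
Local Notation f := cut_indicator.
Local Notation qw := (quad_weight R s).

Lemma cut_attach x z P S : (x < a)%N -> (b <= z)%N -> (z <= s)%N ->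
  leaves P = (s - z + x).+1 -> leaves S = (z - x)%N ->
  f (attach P (s - z) S) = (separating_apex a b x S < h)%N%:R.
Proof.
move=> xa bz zs lP lS; rewrite /cut_indicator /low_apex.
have e : (0 + (leaves P).-1 - (s - z) = x)%N by rewrite lP; lia.
have := @separating_apex_attach a b (ltnW ab) 0 P (s - z) S.
by rewrite e lP lS => -> //; lia.
Qed.

Lemma cut_triangle x y z P L M : (x < a)%N -> (a <= y < b)%N -> (b <= z)%N ->
  (z <= s)%N -> leaves P = (s - z + x).+1 -> leaves L = (y - x)%N ->
  leaves M = (z - y)%N ->
  f (attach P (s - z) (Node L M)) = (y < h)%N%:R.
Proof.
move=> xa yb bz zs lP lL lM; rewrite (cut_attach xa) //=; last by lia.
have -> : (x + leaves L = y)%N by lia.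
have -> : (y < a)%N = false by lia.
by have -> : (b <= y)%N = false by lia.
Qed.

Lemma energy_cst j (g : tree -> R) (c : R) :
  (forall T, leaves T = j -> g T = c) -> energy j g = 0.
Proof.
move=> gc; rewrite /energy big_seq big1 // => T /mem_leaves lT.
rewrite /gradient big_seq big1 // => T' /leaves_flips lT'.
by rewrite !gc ?subrr ?normr0 // lT'.
Qed.

Lemma quad_diff_le x u w z (c : R) :
  (forall P A B C, leaves P = (s - z + x).+1 -> leaves A = (u - x)%N ->
    leaves B = (w - u)%N -> leaves C = (z - w)%N ->
    `|f (attach P (s - z) (Node (Node A B) C)) -
      f (attach P (s - z) (Node A (Node B C)))| <= c) ->
  quad_diff s f x u w z <= qw x u w z * c.
Proof.
move=> hc; rewrite /quad_weight -!mulrA -sum_cst /quad_diff !big_seq.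
apply: ler_sum => P /mem_leaves lP; rewrite -sum_cst !big_seq.
apply: ler_sum => A /mem_leaves lA; rewrite -sum_cst !big_seq.
apply: ler_sum => B /mem_leaves lB; rewrite -sum_cst !big_seq.
by apply: ler_sum => C /mem_leaves lC; exact: hc.
Qed.

Lemma cut_quad x u w z : (x < u < w)%N -> (w < z <= s)%N -> (x < a)%N ->
  (b <= z)%N -> (a <= w)%N -> (u < b)%N -> (a <= u)%N || (w < b)%N ->
  quad_diff s f x u w z <= qw x u w z *
    `|((if w < b then w else u) < h)%N%:R - ((if u < a then w else u) < h)%N%:R|.
Proof.
move=> xuw wzs xa bz aw ub uw; apply: quad_diff_le => P A B C lP lA lB lC.
rewrite !(@cut_attach x z) //=; try lia.
have -> : (x + (leaves A + leaves B) = w)%N by lia.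
have -> : (x + leaves A = u)%N by lia.
have -> : (u + leaves B = w)%N by lia.
have -> : (w < a)%N = false by lia.
have -> : (b <= u)%N = false by lia.
case: (leqP b w) => bw //; case: (ltnP u a) => ua //.
by move: uw; rewrite leqNgt ua ltnNge bw.
Qed.

(** The flips inside the three polygons around the separating triangle keep its
    middle vertex, and so do those that replace [x] or [z]. A flip is counted
    from both ends. *)
Lemma cut_energy : energy s f <= 2 *
  \sum_(0 <= x < a) \sum_(a <= u < h) \sum_(h <= w < b) \sum_(b <= z < s.+1)
    qw x u w z.
Proof.
have qw0 x u w z : 0 <= qw x u w z by rewrite !mulr_ge0 ?ntrees_ge0.
rewrite (energy_separating f a0 ab bs).
apply: le_trans (_ : \sum_(0 <= x < a) \sum_(a <= y < b) \sum_(b <= z < s.+1)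
  (\sum_(a <= u < y) (if (u < h <= y)%N then qw x u y z else 0) +
   \sum_(y.+1 <= w < b) (if (y < h <= w)%N then qw x y w z else 0)) <= _).
  rewrite !big_nat; apply: ler_sum => x xa; rewrite !big_nat; apply: ler_sum => y ya.
  rewrite !big_nat; apply: ler_sum => z za.
  have xyz : (x < y < z)%N by lia.
  have zs : (z <= s)%N by lia.
  have bz : (b <= z)%N by lia.
  have xa1 : (x < a)%N by lia.
  have tri P L M := @cut_triangle x y z P L M xa1 ya bz zs.
  rewrite triangle_sum_gradient //.
  have -> : energy_outer s f x y z = 0.
    rewrite /energy_outer big_seq big1 // => L /mem_leaves lL.
    rewrite big_seq big1 // => M /mem_leaves lM.
    by apply: energy_cst => P lP; exact: tri.
  have -> : energy_left s f x y z = 0.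
    rewrite /energy_left big_seq big1 // => P /mem_leaves lP.
    rewrite big_seq big1 // => M /mem_leaves lM.
    by apply: energy_cst => L lL; exact: tri.
  have -> : energy_right s f x y z = 0.
    rewrite /energy_right big_seq big1 // => P /mem_leaves lP.
    rewrite big_seq big1 // => L /mem_leaves lL.
    by apply: energy_cst => M lM; exact: tri.
  rewrite !add0r.
  have q3 : \sum_(0 <= x' < x) quad_diff s f x' x y z <= 0.
    rewrite big_nat; apply: sumr_le0 => x' xx'.
    apply: le_trans (cut_quad _ _ _ _ _ _ _) _; try lia.
    have -> : (y < b)%N by lia.
    by rewrite xa1 subrr normr0 mulr0.
  have q4 : \sum_(z.+1 <= z' < s.+1) quad_diff s f x y z z' <= 0.
    rewrite big_nat; apply: sumr_le0 => z' zz'.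
    apply: le_trans (cut_quad _ _ _ _ _ _ _) _; try lia.
    have -> : (y < a)%N = false by lia.
    have -> : (z < b)%N = false by lia.
    by rewrite subrr normr0 mulr0.
  have q1 : \sum_(x.+1 <= u < y) quad_diff s f x u y z <=
      \sum_(a <= u < y) (if (u < h <= y)%N then qw x u y z else 0).
    have ay : (a <= y)%N by lia.
    rewrite (@big_cat_nat _ _ _ a) //= -[leRHS]add0r.
    have yb : (y < b)%N by lia.
    apply: lerD.
      rewrite big_nat; apply: sumr_le0 => u ux.
      apply: le_trans (cut_quad _ _ _ _ _ _ _) _; try lia.
      have -> : (u < a)%N by lia.
      by rewrite yb subrr normr0 mulr0.
    rewrite !big_nat; apply: ler_sum => u uy.
    apply: le_trans (cut_quad _ _ _ _ _ _ _) _; try lia.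
    have -> : (u < a)%N = false by lia.
    rewrite yb; case: (ltnP u h) => uh; case: (ltnP y h) => yh;
      rewrite ?subrr ?sub0r ?normrN ?normr1 ?normr0 ?mulr1 ?mulr0 //; lia.
  have q2 : \sum_(y.+1 <= w < z) quad_diff s f x y w z <=
      \sum_(y.+1 <= w < b) (if (y < h <= w)%N then qw x y w z else 0).
    have yb : (y.+1 <= b)%N by lia.
    have ya0 : (y < a)%N = false by lia.
    rewrite (@big_cat_nat _ _ _ b) //= -[leRHS]addr0.
    apply: lerD; last first.
      rewrite big_nat; apply: sumr_le0 => w wz.
      apply: le_trans (cut_quad _ _ _ _ _ _ _) _; try lia.
      have -> : (w < b)%N = false by lia.
      by rewrite ya0 subrr normr0 mulr0.
    rewrite !big_nat; apply: ler_sum => w wb.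
    apply: le_trans (cut_quad _ _ _ _ _ _ _) _; try lia.
    have -> : (w < b)%N by lia.
    rewrite ya0; case: (ltnP w h) => wh; case: (ltnP y h) => yh;
      rewrite ?subrr ?sub0r ?normrN ?normr1 ?normr0 ?mulr1 ?mulr0 //; lia.
  by lra.
rewrite mulr_sumr; apply: ler_sum => x _.
pose Q u w := \sum_(b <= z < s.+1) qw x u w z.
pose S := \sum_(a <= u < b) \sum_(u.+1 <= w < b) (if (u < h <= w)%N then Q u w else 0).
have ifQ (c : bool) u w : \sum_(b <= z < s.+1) (if c then qw x u w z else 0) =
    if c then Q u w else 0 by case: c; rewrite // big1.
have SE : S = \sum_(a <= u < h) \sum_(h <= w < b) Q u w.
  rewrite /S (@big_cat_nat _ _ _ h) //= [X in _ + X]big_nat [X in _ + X]big1 ?addr0.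
    rewrite !big_nat; apply: eq_bigr => u uh.
    have uh1 : (u.+1 <= h)%N by lia.
    rewrite (@big_cat_nat _ _ _ h) //= big_nat big1 ?add0r; last first.
      by move=> w wh; rewrite ifF //; lia.
    by rewrite !big_nat; apply: eq_bigr => w wh; rewrite ifT //; lia.
  by move=> u uh; rewrite big1 // => w _; rewrite ifF //; lia.
apply: le_trans (_ : S + S <= _); last first.
  by rewrite -SE mulr_natl mulr2n.
under eq_bigr do rewrite big_split /=; rewrite big_split.
rewrite le_eqVlt; apply/orP; left; apply/eqP; congr (_ + _).
  rewrite /S sum_upper_lower; apply: eq_bigr => y _; rewrite exchange_big /=.
  by apply: eq_bigr => u _; rewrite ifQ.
apply: eq_bigr => y _; rewrite exchange_big /=.
by apply: eq_bigr => w _; rewrite ifQ.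
Qed.

Lemma sum_cut (phi : nat -> R) :
  \sum_(T <- trees s) phi (low_apex T) =
  \sum_(0 <= x < a) \sum_(a <= y < b) \sum_(b <= z < s.+1)
    triangle_weight R s x y z * phi (y < h)%N.
Proof.
rewrite (@sum_separating_triangle _ s _ a b) // ?a0 //.
rewrite !big_nat; apply: eq_bigr => x xa; rewrite !big_nat; apply: eq_bigr => y ya.
rewrite !big_nat; apply: eq_bigr => z za.
rewrite /triangle_sum /triangle_weight -!mulrA -sum_cst !big_seq.
apply: eq_bigr => P /mem_leaves lP; rewrite -sum_cst !big_seq.
apply: eq_bigr => L /mem_leaves lL; rewrite -sum_cst !big_seq.
apply: eq_bigr => M /mem_leaves lM; congr phi.
have xa1 : (x < a)%N by lia.
have zs : (z <= s)%N by lia.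
have bz : (b <= z)%N by lia.
have := cut_triangle xa1 ya bz zs lP lL lM.
by rewrite /cut_indicator; case: (low_apex _); case: (_ < h)%N => //= /eqP;
  rewrite eqr_nat.
Qed.

End Cut.

Section UpperBound.
Variable R : rcfType.
Local Notation v := (scaled_count R).

(** The trees are cut according to whether the middle vertex of the separating
    triangle lies in the first half of its range. Both parts have of order
    [4 ^ s * s ^ (- 3 / 2)] trees. A flip crosses the cut in a quadrilateral
    [x < u < h <= w < z]. Two opposite arcs of it are long.
    Each of the other two crosses a given point, and [v] sums to order [sqrt s]
    over such arcs; so there are of order [4 ^ s * s ^ (- 2)] such flips. *)
Theorem sparse_cut : exists2 C : R, 0 < C & forall s, (5 <= s)%N ->
  exists p : pred tree, let cut := energy s (fun T => (p T)%:R) : R in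
    forall q, q = p \/ q = predC p ->
      (0 < count q (trees s))%N /\
      cut <= C / Num.sqrt s%:R * (count q (trees s))%:R.
Proof.
(* Long arcs have length at least [a / 4], hence at least [N / 20]. *)
pose K := (pow32 R 20 / 4) ^+ 2.
have K0 : 0 <= K := sqr_ge0 _.
exists (768 * 1000 * K).
  apply: mulr_gt0; first exact: mulr_gt0.
  by apply: exprn_gt0; apply: divr_gt0 => //; exact: pow32_gt0.
move=> s s5; pose N := s.+1; pose a := (N %/ 3)%N; pose h := (a + a %/ 2)%N.
have a0 : (1 < a)%N by rewrite /a /N; lia.
have aN : (3 * a <= N)%N by rewrite /a /N; lia.
have Na : (N <= 5 * a)%N by rewrite /a /N; lia.
have ab : (a < 2 * a)%N by lia.
have bs : (2 * a <= s)%N by rewrite /N in aN; lia.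
have ah : (a <= h)%N by rewrite leq_addr.
have hb : (h <= 2 * a)%N by rewrite /h; lia.
exists (low_apex a h (2 * a)) => cut.
set r := Num.sqrt (N%:R : R).
have r0 : 0 < r by rewrite sqrtr_gt0 ltr0n.
have rr : N%:R = r ^+ 2 :> R by rewrite sqr_sqrtr.
have q3 : pow32 R N = r ^+ 3 by rewrite /pow32 -/r rr; ring.
have four0 : 0 < (4 : R) ^+ N by apply: exprn_gt0.
have cut_le : cut <= 4 ^+ N * (4 * K / r ^+ 4).
  have a1 : (0 < a)%N by lia.
  apply: le_trans (cut_energy R a1 ah hb ab bs) _.
  have k0 : 0 <= K / r ^+ 6 by apply: divr_ge0 => //; exact/exprn_ge0/ltW.
  have vge0 j : (0 < j)%N -> 0 <= v j by move=> j0; exact/ltW/scaled_count_gt0.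
  have vbig i j : (0 < i)%N -> (0 < j)%N -> (a <= 4 * i)%N -> (a <= 4 * j)%N ->
      v i * v j <= K / r ^+ 6.
    have v1 l : (0 < l)%N -> (a <= 4 * l)%N -> v l <= pow32 R 20 / (4 * r ^+ 3).
      move=> l0 al; have pl := pow32_gt0 R l0.
      have h1 : v l <= 4^-1 / pow32 R l by rewrite ler_pdivlMr // scaled_count_le.
      apply: le_trans h1 _; have h2 : r ^+ 3 <= pow32 R 20 * pow32 R l.
        by rewrite -q3 -pow32M pow32_le //; lia.
      have -> : pow32 R 20 / (4 * r ^+ 3) = 4^-1 * (pow32 R 20 / r ^+ 3).
        by field; rewrite gt_eqF.
      rewrite ler_pM2l ?invr_gt0 // ler_pdivlMr ?exprn_gt0 // mulrC.
      by rewrite ler_pdivrMr.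
    move=> i0 j0 ai aj.
    apply: le_trans (ler_pM (vge0 i i0) (vge0 j j0) (v1 i i0 ai) (v1 j j0 aj)) _.
    rewrite le_eqVlt; apply/orP; left; apply/eqP; rewrite /K; field.
    by rewrite gt_eqF.
  pose X := \sum_(0 <= x < a) \sum_(a <= u < h) \sum_(h <= w < 2 * a)
    \sum_(2 * a <= z < N) (v (w - u) * v (N - (z - x)) + v (u - x) * v (z - w)).
  have X_le : X <= 2 * r ^+ 2.
    have crossM (P Q : R) : 0 <= P -> 0 <= Q -> P <= r -> Q <= r -> P * Q <= r ^+ 2.
      by move=> P0 Q0 Pr Qr; rewrite expr2; exact: ler_pM.
    have rle m : (m <= N)%N -> Num.sqrt m%:R <= r.
      by move=> mN; apply: ler_wsqrtr; rewrite ler_nat.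
    have -> : X = (\sum_(a <= u < h) \sum_(h <= w < 2 * a) v (w - u)) *
        (\sum_(0 <= x < a) \sum_(2 * a <= z < N) v (N - (z - x))) +
        (\sum_(0 <= x < a) \sum_(a <= u < h) v (u - x)) *
        (\sum_(h <= w < 2 * a) \sum_(2 * a <= z < N) v (z - w)).
      rewrite /X.
      under eq_bigr do under eq_bigr do under eq_bigr do rewrite big_split /=.
      under eq_bigr do under eq_bigr do rewrite big_split /=.
      under eq_bigr do rewrite big_split /=.
      rewrite big_split; congr (_ + _) => /=.
        rewrite mulrC mulr_suml; apply: eq_bigr => x _.
        rewrite mulr_sumr; apply: eq_bigr => u _.
        rewrite mulr_sumr; apply: eq_bigr => w _.
        by rewrite mulr_suml; apply: eq_bigr => z _; rewrite mulrC.
      rewrite mulr_suml; apply: eq_bigr => x _.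
      rewrite mulr_suml; apply: eq_bigr => u _.
      rewrite mulr_sumr; apply: eq_bigr => w _.
      by rewrite mulr_sumr.
    have nn m n k l (g : nat -> nat -> nat) : (forall i j, (m <= i < n)%N ->
        (k <= j < l)%N -> (0 < g i j)%N) ->
        0 <= \sum_(m <= i < n) \sum_(k <= j < l) v (g i j).
      move=> g0; rewrite big_nat; apply: sumr_ge0 => i im.
      by rewrite big_nat; apply: sumr_ge0 => j jk; exact/vge0/g0.
    rewrite mulr_natl mulr2n; apply: lerD; apply: crossM.
    - by apply: nn; clear; lia.
    - by apply: nn => x z xa za; clear -xa za; lia.
    - apply: le_trans (crossing_window_le _ _ _) _ => //.
      by apply: rle; rewrite /h; clear -aN a0; lia.
    - apply: le_trans (crossing_outer_le _ _ _) _; [by clear; lia|by rewrite leqW|].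
      by apply: rle; clear -aN a0; lia.
    - by apply: nn; clear; lia.
    - by apply: nn; clear; lia.
    - apply: le_trans (crossing_window_le _ _ _) _ => //.
      by apply: rle; clear -aN a0; lia.
    - apply: le_trans (crossing_window_le _ _ _) _ => //; first by rewrite leqW.
      by apply: rle; rewrite /h; clear -aN a0; lia.
  apply: le_trans (_ : 2 * (4 ^+ N * (K / r ^+ 6 * X)) <= _); last first.
    apply: le_trans (_ : 2 * (4 ^+ N * (K / r ^+ 6 * (2 * r ^+ 2))) <= _).
      apply: ler_wpM2l => //; apply: ler_wpM2l; first exact: ltW.
      exact: ler_wpM2l.
    rewrite le_eqVlt; apply/orP; left; apply/eqP; field.
    by rewrite gt_eqF.
  apply: ler_wpM2l => //; rewrite /X !mulr_sumr !big_nat; apply: ler_sum => x xa.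
  rewrite !mulr_sumr !big_nat; apply: ler_sum => u ua.
  rewrite !mulr_sumr !big_nat; apply: ler_sum => w wh.
  rewrite !mulr_sumr !big_nat; apply: ler_sum => z za.
  rewrite quad_weightE; [|clear -xa ua; lia|clear -ua wh; lia|clear -wh za; lia
    |rewrite /N in za; clear -za; lia].
  apply: ler_wpM2l; first exact: ltW.
  rewrite /quad_arcs -/N.
  have i0 : (0 < u - x)%N by clear -xa ua; lia.
  have j0 : (0 < w - u)%N by clear -ua wh; lia.
  have k1 : (0 < z - w)%N by clear -wh za; lia.
  have l0 : (0 < N - (z - x))%N by clear -za xa; lia.
  (* Two opposite arcs of the quadrilateral are long; the other two are summed
     over the crossing of a point. *)
  have [/andP[c1 c2]|] := boolP ((a <= 4 * (u - x)) && (a <= 4 * (z - w)))%N.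
    apply: le_trans (_ : K / r ^+ 6 * (v (w - u) * v (N - (z - x))) <= _); last first.
      by apply: ler_wpM2l => //; rewrite lerDl mulr_ge0 // vge0.
    have -> : v (u - x) * v (w - u) * v (z - w) * v (N - (z - x)) =
      v (u - x) * v (z - w) * (v (w - u) * v (N - (z - x))) by ring.
    by apply: ler_wpM2r; [rewrite mulr_ge0 // vge0|exact: vbig].
  move=> no; have c1 : (a <= 4 * (w - u))%N.
    by move: no; rewrite /h in ua wh; clear -ua wh xa za aN; lia.
  have c2 : (a <= 4 * (N - (z - x)))%N.
    by move: no; rewrite /h in ua wh; clear -ua wh xa za aN; lia.
  apply: le_trans (_ : K / r ^+ 6 * (v (u - x) * v (z - w)) <= _); last first.
    by apply: ler_wpM2l => //; rewrite lerDr mulr_ge0 // vge0.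
  have -> : v (u - x) * v (w - u) * v (z - w) * v (N - (z - x)) =
    v (w - u) * v (N - (z - x)) * (v (u - x) * v (z - w)) by ring.
  by apply: ler_wpM2r; [rewrite mulr_ge0 // vge0|exact: vbig].
have count_ge (phi : nat -> R) y0 y1 : (forall k, 0 <= phi k) ->
    (a <= y0)%N -> (y1 <= 2 * a)%N -> (a <= 3 * (y1 - y0))%N ->
    (forall y, (y0 <= y < y1)%N -> phi (y < h)%N = 1) ->
    4 ^+ N / (192 * 1000 * r ^+ 3) <=
    \sum_(T <- trees s) phi (low_apex a h (2 * a) T).
  move=> phi0 ay0 y1b yy phi1.
  have a1 : (0 < a)%N by lia.
  rewrite (sum_cut a1 ah hb ab bs).
  pose c : R := 4 ^+ N * (8^-1 / r ^+ 3) ^+ 3.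
  have c8 : 0 <= 8^-1 / r ^+ 3 by apply: divr_ge0; [rewrite invr_ge0|exact/exprn_ge0/ltW].
  apply: le_trans (_ : \sum_(0 <= x < a) \sum_(y0 <= y < y1)
      \sum_(2 * a <= z < N) c <= _); last first.
    rewrite !big_nat; apply: ler_sum => x xa.
    have tp0 y : 0 <= \sum_(2 * a <= z < N) triangle_weight R s x y z * phi (y < h)%N.
      by apply: sumr_ge0 => z _; rewrite !mulr_ge0 ?ntrees_ge0.
    have y01 : (y0 <= y1)%N by clear -yy a0; lia.
    apply: le_trans (le_trans (sum_subrange y01 y1b tp0)
      (sum_subrange_low ay0 (leq_trans y01 y1b) tp0)).
    rewrite !big_nat; apply: ler_sum => y yr; rewrite phi1 //.
    rewrite !big_nat; apply: ler_sum => z za; rewrite mulr1.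
    have xyz : (x < y < z)%N by clear -xa yr ay0 y1b za; lia.
    rewrite triangle_weightE //; last by rewrite /N in za; clear -za; lia.
    rewrite /c; apply: ler_wpM2l; first exact: ltW.
    have low l : (0 < l <= N)%N -> 8^-1 / r ^+ 3 <= v l.
      move=> /andP[l0 lN]; rewrite ler_pdivrMr ?exprn_gt0 // -q3.
      apply: le_trans (scaled_count_ge R l0) _; apply: ler_wpM2l; last exact: pow32_le.
      exact/ltW/scaled_count_gt0.
    rewrite exprSr expr2 /triangle_arcs -/N.
    apply: (ler_pM (mulr_ge0 c8 c8) c8); last by apply: low; clear -xa xyz za; lia.
    by apply: (ler_pM c8 c8); apply: low; clear -xa xyz za; lia.
  rewrite !sumr_const_nat -!mulrnA subn0 -[leRHS]mulr_natr.
  have -> : 4 ^+ N / (192 * 1000 * r ^+ 3) = c * (375^-1 * r ^+ 6).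
    by rewrite /c; field; rewrite gt_eqF.
  have c0 : 0 <= c by apply: mulr_ge0; [exact: ltW|exact: exprn_ge0].
  apply: (ler_wpM2l c0).
  have -> : r ^+ 6 = N%:R * N%:R * N%:R :> R by rewrite rr; ring.
  have aR : N%:R <= 5 * a%:R :> R by rewrite -natrM ler_nat.
  have yR : a%:R <= 3 * (y1 - y0)%:R :> R by rewrite -natrM ler_nat.
  have zR : a%:R <= (N - 2 * a)%:R :> R by rewrite ler_nat; clear -aN; lia.
  rewrite !natrM; have NR : 0 <= N%:R :> R by [].
  apply: le_trans (_ : 375^-1 * (5 * a%:R * (5 * a%:R) * (5 * a%:R)) <= _).
    apply: ler_wpM2l; first by rewrite invr_ge0.
    by apply: (ler_pM (mulr_ge0 NR NR) NR _ aR); exact: ler_pM.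
  have -> : 375^-1 * (5 * a%:R * (5 * a%:R) * (5 * a%:R)) =
     a%:R * (3^-1 * a%:R) * a%:R :> R by field.
  have aR0 : 0 <= a%:R :> R by [].
  have a3 : 0 <= 3^-1 * a%:R :> R by apply: mulr_ge0 => //; rewrite invr_ge0.
  rewrite [(N - 2 * a)%:R * _]mulrC.
  apply: (ler_pM (mulr_ge0 aR0 a3) aR0 _ zR); rewrite mulrC.
  by apply: (ler_pM a3 aR0 _ (lexx _)); rewrite ler_pdivrMl.
have conclude (n : nat) : 4 ^+ N / (192 * 1000 * r ^+ 3) <= n%:R ->
    (0 < n)%N /\ cut <= 768 * 1000 * K / Num.sqrt s%:R * n%:R.
  move=> n_ge; have lb_gt0 : 0 < 4 ^+ N / (192 * 1000 * r ^+ 3).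
    apply: divr_gt0; first exact: exprn_gt0.
    by apply: mulr_gt0; [exact: mulr_gt0|exact: exprn_gt0].
  have n0 : 0 < n%:R :> R := lt_le_trans lb_gt0 n_ge.
  split; first by rewrite -(ltr0n R).
  apply: le_trans cut_le _.
  have C0 : 0 <= 768 * 1000 * K := mulr_ge0 (mulr_ge0 (ler0n _ 768) (ler0n _ 1000)) K0.
  have sr : 0 < Num.sqrt (s%:R : R) by rewrite sqrtr_gt0 ltr0n (leq_trans _ s5).
  apply: le_trans (_ : 768 * 1000 * K / r * n%:R <= _).
    have -> : 4 ^+ N * (4 * K / r ^+ 4) =
      768 * 1000 * K / r * (4 ^+ N / (192 * 1000 * r ^+ 3)).
      by field; rewrite gt_eqF.
    by apply: ler_wpM2l n_ge; apply: (divr_ge0 C0); exact: ltW.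
  apply: ler_wpM2r; first exact: ltW.
  apply: (ler_wpM2l C0); rewrite lef_pV2 ?posrE //; apply: ler_wsqrtr; rewrite ler_nat; exact: leqnSn.
have countE (p : pred tree) : (count p (trees s))%:R = \sum_(T <- trees s) (p T)%:R :> R.
  by rewrite -sum1_count big_mkcond natr_sum; apply: eq_bigr => T _; case: (p T).
move=> q [] ->; apply: conclude.
  rewrite countE; apply: (count_ge (fun k => k%:R) a h) => //.
    by rewrite /h; lia.
  by move=> y yh; case/andP: yh => _ ->.
rewrite countE.
have := count_ge (fun k => (k == 0)%N%:R) h (2 * a)%N.
move=> H; apply: le_trans (H _ _ _ _ _) _ => //.
- by rewrite /h; clear -a0; lia.
- by move=> y /andP[hy _]; rewrite ltnNge hy.
by rewrite le_eqVlt; apply/orP; left; apply/eqP/eq_bigr => T _ /=; case: (low_apex _).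
Qed.

End UpperBound.

Local Open Scope nat_scope.

(** * The chords of a tree *)

(** The chords [(i, j)] that are the root sides of the subtrees of [T], with
    more than one leaf, when the leaves of [T] are the sides [(off, off.+1)],
    [(off.+1, off.+2)], and so on. *)
Fixpoint has_chord (off : nat) (T : tree) (i j : nat) : bool :=
  if T is Node A B then
    [|| (i == off) && (j == off + leaves A + leaves B),
        has_chord off A i j | has_chord (off + leaves A) B i j]
  else false.

Lemma has_chord_range off T i j : has_chord off T i j ->
  [/\ off <= i, i.+1 < j & j <= off + leaves T].
Proof.
elim: T off => //= A IA B IB off.
have := leaves_gt0 A; have := leaves_gt0 B => lB lA.
case/or3P => [/andP[/eqP-> /eqP->]|/IA[? ? ?]|/IB[? ? ?]]; split; lia.
Qed.

Lemma has_chord_root off T : 1 < leaves T -> has_chord off T off (off + leaves T).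
Proof. by case: T => //= A B _; rewrite !eqxx addnA eqxx. Qed.

Lemma has_chord_left off A B i j : j <= off + leaves A ->
  has_chord off (Node A B) i j = has_chord off A i j.
Proof.
move=> jA /=; have := leaves_gt0 B => lB.
have -> : (j == off + leaves A + leaves B) = false by lia.
rewrite andbF /=; case hB: (has_chord (_ + _) B i j); rewrite ?orbF //.
by have [] := has_chord_range hB; lia.
Qed.

Lemma has_chord_right off A B i j : off + leaves A <= i ->
  has_chord off (Node A B) i j = has_chord (off + leaves A) B i j.
Proof.
move=> iA /=; have := leaves_gt0 A => lA.
have -> : (i == off) = false by lia.
case hA: (has_chord off A i j) => //=.
by have [] := has_chord_range hA; lia.
Qed.

Lemma has_chord_noncrossing off T i j k l :
  has_chord off T i j -> has_chord off T k l -> ~~ [&& i < k, k < j & j < l].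
Proof.
elim: T off => //= A IA B IB off.
move=> /or3P[/andP[/eqP-> /eqP->]|hA|hB] /or3P[/andP[/eqP-> /eqP->]|hA'|hB'].
- by lia.
- by have := has_chord_range hA'; case; lia.
- by have := has_chord_range hB'; case; lia.
- by have := has_chord_range hA; case; lia.
- exact: IA hA hA'.
- by have := has_chord_range hA; have := has_chord_range hB'; case=> ? ? ? [? ? ?]; lia.
- by have := has_chord_range hB; case; lia.
- by have := has_chord_range hB; have := has_chord_range hA'; case=> ? ? ? [? ? ?]; lia.
- exact: IB hB hB'.
Qed.

(** In the smallest subtree that spans [(i, j)], the root side of a child
    crosses it. *)
Lemma has_chord_maximal off T i j :
  off <= i -> i.+1 < j -> j <= off + leaves T -> ~~ has_chord off T i j ->
  exists k l, has_chord off T k l /\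
    ([&& k < i, i < l & l < j] \/ [&& i < k, k < j & j < l]).
Proof.
elim: T off => [|A IA B IB] off oi ij; first by rewrite /=; lia.
have := leaves_gt0 A; have := leaves_gt0 B => lB lA.
case: (leqP j (off + leaves A)) => jA.
  rewrite has_chord_left // => _ /(IA _ oi ij jA)[k [l [hkl cr]]].
  by exists k, l; split=> //=; rewrite hkl orbT.
case: (leqP (off + leaves A) i) => iA.
  rewrite has_chord_right //= => jB /(IB _ iA ij).
  move=> /(_ ltac:(lia))[k [l [hkl cr]]].
  by exists k, l; split=> //=; rewrite hkl !orbT.
move=> jE nc; case: (ltnP off i) => oi'.
  exists off, (off + leaves A); split; last by lia.
  by rewrite has_chord_left // has_chord_root //; lia.
have jB : j < off + leaves (Node A B).
  by move: nc jE => /=; rewrite !negb_or; case/and3P; lia.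
exists (off + leaves A), (off + leaves (Node A B)); split; last by lia.
rewrite has_chord_right // /= addnA has_chord_root //.
by rewrite /= in jB; lia.
Qed.

Lemma has_chord_sub off A B A' B' : leaves A = leaves A' ->
  (forall i j, has_chord off (Node A B) i j -> has_chord off (Node A' B') i j) ->
  (forall i j, has_chord off A i j -> has_chord off A' i j) /\
  (forall i j, has_chord (off + leaves A) B i j ->
               has_chord (off + leaves A') B' i j).
Proof.
move=> lA h; split=> i j hij.
  have [? ? jA] := has_chord_range hij.
  rewrite -(@has_chord_left off A' B') -?lA //; apply: h.
  by rewrite has_chord_left.
have [iA ? ?] := has_chord_range hij.
rewrite -(@has_chord_right off A' B') -?lA //; apply: h.
by rewrite has_chord_right.
Qed.

Lemma crossing_false off T i j k l :
  has_chord off T i j -> has_chord off T k l -> i < k -> k < j -> j < l -> False.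
Proof.
by move=> h1 h2 ik kj jl; have := has_chord_noncrossing h1 h2; rewrite ik kj jl.
Qed.

(** If the root triangles differed, the root sides of two children would
    cross. *)
Lemma has_chord_inj off T T' : leaves T = leaves T' ->
  (forall i j, has_chord off T i j -> has_chord off T' i j) -> T = T'.
Proof.
elim: T T' off => [|A IA B IB] [|A' B'] off //.
- by rewrite /=; have := leaves_gt0 A'; have := leaves_gt0 B'; lia.
- by rewrite /=; have := leaves_gt0 A; have := leaves_gt0 B; lia.
move=> lT h; rewrite /= in lT; have := leaves_gt0 A; have := leaves_gt0 B => lB lA.
have := leaves_gt0 A'; have := leaves_gt0 B' => lB' lA'.
have E : off + (leaves A + leaves B) = off + (leaves A' + leaves B') by lia.
have chordsL (C D : tree) : 1 < leaves C -> has_chord off (Node C D) off (off + leaves C).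
  by move=> ?; rewrite has_chord_left // has_chord_root.
have chordsR (C D : tree) : 1 < leaves D ->
    has_chord off (Node C D) (off + leaves C) (off + (leaves C + leaves D)).
  by move=> ?; rewrite has_chord_right // addnA has_chord_root.
have lAA : leaves A = leaves A'.
  case: (ltngtP (leaves A) (leaves A')) => // AA; exfalso.
    have h1 := chordsL A' B' ltac:(lia); have h2 := h _ _ (chordsR A B ltac:(lia)).
    by apply: (crossing_false h1 h2); lia.
  have h1 := h _ _ (chordsL A B ltac:(lia)); have h2 := chordsR A' B' ltac:(lia).
  by apply: (crossing_false h1 h2); lia.
have [hA hB] := @has_chord_sub off A B A' B' lAA h.
congr Node; first exact: IA hA.
rewrite -lAA in hB; apply: IB hB; lia.
Qed.

(** If the root triangles agree, the missing diagonal lies below one of the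
    children. If not, it is the root side of the child of [T] that the root
    triangle of [T'] cuts, and the chords that remain force [T'] to be a
    rotation of [T]. *)
Lemma has_chord_flip off T T' p q : leaves T = leaves T' ->
  ~~ ((p == off) && (q == off + leaves T)) ->
  (forall i j, has_chord off T i j -> ~~ ((i == p) && (j == q)) ->
               has_chord off T' i j) ->
  T = T' \/ T' \in flips T.
Proof.
elim: T T' off => [|A IA B IB] [|A' B'] off.
- by left.
- by rewrite /=; have := leaves_gt0 A'; have := leaves_gt0 B'; lia.
- by rewrite /=; have := leaves_gt0 A; have := leaves_gt0 B; lia.
move=> lT npq h; have := leaves_gt0 A; have := leaves_gt0 B => lB lA.
have := leaves_gt0 A'; have := leaves_gt0 B' => lB' lA'.
rewrite /= in lT npq.
have chordsL (C D : tree) : 1 < leaves C -> has_chord off (Node C D) off (off + leaves C).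
  by move=> ?; rewrite has_chord_left // has_chord_root.
have chordsR (C D : tree) : 1 < leaves D ->
    has_chord off (Node C D) (off + leaves C) (off + (leaves C + leaves D)).
  by move=> ?; rewrite has_chord_right // addnA has_chord_root.
case: (ltngtP (leaves A) (leaves A')) => [AA|AA|AA].
- (* the missing diagonal is the root side of [B] *)
  have h1 := chordsL A' B' ltac:(lia); have h2 := chordsR A B ltac:(lia).
  have /andP[/eqP pE /eqP qE] : (off + leaves A == p) &&
      (off + (leaves A + leaves B) == q).
    apply/negPn/negP => /(h _ _ h2) h3.
    by apply: (crossing_false h1 h3); lia.
  case: B => [|B1 B2] in IB lB lT h chordsR h2 npq pE qE *.
    by rewrite /= in lT; lia.
  have := leaves_gt0 B1; have := leaves_gt0 B2 => lB2 lB1.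
  have hB i j : has_chord (off + leaves A) (Node B1 B2) i j ->
      ~~ ((i == p) && (j == q)) -> has_chord off (Node A' B') i j.
    move=> hij; apply: h; rewrite has_chord_right //.
    by have [] := has_chord_range hij.
  rewrite /= in lT qE lB.
  have lA'E : leaves A' = leaves A + leaves B1.
    case: (ltngtP (leaves A') (leaves A + leaves B1)) => // A1; exfalso.
      have h3 : has_chord off (Node A' B') (off + leaves A) (off + leaves A + leaves B1).
        apply: hB; last by rewrite -pE -qE; lia.
        by rewrite has_chord_left // has_chord_root //; lia.
      have h4 := chordsR A' B' ltac:(lia).
      by apply: (crossing_false h3 h4); lia.
    have h3 : has_chord off (Node A' B') (off + leaves A + leaves B1)
        (off + leaves A + (leaves B1 + leaves B2)).
      apply: hB; last by rewrite -pE -qE; lia.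
      by rewrite has_chord_right // addnA has_chord_root //; lia.
    by apply: (crossing_false h1 h3); lia.
  have lB'E : leaves B2 = leaves B' by lia.
  case: A' => [|C D] in lT h h1 hB chordsL lA' AA lA'E *; first by rewrite /= in AA; lia.
  have := leaves_gt0 C; have := leaves_gt0 D => lD lC.
  rewrite /= in lA'E lA' AA.
  have inA' i j : has_chord off (Node A (Node B1 B2)) i j -> ~~ ((i == p) && (j == q)) ->
      j <= off + leaves (Node C D) -> has_chord off (Node C D) i j.
    by move=> hij npij jl; rewrite -(@has_chord_left off _ B') // h.
  have lCE : leaves A = leaves C.
    case: (ltngtP (leaves A) (leaves C)) => // AC; exfalso.
      have h3 : has_chord off (Node C D) (off + leaves A) (off + leaves A + leaves B1).
        apply: inA'; [|by rewrite -pE -qE; lia|by rewrite /=; lia].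
        by rewrite has_chord_right // has_chord_left // has_chord_root //; lia.
      have h4 := has_chord_root off (ltac:(lia) : 1 < leaves C).
      rewrite -(@has_chord_left off C D) // in h4.
      by apply: (crossing_false h4 h3); lia.
    have h3 : has_chord off (Node C D) off (off + leaves A).
      apply: inA'; [|by rewrite -pE -qE; lia|by rewrite /=; lia].
      by rewrite has_chord_left // has_chord_root //; lia.
    have h4 := has_chord_root (off + leaves C) (ltac:(lia) : 1 < leaves D).
    rewrite -(@has_chord_right off C D) // in h4.
    by apply: (crossing_false h3 h4); lia.
  have lDE : leaves B1 = leaves D by lia.
  have eA : A = C.
    apply: (@has_chord_inj off) => // i j hij.
    have [? ? ?] := has_chord_range hij.
    rewrite -(@has_chord_left off C D) -?lCE //; apply: inA'.
    - by rewrite has_chord_left.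
    - by rewrite -pE -qE; lia.
    - by rewrite /=; lia.
  have eB1 : B1 = D.
    apply: (@has_chord_inj (off + leaves A)) => // i j hij.
    have [? ? ?] := has_chord_range hij.
    rewrite {1}lCE -(@has_chord_right off C D) -?lCE //; apply: inA'.
    - by rewrite has_chord_right // has_chord_left.
    - by rewrite -pE -qE; lia.
    - by rewrite /=; lia.
  have eB2 : B2 = B'.
    apply: (@has_chord_inj (off + leaves A + leaves B1)) => // i j hij.
    have [? ? ?] := has_chord_range hij.
    have lCDE : off + leaves A + leaves B1 = off + leaves (Node C D) by rewrite /=; lia.
    rewrite lCDE -(@has_chord_right off (Node C D) B') -?lCDE //; apply: h.
      by rewrite has_chord_right ?has_chord_right //; lia.
    by rewrite -pE -qE; lia.
  by right; rewrite -eA -eB1 -eB2 /= !mem_cat mem_head !orbT.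
- (* the missing diagonal is the root side of [A] *)
  have h1 := chordsR A' B' ltac:(lia); have h2 := chordsL A B ltac:(lia).
  have /andP[/eqP pE /eqP qE] : (off == p) && (off + leaves A == q).
    apply/negPn/negP => /(h _ _ h2) h3.
    by apply: (crossing_false h3 h1); lia.
  case: A => [|A1 A2] in IA lA lT h chordsL AA h2 npq pE qE *.
    by rewrite /= in AA; lia.
  have := leaves_gt0 A1; have := leaves_gt0 A2 => lA2 lA1.
  have hA i j : has_chord off (Node A1 A2) i j ->
      ~~ ((i == p) && (j == q)) -> has_chord off (Node A' B') i j.
    move=> hij; apply: h; rewrite has_chord_left //.
    by have [] := has_chord_range hij.
  rewrite /= in lT qE lA AA.
  have lA'E : leaves A' = leaves A1.
    case: (ltngtP (leaves A') (leaves A1)) => // A11; exfalso.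
      have h3 : has_chord off (Node A' B') off (off + leaves A1).
        apply: hA; last by rewrite -pE -qE; lia.
        by rewrite has_chord_left // has_chord_root //; lia.
      by apply: (crossing_false h3 h1); lia.
    have h3 : has_chord off (Node A' B') (off + leaves A1)
        (off + leaves A1 + leaves A2).
      apply: hA; last by rewrite -pE -qE; lia.
      by rewrite has_chord_right // has_chord_root //; lia.
    have h4 := chordsL A' B' ltac:(lia).
    by apply: (crossing_false h4 h3); lia.
  case: B' => [|C D] in lT h h1 hA chordsR lB' *; first by rewrite /= in lT; lia.
  have := leaves_gt0 C; have := leaves_gt0 D => lD lC.
  rewrite /= in lT lB'.
  have inB' i j : has_chord off (Node (Node A1 A2) B) i j ->
      ~~ ((i == p) && (j == q)) ->
      off + leaves A' <= i -> has_chord (off + leaves A') (Node C D) i j.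
    by move=> hij npij jl; rewrite -(@has_chord_right off A') // h.
  have lCE : leaves C = leaves A2.
    case: (ltngtP (leaves C) (leaves A2)) => // AC; exfalso.
      have h3 : has_chord (off + leaves A') (Node C D) (off + leaves A1)
          (off + leaves A1 + leaves A2).
        apply: inB'; [|by rewrite -pE -qE; lia|by lia].
        by rewrite has_chord_left ?has_chord_right ?has_chord_root //= ?addnA; lia.
      have h4 := has_chord_root (off + leaves A' + leaves C) (ltac:(lia) : 1 < leaves D).
      rewrite -(@has_chord_right (off + leaves A') C D) // in h4.
      by apply: (crossing_false h3 h4); lia.
    have h3 : has_chord (off + leaves A') (Node C D) (off + leaves (Node A1 A2))
        (off + leaves (Node A1 A2) + leaves B).
      apply: inB'; [|by rewrite -pE -qE /=; lia|by rewrite /=; lia].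
      by rewrite has_chord_right // has_chord_root //; lia.
    have h4 := has_chord_root (off + leaves A') (ltac:(lia) : 1 < leaves C).
    rewrite -(@has_chord_left (off + leaves A') C D) // in h4.
    by rewrite /= in h3; apply: (crossing_false h4 h3); rewrite /=; lia.
  have lDE : leaves B = leaves D by lia.
  have eA1 : A1 = A'.
    apply: (@has_chord_inj off) => // i j hij.
    have [? ? ?] := has_chord_range hij.
    rewrite -(@has_chord_left off A' (Node C D)) ?lA'E //; apply: h.
    - by rewrite has_chord_left ?has_chord_left //=; lia.
    - by rewrite -pE -qE; lia.
  have eA2 : A2 = C.
    apply: (@has_chord_inj (off + leaves A')) => // i j hij.
    have [? ? ?] := has_chord_range hij.
    rewrite -(@has_chord_left (off + leaves A') C D) ?lCE //; apply: inB' => //.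
    - by rewrite has_chord_left ?has_chord_right -?lA'E //=; lia.
    - by rewrite -pE -qE; lia.
  have eB : B = D.
    apply: (@has_chord_inj (off + leaves A' + leaves C)) => // i j hij.
    have [? ? ?] := has_chord_range hij.
    have lCDE : off + leaves A' + leaves C = off + leaves (Node A1 A2) by rewrite /=; lia.
    rewrite -(@has_chord_right (off + leaves A') C D) //; apply: inB'.
    - by rewrite has_chord_right -?lCDE.
    - by rewrite -pE -qE; lia.
    - by lia.
  by right; rewrite eA1 eA2 eB /= !mem_cat mem_head !orbT.
- have lBB : leaves B = leaves B' by lia.
  have hA i j : has_chord off A i j -> ~~ ((i == p) && (j == q)) -> has_chord off A' i j.
    move=> hij npij; have [? ? ?] := has_chord_range hij.
    by rewrite -(@has_chord_left off A' B') -?AA // h ?has_chord_left.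
  have hB i j : has_chord (off + leaves A) B i j -> ~~ ((i == p) && (j == q)) ->
      has_chord (off + leaves A) B' i j.
    move=> hij npij; have [? ? ?] := has_chord_range hij.
    by rewrite {1}AA -(@has_chord_right off A' B') -?AA // h ?has_chord_right.
  case: (boolP ((p == off) && (q == off + leaves A))) => [/andP[/eqP pE /eqP qE]|nA].
    left; congr Node.
      apply: (@has_chord_inj off) => // i j hij.
      have [/andP[/eqP-> /eqP->]|] := boolP ((i == p) && (j == q)); last exact: hA.
      by rewrite pE qE AA has_chord_root //; have [? ? ?] := has_chord_range hij; lia.
    apply: (@has_chord_inj (off + leaves A)) => // i j hij; apply: hB => //.
    by have [? ? ?] := has_chord_range hij; lia.
  case: (boolP ((p == off + leaves A) && (q == off + leaves A + leaves B))) =>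
      [/andP[/eqP pE /eqP qE]|nB].
    left; congr Node.
      apply: (@has_chord_inj off) => // i j hij; apply: hA => //.
      by have [? ? ?] := has_chord_range hij; lia.
    apply: (@has_chord_inj (off + leaves A)) => // i j hij.
    have [/andP[/eqP-> /eqP->]|] := boolP ((i == p) && (j == q)); last exact: hB.
    by rewrite pE qE lBB has_chord_root //; have [? ? ?] := has_chord_range hij; lia.
  case: (leqP q (off + leaves A)) => qA.
    have eB : B = B'.
      apply: (@has_chord_inj (off + leaves A)) => // i j hij; apply: hB => //.
      by have [? ? ?] := has_chord_range hij; lia.
    have [->|fA] := IA A' off AA nA hA; [left|right]; rewrite -eB //=.
    by rewrite !mem_cat map_f.
  have eA : A = A'.
    apply: (@has_chord_inj off) => // i j hij; apply: hA => //.
    by have [? ? ?] := has_chord_range hij; lia.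
  have [->|fB] := IB B' _ lBB nB hB; [left|right]; rewrite -eA //=.
  by rewrite !mem_cat map_f ?orbT.
Qed.

Lemma flips_sym T T' : T' \in flips T -> T \in flips T'.
Proof.
elim: T T' => [|A IA B IB] T' //=; rewrite !mem_cat => /or4P[].
- by case/mapP => A' /IA fA ->; rewrite /= !mem_cat map_f.
- by case/mapP => B' /IB fB ->; rewrite /= !mem_cat (map_f _ fB) ?orbT.
- by case: B {IB} => // B1 B2; rewrite inE => /eqP-> /=; rewrite !mem_cat mem_head !orbT.
- by case: A {IA} => // A1 A2; rewrite inE => /eqP-> /=; rewrite !mem_cat mem_head !orbT.
Qed.

Lemma flips_neq T : T \notin flips T.
Proof.
elim: T => //= A IA B IB; rewrite !mem_cat; apply/or4P; case.
- by case/mapP => A' fA [AA]; rewrite -AA (negPf IA) in fA.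
- by case/mapP => B' fB [BB]; rewrite -BB (negPf IB) in fB.
- case: B {IB} => // B1 B2; rewrite inE => /eqP[] /(congr1 leaves) /=.
  by have := leaves_gt0 B1; lia.
- case: A {IA} => // A1 A2; rewrite inE => /eqP[] /(congr1 leaves) /=.
  by have := leaves_gt0 A2; lia.
Qed.

Lemma flips_uniq T : uniq (flips T).
Proof.
elim: T => //= A IA B IB.
rewrite !cat_uniq !map_inj_uniq ?IA ?IB /=; try by move=> ? ? [].
apply/and3P; split.
- apply/hasPn => T'; rewrite !mem_cat => /or3P[/mapP[B' fB ->]||].
  + apply/mapP => -[A' fA [AA _]]; by rewrite -AA (negPf (flips_neq A)) in fA.
  + case: B {IB} => // B1 B2; rewrite inE => /eqP->; apply/mapP => -[A' fA [/(congr1 leaves) /=]].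
    by rewrite (leaves_flips fA); have := leaves_gt0 B1; lia.
  + case: A {IA} => // A1 A2; rewrite inE => /eqP->; apply/mapP => -[A' fA [/(congr1 leaves) /=]].
    by rewrite (leaves_flips fA) /=; have := leaves_gt0 A2; lia.
- apply/hasPn => T'; rewrite mem_cat => /orP[].
  + case: B {IB} => // B1 B2; rewrite inE => /eqP->; apply/mapP => -[B' fB [/(congr1 leaves) /=]].
    by have := leaves_gt0 B1; lia.
  + case: A {IA} => // A1 A2; rewrite inE => /eqP->; apply/mapP => -[B' fB [/(congr1 leaves) /=]].
    by have := leaves_gt0 A2; lia.
- case: A {IA} => [|A1 A2]; first by case: B {IB}.
  case: B {IB} => [|B1 B2] /=; first by [].
  rewrite orbF andbT inE; apply/negP => /eqP[AE _]; move/(congr1 leaves): AE => /=.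
  by have := leaves_gt0 B1; have := leaves_gt0 A2; lia.
Qed.

(** What a flip does to chords, up to exchanging the two triangulations: in
    the quadrilateral [i < m < u < j], the diagonal [(m, j)] is replaced by
    [(i, u)]. *)
Definition rotates off S S' := exists i m u j,
  let link k l := (l == k.+1) || has_chord off S k l in
  [/\ [&& i < m, m < u, u < j & has_chord off S i j],
      [&& link i m, link m u & link u j], has_chord off S m j
    & forall k l, has_chord off S' k l =
        ((k == i) && (l == u)) || (has_chord off S k l && ~~ ((k == m) && (l == j)))].

Lemma rotates_left off A A' B : leaves A' = leaves A ->
  rotates off A A' -> rotates off (Node A B) (Node A' B).
Proof.
move=> lA [i [m [u [j [/and4P[im mu uj hij] /and3P[l1 l2 l3] hmj h]]]]].
have [offi _ jA] := has_chord_range hij; have [_ _ mjA] := has_chord_range hmj.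
have sub k l : has_chord off A k l -> has_chord off (Node A B) k l.
  by move=> hA /=; rewrite hA orbT.
exists i, m, u, j; split; last 1 first.
- move=> k l /=; rewrite lA h.
  case hB: (has_chord (off + leaves A) B k l).
    have [? ? ?] := has_chord_range hB.
    rewrite !orbT /= (_ : (k == m) = false) ?orbT //; lia.
  case: (altP (k =P m)) => [->|_] /=; last by rewrite !andbT !orbF orbCA.
  case: (altP (l =P j)) => [->|_] /=; last by rewrite !andbT !orbF orbCA.
  by rewrite !andbF !orbF; have -> : (m == off) = false by lia.
- by rewrite im mu uj sub.
- apply/and3P; split; [move: l1|move: l2|move: l3] => /orP[->//|/sub->];
    by rewrite orbT.
- exact: sub.
Qed.

Lemma rotates_right off A B B' : leaves B' = leaves B ->
  rotates (off + leaves A) B B' -> rotates off (Node A B) (Node A B').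
Proof.
move=> lB [i [m [u [j [/and4P[im mu uj hij] /and3P[l1 l2 l3] hmj h]]]]].
have [offi _ jB] := has_chord_range hij; have [_ _ mjB] := has_chord_range hmj.
have sub k l : has_chord (off + leaves A) B k l -> has_chord off (Node A B) k l.
  by move=> hB /=; rewrite hB !orbT.
exists i, m, u, j; split; last 1 first.
- move=> k l /=; rewrite lB h; have lA := leaves_gt0 A.
  case hA: (has_chord off A k l).
    have [? ? ?] := has_chord_range hA; have ? : k < m by lia.
    rewrite !orbT /= (_ : (k == m) = false) ?orbT //; lia.
  case: (altP (k =P m)) => [->|_] /=; last by rewrite !andbT orbCA.
  case: (altP (l =P j)) => [->|_] /=; last by rewrite !andbT orbCA.
  by rewrite !andbF !orbF; have -> : (m == off) = false by lia.
- by rewrite im mu uj sub.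
- apply/and3P; split; [move: l1|move: l2|move: l3] => /orP[->//|/sub->];
    by rewrite orbT.
- exact: sub.
Qed.

Lemma rotates_node off A B C :
  rotates off (Node A (Node B C)) (Node (Node A B) C).
Proof.
have := leaves_gt0 A; have := leaves_gt0 B; have := leaves_gt0 C => lC lB lA.
have link o S : (o + leaves S == o.+1) || has_chord o S o (o + leaves S).
  have := leaves_gt0 S; case: (ltngtP 1 (leaves S)) => // [l1 _|<- _].
    by rewrite (has_chord_root o l1) orbT.
  by rewrite addn1 eqxx.
exists off, (off + leaves A), (off + leaves A + leaves B),
  (off + leaves A + leaves B + leaves C); split.
- by rewrite /= !eqxx !addnA eqxx /=; lia.
- by apply/and3P; split; [have := link off A|have := link (off + leaves A) B
    |have := link (off + leaves A + leaves B) C] => /orP[->//|h]; rewrite /= h !orbT.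
- by rewrite /= !eqxx !orbT.
- move=> k l /=; rewrite !addnA.
  case hA: (has_chord off A k l).
    have [? ? ?] := has_chord_range hA.
    rewrite !orbT /= (_ : (l == _) = false) ?andbF ?orbT //; lia.
  case hB: (has_chord (off + leaves A) B k l).
    have [? ? ?] := has_chord_range hB.
    rewrite !orbT /= (_ : (l == _ + leaves C) = false) ?andbF ?orbT //; lia.
  case hC: (has_chord (off + leaves A + leaves B) C k l).
    have [? _ ?] := has_chord_range hC.
    rewrite !orbT /= (_ : (k == off + leaves A) = false) ?orbT //; lia.
  rewrite !orbF.
  by lia.
Qed.

Lemma flips_rotate off T T' : T' \in flips T ->
  rotates off T T' \/ rotates off T' T.
Proof.
elim: T T' off => [|A IA B IB] T' off //=; rewrite !mem_cat => /or4P[].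
- case/mapP => A' fA ->; have lA := leaves_flips fA.
  by case: (IA _ off fA) => h; [left|right]; apply: rotates_left.
- case/mapP => B' fB ->; have lB := leaves_flips fB.
  by case: (IB _ (off + leaves A) fB) => h; [left|right]; apply: rotates_right.
- by case: B {IB} => // B1 B2; rewrite inE => /eqP->; left; apply: rotates_node.
- by case: A {IA} => // A1 A2; rewrite inE => /eqP->; right; apply: rotates_node.
Qed.

(** * The diagonals of a tree form a triangulation *)

Section Pairs.
Variable n : nat.
Implicit Types (i j k l : 'I_n.+2).

Lemma eq_pair i j k l : i < j -> k < l ->
  ([set i; j] == [set k; l]) = (i == k) && (j == l).
Proof.
move=> ij kl; apply/eqP/andP => [E|[/eqP-> /eqP->]//].
have := set21 i j; have := set22 i j; rewrite {}E !inE.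
move=> /orP[]/eqP Ej /orP[]/eqP Ei; move: ij; rewrite ?Ei ?Ej ?eqxx ?ltnn //.
by move=> lk; move: (ltn_trans kl lk); rewrite ltnn.
Qed.

Lemma card2_pair (d : {set 'I_n.+2}) : #|d| == 2 ->
  exists i, exists2 j : 'I_n.+2, (i < j)%N & d = [set i; j].
Proof.
case/cards2P => a [b [ab ->]].
have [ltab|ltba|/val_inj E] := ltngtP a b; first by exists a, b.
  by exists b, a; rewrite // setUC.
by rewrite E eqxx in ab.
Qed.

Lemma side_pair i j : i < j ->
  side [set i; j] = (j == i.+1 :> nat) || (i == 0 :> nat) && (j == n.+1 :> nat).
Proof.
move=> ij; apply/existsP/orP => [[k /eqP E]|H].
  have vS : (ordS k : nat) = k.+1 %% n.+2 by [].
  have := ltn_ord k; rewrite ltnS leq_eqVlt => /orP[/eqP kE|kn].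
    have SE : (ordS k : nat) = 0 by rewrite vS kE modnn.
    have lt : ordS k < k by rewrite SE kE.
    move/eqP: E; rewrite [X in _ == X]setUC eq_pair // => /andP[/eqP-> /eqP->].
    by right; rewrite SE kE !eqxx.
  have SE : (ordS k : nat) = k.+1 by rewrite vS modn_small.
  have lt : k < ordS k by rewrite SE.
  move/eqP: E; rewrite eq_pair // => /andP[/eqP-> /eqP->].
  by left; rewrite SE.
case: H => [/eqP jE|/andP[/eqP iE /eqP jE]].
  exists i; have -> : j = ordS i; last by [].
  by apply: val_inj; rewrite /= jE modn_small // -jE.
exists j; have -> : i = ordS j; last by rewrite setUC.
by apply: val_inj; rewrite /= iE jE modnn.
Qed.

Lemma diagonal_pair i j : i < j -> diagonal [set i; j] =
  (i.+1 < j) && ~~ ((i == 0 :> nat) && (j == n.+1 :> nat)).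
Proof.
move=> ij; rewrite /diagonal side_pair // cards2.
have -> : i != j by apply: contraTneq ij => ->; rewrite ltnn.
rewrite eqxx negb_or /=; congr (_ && _); lia.
Qed.

Lemma diagonalP (d : {set 'I_n.+2}) : diagonal d ->
  exists i, exists j : 'I_n.+2, [/\ i < j, d = [set i; j], i.+1 < j
    & ~~ ((i == 0 :> nat) && (j == n.+1 :> nat))].
Proof.
move=> dd; have /andP[/card2_pair[i [j ij E]] _] := dd.
by exists i, j; move: dd; rewrite E diagonal_pair // => /andP[].
Qed.

Lemma interleave_pair i j k l : i < j -> k < l ->
  interleave [set i; j] [set k; l] = [&& i < k, k < j & j < l].
Proof.
move=> ij kl; apply/idP/idP.
  case/existsP => a /existsP[b /existsP[c /existsP[f]]].
  case/and5P => ab bc cf E E'.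
  have ac := ltn_trans ab bc; have bf := ltn_trans bc cf.
  rewrite eq_pair // in E; rewrite eq_pair // in E'.
  by case/andP: E => /eqP-> /eqP->; case/andP: E' => /eqP-> /eqP->; apply/and3P.
move=> /and3P[ik kj jl].
apply/existsP; exists i; apply/existsP; exists k; apply/existsP; exists j.
by apply/existsP; exists l; rewrite ik kj jl !eqxx.
Qed.

Lemma crossing_pair i j k l : i < j -> k < l ->
  crossing [set i; j] [set k; l] =
  [&& i < k, k < j & j < l] || [&& k < i, i < l & l < j].
Proof. by move=> ij kl; rewrite /crossing !interleave_pair. Qed.

(** The chords of a tree other than its root side, which is the side
    [{0, n.+1}] of the polygon. *)
Definition tree_diagonals (T : tree) : {set {set 'I_n.+2}} :=
  [set d : {set 'I_n.+2} | [exists i : 'I_n.+2, exists j : 'I_n.+2,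
    [&& d == [set i; j], has_chord 0 T i j
      & ~~ ((i == 0 :> nat) && (j == n.+1 :> nat))]]].

Lemma tree_diagonals_pair T i j : i < j ->
  ([set i; j] \in tree_diagonals T) =
  has_chord 0 T i j && ~~ ((i == 0 :> nat) && (j == n.+1 :> nat)).
Proof.
move=> ij; rewrite inE; apply/idP/idP.
  case/existsP => k /existsP[l /and3P[E h r]].
  have kl : k < l by case/has_chord_range: h => _ /ltnW.
  by move: E; rewrite eq_pair // => /andP[/eqP-> /eqP->]; rewrite h r.
by move=> H; apply/existsP; exists i; apply/existsP; exists j; rewrite eqxx.
Qed.

Lemma tree_diagonals_diagonal T d : d \in tree_diagonals T -> diagonal d.
Proof.
rewrite inE => /existsP[i /existsP[j /and3P[/eqP-> h r]]].
have [_ ij _] := has_chord_range h.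
by rewrite diagonal_pair ?ij ?r // ltnW.
Qed.

Lemma noncrossing_tree_diagonals T : noncrossing_diagonals (tree_diagonals T).
Proof.
apply/andP; split; first by apply/forall_inP => d /tree_diagonals_diagonal.
apply/forall_inP => d dT; apply/forall_inP => e eT.
have /diagonalP[i [j [ij E _ _]]] := tree_diagonals_diagonal dT.
have /diagonalP[k [l [kl E' _ _]]] := tree_diagonals_diagonal eT.
move: dT eT; rewrite {}E {}E' !tree_diagonals_pair // => /andP[hd _] /andP[he _].
rewrite crossing_pair // negb_or.
by rewrite (has_chord_noncrossing hd he) (has_chord_noncrossing he hd).
Qed.

Lemma has_chord_diagonal T i j : i < j ->
  (j == i.+1 :> nat) || has_chord 0 T i j ->
  side [set i; j] || ([set i; j] \in tree_diagonals T).
Proof.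
move=> ij; rewrite side_pair // tree_diagonals_pair // => /orP[->//|->].
by case: (_ && _); rewrite ?orbT.
Qed.

Lemma tree_diagonals_triangulation T : leaves T = n.+1 ->
  is_triangulation (tree_diagonals T).
Proof.
move=> leavesT; apply/maxsetP; split; first exact: noncrossing_tree_diagonals.
move=> D /andP[/forall_inP Dd /forall_inP DX] TD.
apply/eqP; rewrite eqEsubset TD andbT; apply/subsetP => d dD.
have /diagonalP[i [j [ij E ij1 nr]]] := Dd _ dD.
rewrite E tree_diagonals_pair // nr andbT.
apply/negPn/negP => nh.
have jT : j <= 0 + leaves T by have := ltn_ord j; lia.
have [k [l [hkl cr]]] := has_chord_maximal (leq0n i) ij1 jT nh.
have [_ kl ln] := has_chord_range hkl.
have [/andP[/eqP k0 /eqP l0]|nr'] := boolP ((k == 0) && (l == n.+1)).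
  by have := ltn_ord j; lia.
have ltl : l < n.+2 by lia.
have ltk : k < n.+2 by lia.
have ltkl : Ordinal ltk < Ordinal ltl by apply: ltnW.
have /(subsetP TD) eD : [set Ordinal ltk; Ordinal ltl] \in tree_diagonals T.
  by rewrite tree_diagonals_pair // hkl.
have /forall_inP/(_ _ eD) := DX _ dD.
rewrite E crossing_pair //= negb_or => /andP[/negP nc /negP nc'].
by case: cr.
Qed.

End Pairs.

(** * Every triangulation comes from a tree *)

Section Surjective.
Variables (n : nat) (S : {set {set 'I_n.+2}}).
Hypothesis S_max : is_triangulation S.

(** Sides and diagonals of [S], for vertices that are natural numbers as in
    [has_chord]. *)
Definition drawn i j :=
  [|| j == i.+1, (i == 0) && (j == n.+1) |
    [&& i < j, j <= n.+1 & [set inord i; inord j] \in S]].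

Lemma triangulation_diagonal (d : {set 'I_n.+2}) : d \in S -> diagonal d.
Proof. by case/maxsetP: S_max => /andP[/forall_inP h _] _ /h. Qed.

Lemma triangulation_noncrossing (i j k l : 'I_n.+2) :
  [set i; j] \in S -> [set k; l] \in S -> i < k -> k < j -> j < l -> False.
Proof.
case/maxsetP: S_max => /andP[_ /forall_inP h] _ /h/forall_inP h' /h'.
move=> + ik kj jl; have ij := ltn_trans ik kj; have kl := ltn_trans kj jl.
by rewrite crossing_pair // ik kj jl.
Qed.

Lemma drawn_noncrossing i j k l : drawn i j -> drawn k l -> l <= n.+1 ->
  i < k -> k < j -> j < l -> False.
Proof.
move=> /or3P[/eqP->|/andP[/eqP-> /eqP->]|/and3P[ij jn hS]]; try lia.
move=> /or3P[/eqP->|/andP[/eqP-> /eqP->]|/and3P[kl ln hS']] *; try lia.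
by apply: (triangulation_noncrossing hS hS'); rewrite !inordK //; lia.
Qed.

Lemma drawn_maximal i j : i.+1 < j -> j <= n.+1 ->
  (forall k l, drawn k l -> l <= n.+1 ->
    ~ (([&& k < i, i < l & l < j]) \/ [&& i < k, k < j & j < l])) ->
  drawn i j.
Proof.
move=> ij jn nc; apply/or3P.
have [root|nroot] := boolP ((i == 0) && (j == n.+1)); first exact: Or32.
apply: Or33; rewrite jn ltnW //=.
have lti : i < n.+2 by lia.
have ltj : j < n.+2 by lia.
pose d : {set 'I_n.+2} := [set inord i; inord j].
have iE : (inord i : 'I_n.+2) = i :> nat by rewrite inordK.
have jE : (inord j : 'I_n.+2) = j :> nat by rewrite inordK.
have ltij : (inord i : 'I_n.+2) < (inord j : 'I_n.+2) by rewrite iE jE ltnW.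
have dd : diagonal d by rewrite diagonal_pair // iE jE ij.
have ncd e : e \in S -> ~~ crossing d e && ~~ crossing e d.
  move=> eS; have /diagonalP[k [l [kl eE _ _]]] := triangulation_diagonal eS.
  have dr : drawn k l.
    by apply/or3P/Or33; rewrite kl -ltnS ltn_ord !inord_val -eE.
  have := nc _ _ dr; rewrite -ltnS ltn_ord => /(_ isT) {}nc.
  rewrite eE !crossing_pair // iE jE -negb_or [X in _ || X]orbC orbb.
  by apply/negP => /orP cr; apply: nc; tauto.
case/maxsetP: S_max => /andP[/forall_inP Sd /forall_inP SX] /(_ (d |: S)) max.
have <- : d |: S = S; last exact: setU11.
apply: max; last exact: subsetUr.
apply/andP; split.
  by apply/forall_inP => e /setU1P[->//|/Sd].
apply/forall_inP => e /setU1P[->|eS]; apply/forall_inP => e' /setU1P[->|e'S].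
- by rewrite crossing_pair // !ltnn.
- by case/andP: (ncd _ e'S).
- by case/andP: (ncd _ eS).
- by have /forall_inP/(_ _ e'S) := SX _ eS.
Qed.

(** The leftmost side of the triangle below [(i, j)] joins [i] to the last
    vertex [m < j] to which it is drawn; by maximality [(m, j)] is drawn too. *)
Lemma drawn_tree i j : i < j -> j <= n.+1 -> drawn i j ->
  exists2 T, leaves T = j - i & forall k l, has_chord i T k l -> drawn k l.
Proof.
have [s] := ubnP (j - i); elim: s i j => // s IH i j js ij jn dij.
have [j1|j1] := eqVneq j i.+1.
  by exists Leaf; rewrite //= j1; lia.
pose P m := (m < j) && (i < m) && drawn i m.
have exP : exists m, P m.
  by exists i.+1; rewrite /P /drawn eqxx /= andbT; lia.
have ubP m : P m -> m <= j by case/andP => /andP[/ltnW].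
case: (ex_maxnP exP ubP) => m /andP[/andP[mj im] dim] mmax.
have dmj : drawn m j.
  have [->|m1] := eqVneq j m.+1; first by rewrite /drawn eqxx.
  apply: drawn_maximal => // [|k l dkl ln]; first by lia.
  case=> [/and3P[km ml lj]|/and3P[mk kj jl]]; last first.
    by apply: (drawn_noncrossing dij dkl) => //; lia.
  have [ki|ik|kE] := ltngtP k i.
  - exact: (drawn_noncrossing dkl dij _ ki (ltn_trans im ml) lj).
  - exact: (drawn_noncrossing dim dkl _ ik km ml).
  - by have := mmax l; rewrite /P -kE dkl; lia.
have mn : m <= n.+1 by lia.
have [|A lA hA] := IH i m _ im mn dim; first by lia.
have [|B lB hB] := IH m j _ mj jn dmj; first by lia.
exists (Node A B) => [|k l /=]; first by rewrite /= lA lB; lia.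
rewrite lA lB (_ : i + (m - i) = m) 1?(_ : m + (j - m) = j); try lia.
by case/or3P => [/andP[/eqP-> /eqP->]|/hA|/hB].
Qed.

Lemma triangulation_tree : exists2 T, leaves T = n.+1 & S = tree_diagonals n T.
Proof.
have d0 : drawn 0 n.+1 by rewrite /drawn !eqxx orbT.
have [T lT hT] := drawn_tree (ltn0Sn n) (leqnn _) d0; rewrite subn0 in lT.
exists T => //; have /maxsetP[_ max] := tree_diagonals_triangulation lT.
have /maxsetP[ncS _] := S_max; apply: max => //.
apply/subsetP => d dT.
have /diagonalP[i [j [ij E ij1 nr]]] := tree_diagonals_diagonal dT.
move: dT; rewrite E tree_diagonals_pair // => /andP[/hT + _].
rewrite /drawn (negPf nr) !inord_val => /or3P[/eqP jE|//|/and3P[]//].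
by rewrite jE ltnn in ij1.
Qed.

End Surjective.

(** * Flips of triangulations and flips of trees *)
Section Adjacency.
Variable n : nat.
Variables T T' : tree.
Hypotheses (leavesT : leaves T = n.+1) (leavesT' : leaves T' = n.+1).

Lemma tree_diagonals_chord i j : has_chord 0 T i j -> forall U : tree,
  leaves U = n.+1 ->
  (forall k l : 'I_n.+2, k = i :> nat -> l = j :> nat ->
    [set k; l] \in tree_diagonals n T -> [set k; l] \in tree_diagonals n U) ->
  has_chord 0 U i j.
Proof.
move=> hT U lU H; have [_ ij jn] := has_chord_range hT.
have [/andP[/eqP-> /eqP jE]|nr] := boolP ((i == 0) && (j == n.+1)).
  have := @has_chord_root 0 U; rewrite lU jE add0n; apply; move: ij; rewrite jE; lia.
have ltj : j < n.+2 by move: jn; rewrite leavesT.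
have lti : i < n.+2 by lia.
have ltij : Ordinal lti < Ordinal ltj by apply: ltnW.
have := H (Ordinal lti) (Ordinal ltj) erefl erefl.
by rewrite !tree_diagonals_pair // hT nr !andbT; apply.
Qed.

Lemma tree_diagonals_inj : tree_diagonals n T = tree_diagonals n T' -> T = T'.
Proof.
move=> E; apply: (@has_chord_inj 0) => [|i j hij]; first by rewrite leavesT.
by apply: (tree_diagonals_chord hij) => // k l _ _; rewrite E.
Qed.

(** All diagonals except [d] are kept, and the new one is disjoint from [d], so
    that the two trees differ. *)
Lemma flip_flips :
  flip (tree_diagonals n T) (tree_diagonals n T') -> T' \in flips T.
Proof.
case/exists_inP => d dT /existsP[t1 /existsP[t2 /and5P[_ _ _ _ /andP[_ /eqP E]]]].
have /diagonalP[p [q [pq dE pq1 nr]]] := tree_diagonals_diagonal dT.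
have dT' : d \notin tree_diagonals n T'.
  rewrite E !inE eqxx /= orbF dE; apply/eqP => /setP/(_ p).
  by rewrite !inE eqxx.
have [|||TT'|//] := @has_chord_flip 0 T T' p q.
- by rewrite leavesT.
- by rewrite add0n leavesT.
- move=> i j hij nij; apply: (tree_diagonals_chord hij) => // k l kE lE klT.
  rewrite E in_setU1 in_setD1 klT andbT; apply/orP; right; rewrite dE.
  apply/negP => /eqP klE; have kl : k < l.
    by rewrite kE lE ltnW //; have [] := has_chord_range hij.
  move/eqP: klE; rewrite eq_pair // => /andP[/eqP kp /eqP lq].
  by move: nij; rewrite -kE -lE kp lq !eqxx.
- by rewrite -TT' dT in dT'.
Qed.

Lemma triangle_triple (a b c : 'I_n.+2) (D : {set {set 'I_n.+2}}) :
  a < b -> b < c ->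
  side [set a; b] || ([set a; b] \in D) ->
  side [set b; c] || ([set b; c] \in D) ->
  side [set a; c] || ([set a; c] \in D) -> triangle D [set a; b; c].
Proof.
move=> ab bc Dab Dbc Dac; have ac := ltn_trans ab bc.
have nab : a != b by apply: contraTneq ab => ->; rewrite ltnn.
have nbc : b != c by apply: contraTneq bc => ->; rewrite ltnn.
have nac : a != c by apply: contraTneq ac => ->; rewrite ltnn.
apply/andP; split.
  by rewrite setUC cardsU1 !inE cards2 nab negb_or !(eq_sym c) nac nbc.
apply/forallP => e; apply/implyP => /andP[et /card2_pair[k [l kl E]]].
have := subsetP et k; have := subsetP et l; rewrite E !inE !eqxx !orbT /=.
move=> /(_ isT) /orP[/orP[]|] /eqP lE /(_ isT) /orP[/orP[]|] /eqP kE.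
all: move: kl; rewrite lE kE ?ltnn // => kl.
- by move: (ltn_trans kl ab); rewrite ltnn.
- by move: (ltn_trans kl ac); rewrite ltnn.
- by move: (ltn_trans kl bc); rewrite ltnn.
Qed.

Lemma rotates_flip : rotates 0 T T' ->
  flip (tree_diagonals n T) (tree_diagonals n T').
Proof.
move=> [i' [m' [u' [j' [/and4P[im mu uj hij] /and3P[l1 l2 l3] hmj h]]]]].
have [_ _ jn] := has_chord_range hij; rewrite add0n leavesT in jn.
have [j jE] : exists j : 'I_n.+2, j' = j by exists (inord j'); rewrite inordK //; lia.
have [i iE] : exists i : 'I_n.+2, i' = i by exists (inord i'); rewrite inordK //; lia.
have [m mE] : exists m : 'I_n.+2, m' = m by exists (inord m'); rewrite inordK //; lia.
have [u uE] : exists u : 'I_n.+2, u' = u by exists (inord u'); rewrite inordK //; lia.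
move: im mu uj hij l1 l2 l3 hmj h; rewrite {}iE {}jE {}mE {}uE.
move=> im mu uj hij l1 l2 l3 hmj h.
have mj := ltn_trans mu uj; have iu := ltn_trans im mu; have ij := ltn_trans im mj.
apply/exists_inP; exists [set m; j].
  by rewrite tree_diagonals_pair // hmj /=; lia.
apply/existsP; exists [set i; m; j]; apply/existsP; exists [set m; u; j].
have edge := @has_chord_diagonal n T.
apply/and5P; split.
- apply: triangle_triple => //; apply: edge; rewrite ?hmj ?hij ?orbT //.
- apply: triangle_triple => //; apply: edge; rewrite ?hmj ?hij ?orbT //.
- apply/eqP => /setP/(_ i); rewrite !inE eqxx /= => /esym/orP[/orP[]|] /eqP E.
  + by rewrite E ltnn in im.
  + by rewrite E ltnn in iu.
  + by rewrite E ltnn in ij.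
- by apply/subsetP => x; rewrite !inE => /orP[]->; rewrite ?orbT.
apply/andP; split; first by apply/subsetP => x; rewrite !inE => /orP[]->; rewrite ?orbT.
have -> : ([set i; m; j] :|: [set m; u; j]) :\: [set m; j] = [set i; u].
  have im' : (i == m) = false by apply/eqP => E; rewrite E ltnn in im.
  have ij' : (i == j) = false by apply/eqP => E; rewrite E ltnn in ij.
  have um' : (u == m) = false by apply/eqP => E; rewrite E ltnn in mu.
  have uj' : (u == j) = false by apply/eqP => E; rewrite E ltnn in uj.
  apply/setP => x; rewrite !inE.
  have [->|xi] := eqVneq x i; first by rewrite im' ij'.
  have [->|xu] := eqVneq x u; first by rewrite um' uj' !orbT.
  by rewrite /=; case: (x == m); case: (x == j).
apply/eqP/setP => d; rewrite in_setU1 in_setD1.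
have [dd|ndd] := boolP (diagonal d); last first.
  have nT U : d \in tree_diagonals n U = false.
    by apply: contraNF ndd; apply: tree_diagonals_diagonal.
  rewrite !nT andbF orbF; apply/esym/negP => /eqP dE; move: ndd.
  by have := ltn_ord j; rewrite dE diagonal_pair //; lia.
have /diagonalP[k [l [kl -> _ nr]]] := dd.
by rewrite !tree_diagonals_pair // !eq_pair // nr h !andbT [_ && ~~ _]andbC.
Qed.

End Adjacency.

Lemma flip_or_flips n T T' : leaves T = n.+1 -> leaves T' = n.+1 ->
  flip (tree_diagonals n T) (tree_diagonals n T') ||
  flip (tree_diagonals n T') (tree_diagonals n T) = (T' \in flips T).
Proof.
move=> lT lT'; apply/idP/idP => [/orP[]/flip_flips|/(flips_rotate 0)[]/rotates_flip].
- exact.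
- by move=> h; apply: flips_sym; apply: h.
- by move->.
- by move->; rewrite ?orbT.
Qed.

Local Open Scope ring_scope.

(** * Edge boundary and energy *)

Section Transfer.
Variables (R : realType) (n : nat).
Notation V := (triangulation n).

Lemma perm_tree_diagonals :
  perm_eq [seq val x | x <- index_enum V] [seq tree_diagonals n T | T <- trees n.+1].
Proof.
apply: uniq_perm.
- by rewrite map_inj_uniq ?index_enum_uniq //; apply: val_inj.
- rewrite map_inj_in_uniq ?trees_uniq // => T T'.
  by rewrite !mem_trees => /eqP lT /eqP lT'; apply: tree_diagonals_inj.
move=> A; apply/mapP/mapP => [[x _ ->]|].
  by have [T lT ->] := triangulation_tree (valP x); exists T; rewrite // mem_trees lT.
case=> T; rewrite mem_trees => /eqP lT ->.
by exists (Sub _ (tree_diagonals_triangulation lT) : V); rewrite ?mem_index_enum ?SubK.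
Qed.

Lemma sum_triangulations (F : {set {set 'I_n.+2}} -> R) :
  \sum_(x : V) F (val x) = \sum_(T <- trees n.+1) F (tree_diagonals n T).
Proof.
rewrite -(big_map (fun x : V => val x) xpredT F).
by rewrite (perm_big _ perm_tree_diagonals) big_map.
Qed.

Lemma card_triangulations : #|{: V}| = size (trees n.+1).
Proof.
have /perm_size := perm_tree_diagonals; rewrite !size_map => <-.
by rewrite cardT enumT.
Qed.

Lemma sum_mem (I : finType) (A : {set I}) : \sum_(x : I) (x \in A)%:R = #|A|%:R :> R.
Proof.
rewrite -sum1_card natr_sum [in RHS]big_mkcond.
by apply: eq_bigr => x _; case: (x \in A).
Qed.

Variable S : {set V}.

Definition tree_indicator (T : tree) : R := (tree_diagonals n T \in val @: S)%:R.

Lemma sum_tree_indicator : \sum_(T <- trees n.+1) tree_indicator T = #|S|%:R.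
Proof.
rewrite /tree_indicator -(sum_triangulations (fun A => (A \in val @: S)%:R)).
under eq_bigr => x _ do rewrite (mem_imset _ _ val_inj).
exact: sum_mem.
Qed.

Lemma gradient_flips f T : leaves T = n.+1 -> gradient f T =
  \sum_(T' <- trees n.+1) if flip (tree_diagonals n T) (tree_diagonals n T') ||
       flip (tree_diagonals n T') (tree_diagonals n T) then `|f T - f T'| else 0 :> R.
Proof.
move=> lT; rewrite -big_mkcond /gradient -big_filter; apply: perm_big.
apply: uniq_perm; rewrite ?flips_uniq ?filter_uniq ?trees_uniq // => T'.
rewrite mem_filter mem_trees.
have [lT'|lT'] := eqVneq (leaves T') n.+1; first by rewrite flip_or_flips ?andbT.
by rewrite andbF; apply: contra_neqF lT' => /leaves_flips->.
Qed.

(** An edge of the boundary is counted from both of its ends. *)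
Lemma energy_indicator :
  energy n.+1 tree_indicator = 2 * #|edge_boundary (@associahedron n) S|%:R.
Proof.
pose g (A B : {set {set 'I_n.+2}}) : R := if flip A B || flip B A then
  `|(A \in val @: S)%:R - (B \in val @: S)%:R| else 0.
have -> : energy n.+1 tree_indicator = \sum_(x : V) \sum_(y : V) g (val x) (val y).
  under eq_bigr => x _ do rewrite sum_triangulations.
  rewrite (sum_triangulations (fun A => \sum_(T' <- _) g A (tree_diagonals n T'))).
  rewrite /energy big_seq [RHS]big_seq; apply: eq_bigr => T.
  by rewrite mem_trees => /eqP lT; rewrite gradient_flips.
pose b (x y : V) := (x, y) \in edge_boundary (@associahedron n) S.
have gE x y : g (val x) (val y) = (b x y)%:R + (b y x)%:R.
  rewrite /g /b !inE /= !(mem_imset _ _ val_inj) /associahedron.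
  rewrite [flip (val y) _ || _]orbC.
  case: (_ || _); case: (x \in S); case: (y \in S);
    by rewrite /= ?subrr ?subr0 ?sub0r ?normrN ?normr0 ?normr1 ?addr0 ?add0r.
have bE : \sum_(x : V) \sum_(y : V) (b x y)%:R =
    #|edge_boundary (@associahedron n) S|%:R :> R.
  by rewrite pair_big /= -sum_mem; apply: eq_bigr => -[x y] _.
under eq_bigr => x _ do (under eq_bigr => y _ do rewrite gE; rewrite big_split).
rewrite big_split /= bE [X in _ + X]exchange_big /= bE; lra.
Qed.

End Transfer.

(** * Bounds on the expansion *)

Lemma card_triangulations_gt1 n : (1 < n)%N -> (1 < #|{: triangulation n}|)%N.
Proof.
move=> n1; rewrite card_triangulations.
have : (0 < size (trees n.-1))%N by apply: trees_size_gt0; lia.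
case E: (trees n.-1) => [//|A s] _.
have /eqP lA : leaves A == n.-1 by rewrite -mem_trees E mem_head.
pose T1 := Node Leaf (Node Leaf A); pose T2 := Node (Node Leaf Leaf) A.
have : uniq [:: T1; T2] by [].
move/uniq_leq_size; apply=> T.
by rewrite !inE => /orP[]/eqP->; rewrite mem_trees /= lA; lia.
Qed.

Section Bounds.
Variable R : realType.

(** A set with at most half of the triangulations deviates from its mean by at
    least half of its size. *)
Lemma expansion_ge : exists2 c : R, 0 < c & forall n, (1 < n)%N ->
  c / Num.sqrt n%:R <= edge_expansion R (@associahedron n).
Proof.
have [K K0 HK] := tree_poincare R.
exists (8 * K)^-1 => [|n n1]; first by rewrite invr_gt0 mulr_gt0.
have [[S /andP[S0 SV] ->] _] :=
  edge_expansion_min R (@associahedron n) (card_triangulations_gt1 n1).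
set f := tree_indicator R S; set k : R := #|S|%:R.
have k0 : 0 < k by rewrite ltr0n.
have sumf : \sum_(T <- trees n.+1) f T = k by exact: sum_tree_indicator.
have dev : k / 2 <= mean_dev (trees n.+1) f.
  have m2 : mean (trees n.+1) f <= 2^-1.
    rewrite /mean sumf -card_triangulations ler_pdivrMr; last first.
      by rewrite ltr0n; apply: leq_trans (card_triangulations_gt1 n1).
    have : (#|S|.*2%:R <= #|{: triangulation n}|%:R :> R) by rewrite ler_nat.
    by rewrite -muln2 natrM -/k => ?; lra.
  rewrite -sumf mulr_suml; apply: ler_sum => T _.
  have [->|->] : f T = 1 \/ f T = 0.
  - by rewrite /f /tree_indicator; case: (_ \in _); [left|right].
  - by apply: le_trans (ler_norm _); lra.
  - by rewrite mul0r.
have := le_trans dev (HK n.+1 f isT); rewrite energy_indicator => le_bd.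
have nR : 0 < Num.sqrt n%:R :> R by rewrite sqrtr_gt0 ltr0n; lia.
have n2 : Num.sqrt n.+1%:R <= 2 * Num.sqrt n%:R :> R.
  have -> : 2 = Num.sqrt (4 : R) by rewrite (_ : 4 = 2 ^+ 2) ?sqrtr_sqr ?ger0_norm //; ring.
  by rewrite -sqrtrM //; apply: ler_wsqrtr; rewrite -natrM ler_nat; lia.
rewrite /edge_ratio -/k ler_pdivlMr //.
set b : R := #|_|%:R in le_bd *.
have b0 : 0 <= b by [].
rewrite -invfM mulrC ler_pdivrMr; last by rewrite !mulr_gt0.
have : K * Num.sqrt n.+1%:R * (2 * b) <= K * (2 * Num.sqrt n%:R) * (2 * b).
  by apply: ler_wpM2r; [lra|apply: ler_wpM2l => //; exact: ltW].
by move=> le2; have := le_trans le_bd le2; lra.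
Qed.

Section Cut.
Variables (n : nat) (p : pred tree).

Definition cut_triangulations : {set triangulation n} :=
  [set x | val x \in [seq tree_diagonals n T | T <- trees n.+1 & p T]].

Lemma tree_indicator_cut T : leaves T = n.+1 ->
  tree_indicator R cut_triangulations T = (p T)%:R.
Proof.
move=> lT; rewrite /tree_indicator; congr (nat_of_bool _)%:R; apply/imsetP/idP.
  case=> x + E; rewrite inE -E => /mapP[T']; rewrite mem_filter mem_trees.
  by case/andP=> pT' /eqP lT' /(tree_diagonals_inj lT lT')->.
move=> pT; exists (Sub _ (tree_diagonals_triangulation lT) : triangulation n).
  by rewrite inE SubK map_f // mem_filter pT mem_trees lT /=.
by rewrite SubK.
Qed.

Lemma energy_cut :
  energy n.+1 (fun T => (p T)%:R) = 2 * #|edge_boundary (@associahedron n) cut_triangulations|%:R :> R.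
Proof.
rewrite -energy_indicator /energy !big_seq; apply: eq_bigr => T.
rewrite mem_trees => /eqP lT; apply: eq_gradient => T' lT'.
by rewrite tree_indicator_cut // lT'.
Qed.

Lemma card_cut : #|cut_triangulations| = count p (trees n.+1).
Proof.
apply/eqP; rewrite -(eqr_nat R) -sum_tree_indicator -sum1_count natr_sum.
apply/eqP; rewrite [RHS]big_mkcond /= !big_seq; apply: eq_bigr => T; rewrite mem_trees => /eqP lT.
by rewrite tree_indicator_cut //; case: (p T).
Qed.

Lemma expansion_le_cut (c : R) : (1 < n)%N ->
  (0 < count p (trees n.+1))%N -> ((count p (trees n.+1)).*2 <= size (trees n.+1))%N ->
  energy n.+1 (fun T => (p T)%:R) <= c * (count p (trees n.+1))%:R ->
  edge_expansion R (@associahedron n) <= c.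
Proof.
rewrite -!card_cut -card_triangulations energy_cut => n1 S0 SV le_c.
have [_ min] := edge_expansion_min R (@associahedron n) (card_triangulations_gt1 n1).
apply: le_trans (min cut_triangulations _) _; first by rewrite /expansion_set S0.
rewrite /edge_ratio ler_pdivrMr ?ltr0n //; apply: le_trans le_c.
by rewrite ler_peMl // ler1n.
Qed.

End Cut.

Lemma energy_predC s (p : pred tree) :
  energy s (fun T => (predC p T)%:R) = energy s (fun T => (p T)%:R) :> R.
Proof.
apply: eq_bigr => T _; apply: eq_bigr => T' _ /=.
by case: (p T); case: (p T'); rewrite /= ?subrr ?subr0 ?sub0r ?normrN.
Qed.

(** The smaller side of the sparse cut is admissible. *)
Lemma expansion_le : exists2 C : R, 0 < C & forall n, (3 < n)%N ->
  edge_expansion R (@associahedron n) <= C / Num.sqrt n%:R.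
Proof.
have [C C0 HC] := sparse_cut R; exists C => // n n3.
have [|p Hp] := HC n.+1; first by lia.
have key q : q = p \/ q = predC p -> ((count q (trees n.+1)).*2 <= size (trees n.+1))%N ->
    edge_expansion R (@associahedron n) <= C / Num.sqrt n%:R.
  move=> qp q2; have [q0 le_q] := Hp q qp.
  apply: le_trans (_ : C / Num.sqrt n.+1%:R <= _).
    apply: (@expansion_le_cut n q) => //; first by lia.
    by apply: le_trans le_q; case: qp => ->; rewrite ?energy_predC.
  rewrite ler_pM2l // lef_pV2 ?posrE ?sqrtr_gt0 ?ltr0n //; last by lia.
  by apply: ler_wsqrtr; rewrite ler_nat.
have [half|half] := leqP (count p (trees n.+1)).*2 (size (trees n.+1)).
  by apply: key half; left.
by apply: (key (predC p)); [right|move: half; rewrite -(count_predC p); lia].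
Qed.

End Bounds.

Local Open Scope classical_set_scope.
Local Open Scope ring_scope.

Theorem theorem2 (R : realType) :
  ((fun n : nat => edge_expansion R (@associahedron n) : R^o)
     =Omega_\oo (fun n : nat => (Num.sqrt n%:R * ln n%:R)^-1 : R^o)) /\
  ((fun n : nat => edge_expansion R (@associahedron n) : R^o)
     =O_\oo (fun n : nat => (Num.sqrt n%:R)^-1 : R^o)).
Proof.
have [c c0 lower] := expansion_ge R; have [C C0 upper] := expansion_le R.
have sqrt0 n : (1 < n)%N -> 0 < Num.sqrt (n%:R : R).
  by move=> n1; rewrite sqrtr_gt0 ltr0n ltnW.
have exp0 n : (1 < n)%N -> 0 <= edge_expansion R (@associahedron n).
  move=> n1; apply: le_trans (lower n n1); apply: divr_ge0; first exact: ltW.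
  exact: sqrtr_ge0.
split.
  rewrite eqOmegaE qualifE; apply/asboolP.
  have l2 : 0 < ln (2 : R) by rewrite ln_gt0 // ltr1n.
  exists (c * ln 2) => [|]; first exact: mulr_gt0.
  near=> n; have n1 : (1 < n)%N by near: n; exists 2%N.
  rewrite /= [leRHS]ger0_norm ?exp0 //; apply: le_trans (lower n n1).
  (* The logarithm only weakens the bound. *)
  have ln2n : ln (2 : R) <= ln n%:R.
    by rewrite ler_ln ?posrE ?ltr0n ?(ltnW n1) // ler_nat.
  have lnn : 0 < ln (n%:R : R) by apply: lt_le_trans ln2n.
  rewrite ger0_norm; last by rewrite invr_ge0 mulr_ge0 // ltW // sqrt0.
  rewrite invfM mulrCA mulrA [leRHS]mulrC -mulrA ler_wpM2l ?invr_ge0 ?sqrtr_ge0 //.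
  by rewrite -mulrA ger_pMr // ler_pdivrMr // mul1r.
apply/eqO_exP; exists C => //.
near=> n; have n3 : (3 < n)%N by near: n; exists 4%N.
have n1 : (1 < n)%N by apply: leq_trans n3.
rewrite /= ger0_norm ?exp0 //; apply: le_trans (upper n n3) _.
by rewrite ger0_norm // invr_ge0 sqrtr_ge0.
Unshelve. all: by end_near.
Qed.
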